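(* Let $F:\overline{D}\to\mathbb{C}$ be continuous and assume that $\sup_{\partial D}|F|<1$. For $r\in(0,1]$ and $j\in\mathbb{Z}$ let $A_j(r)$ denote the $j$-th Fourier coefficient of $\theta\mapsto F(re^{i\theta})$. Assume that $$\sum_{n\in\mathbb{Z}}\frac{|A_n(r)|}{r^n}<1\qquad\text{for all } r\in(0,1].$$ Let $\Omega_1\subset\mathbb{C}^2$ be an open neighbourhood of $\Gamma(F)\cup(\partial D\times D)$, and let $\Omega_2\subset\mathbb{C}^2$ be any connected open set satisfying $$\partial D\times D\ \subset\ \overline{\Omega_2}\ \subset\ \Omega_1\cap\big(\{z\in\mathbb{C}:|z|\ge 1\}\times D\big),$$ where $\overline{\Omega_2}$ denotes the closure relative to $\mathbb{C}\times D$ and $\Omega_2\subset\mathbb{C}\times D$. If $f$ is holomorphic on $\Omega_1$, then $f|_{\Omega_2}$ has a holomorphic extension to $D\times D$; that is, there exist an open set $W\supset(\overline{D}\times D)\cup\Omega_2$ and a holomorphic function $g$ on $W$ such that $g=f$ on $\Omega_2$.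
   Context: $D=\{z\in\mathbb{C}:|z|<1\}$ is the open unit disc, $\partial D$ is the unit circle and $\overline{D}$ is the closed unit disc. $\Gamma(F)=\{(z,F(z)):z\in\overline{D}\}\subset\mathbb{C}^2$ is the graph of $F$. The $j$-th Fourier coefficient is $A_j(r)=\frac{1}{2\pi}\int_0^{2\pi}F(re^{i\theta})e^{-ij\theta}\,d\theta$. *)

(* Defs.v *)
From HB Require Import structures.
From mathcomp Require Import all_boot all_order all_algebra.
From mathcomp Require Import complex.
From mathcomp Require Import all_classical all_reals all_analysis.

Set Implicit Arguments.
Unset Strict Implicit.
Unset Printing Implicit Defensive.

Import Order.TTheory GRing.Theory Num.Theory.
Import numFieldNormedType.Exports.

Local Open Scope classical_set_scope.
Local Open Scope ring_scope.
Local Open Scope complex_scope.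

(* [R[i]^o] is [R[i]] seen as a normed module over itself, so that [Cplx R] and
   [Cplx R * Cplx R] carry the usual topologies and [differentiable] on them
   means complex (i.e. [R[i]]-linear Fréchet) differentiability. *)
Notation Cplx R := (R[i]^o).

Section Defs.
Variable R : realType.
Implicit Types (z w : Cplx R) (U : set (Cplx R * Cplx R)).

(* The norm of [R[i]] takes values in [R[i]] (it is real there), and
   [x < y] on [R[i]] means that [y - x] is real and positive. *)
Definition disc : set (Cplx R) := [set z | `|z| < 1].
Definition circle : set (Cplx R) := [set z | `|z| = 1].
Definition closed_disc : set (Cplx R) := [set z | `|z| <= 1].

Definition cmod z : R := complex.Re `|z|.

Definition graph_over_closed_disc (F : Cplx R -> Cplx R) : set (Cplx R * Cplx R) :=
  [set (z, F z) | z in closed_disc].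

Definition cis (t : R) : Cplx R := cos t +i* sin t.

Definition cintegral (a b : R) (h : R -> Cplx R) : Cplx R :=
  (\int[lebesgue_measure]_(t in `[a, b]) complex.Re (h t))
  +i* (\int[lebesgue_measure]_(t in `[a, b]) complex.Im (h t)).

Definition fourier_coef (F : Cplx R -> Cplx R) (r : R) (j : int) : Cplx R :=
  ((2 * pi)^-1)%:C *
  cintegral 0 (2 * pi) (fun t => F (r%:C * cis t) * cis (- (j%:~R * t))).

Definition holomorphic_on U (f : Cplx R * Cplx R -> Cplx R) : Prop :=
  forall p, U p -> differentiable f p.

End Defs.
Arguments disc {R}.
Arguments circle {R}.
Arguments closed_disc {R}.

(* Main.v *)
Require Import Defs.
From HB Require Import structures.
From mathcomp Require Import all_boot all_order all_algebra.
From mathcomp Require Import complex ring lra.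
From mathcomp Require Import all_classical all_reals all_analysis.
Import Order.TTheory GRing.Theory Num.Theory.
Import numFieldNormedType.Exports.
Local Open Scope classical_set_scope.
Local Open Scope ring_scope.

(** The Laurent series [sum_n A_n(r) (z/r)^n], for [r <= |z| <= 1], are
    holomorphic annuli: on [|z| = r] they follow the graph of [F], and on
    [|z| = 1] the hypothesis keeps them in the unit disc.  Replacing them by
    Fejér means gives Laurent polynomials [P_r] of a fixed degree whose
    coefficients depend continuously on [r].

    For [f] holomorphic near the data and a Laurent polynomial [P], consider the
    difference of the means of [f(z, P(z))] over [|z| = 1] and over [|z| = r].
    It is holomorphic in the coefficients of [P], it is locally constant in [r]
    by Cauchy's theorem, and it vanishes identically for [r = 1].  By the
    identity theorem it therefore vanishes near [P_r] for every [r] in the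
    interval [[r1, 1]].  When [r1] is small, [P_{r1}] can be moved through a
    convex set to constants [w].  If [f] vanishes on [z = 0], its mean over
    [|z| = r1] along the constant graph is [0], hence so is its mean over the
    unit circle; this then holds for all [w] in the disc.  Applied to
    [f z^(m+1)], this says that the negative Laurent coefficients of [f(., w)]
    near the unit circle vanish, and the Cauchy integral of [f] over
    [|z| = 1] is the extension. *)

Set Implicit Arguments.
Unset Strict Implicit.
Unset Printing Implicit Defensive.

(** * Modulus and differentiability in epsilon-delta form *)

Section GenericDifferential.
Variables (K : numFieldType) (V W : normedModType K).

(** Over the annulus between [|z| = r] and [|z| = 1] the graph of [P_r] may leave the domain of [f],
    so Cauchy's theorem cannot compare the two means directly. Two moves get around this: the
    identity theorem changes the coefficients and looks only at the two circles, and Cauchy's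
    theorem changes the radius over an annulus so thin that the graph stays in the domain. Since the
    identity theorem needs vanishing on an open set, the statement carried along is vanishing for
    all coefficients near those of [P_r]. Fejér means are preferred to partial sums because one
    degree approximates [F] on all circles at once, by uniform continuity, and because their weights
    lie in [[0, 1]], so that the bound on [|z| = 1] survives. They also replace convergence of
    series elsewhere: the Fejér mean of a function without negative coefficients is an average of
    partial sums, which yields both the Taylor expansion and the Cauchy formula. *)

Lemma differentiable_bound (f : V -> W) (x : V) (e : K) :
  differentiable f x -> 0 < e ->
  \forall h \near (0 : V), `|f (x + h) - f x - 'd f x h| <= e * `|h|.
Proof.
move=> /diff_locallyP[_ df] e0; move/eqaddoP: df => /(_ e e0).
by apply: filterS => h; rewrite !fctE /= opprD addrA [h + x]addrC.
Qed.

Lemma differentiable_of_bound (f : V -> W) (L : {linear V -> W}) (x : V) :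
  continuous L ->
  (forall e : K, 0 < e ->
     \forall h \near (0 : V), `|f (x + h) - f x - L h| <= e * `|h|) ->
  differentiable f x.
Proof.
move=> cL H.
have fE : f \o shift x = cst (f x) + L +o_ (0 : V) id.
  apply/eqaddoP => e e0; apply: filterS (H e e0) => h.
  by rewrite !fctE /= opprD addrA [h + x]addrC.
have dE := diff_unique cL fE.
by apply/diff_locallyP; rewrite dE.
Qed.
End GenericDifferential.

Section Modulus.
Variable R : realType.
Implicit Types z w : Cplx R.

Lemma cmodE z : (cmod z)%:C%C = `|z|.
Proof. by []. Qed.

Lemma cmod_ge0 z : 0 <= cmod z.
Proof. by rewrite -lecR cmodE normr_ge0. Qed.

Lemma cmodM z w : cmod (z * w) = cmod z * cmod w.
Proof. exact: Normc.normcM. Qed.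

Lemma cmod1 : cmod (1 : Cplx R) = 1.
Proof. exact: Normc.normc1. Qed.

Lemma cmod0 : cmod (0 : Cplx R) = 0.
Proof. exact: Normc.normc0. Qed.

Lemma cmodN z : cmod (- z) = cmod z.
Proof. by apply: complexI; rewrite !cmodE normrN. Qed.

Lemma cmodV z : cmod z^-1 = (cmod z)^-1.
Proof. exact: Normc.normcV. Qed.

Lemma cmodX z n : cmod (z ^+ n) = cmod z ^+ n.
Proof. by elim: n => [|n IH]; rewrite ?expr0 ?cmod1// !exprS cmodM IH. Qed.

Lemma cmodBC z w : cmod (z - w) = cmod (w - z).
Proof. by rewrite -cmodN opprB. Qed.

Lemma cmodD z w : cmod (z + w) <= cmod z + cmod w.
Proof. by rewrite -lecR rmorphD /= !cmodE ler_normD. Qed.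

Lemma cmodB z w : cmod (z - w) <= cmod z + cmod w.
Proof. by rewrite -[cmod w]cmodN cmodD. Qed.

Lemma cmod_dist z w v : cmod (z - w) <= cmod (z - v) + cmod (v - w).
Proof. by rewrite -[z - w](subrKA v); exact: cmodD. Qed.

Lemma cmod_eq0 z : (cmod z == 0) = (z == 0).
Proof. by rewrite -(inj_eq (@complexI R)) cmodE normr_eq0. Qed.

Lemma cmod_gt0 z : (0 < cmod z) = (z != 0).
Proof. by rewrite lt_neqAle cmod_ge0 andbT eq_sym cmod_eq0. Qed.

Lemma cmod_real (x : R) : cmod (x%:C%C : Cplx R) = `|x|.
Proof. by rewrite /cmod normc_def /= expr0n addr0 sqrtr_sqr. Qed.

Lemma cmod_nneg (x : R) : 0 <= x -> cmod (x%:C%C : Cplx R) = x.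
Proof. by move=> x0; rewrite cmod_real ger0_norm. Qed.

Lemma cmod_natr n : cmod (n%:R : Cplx R) = n%:R.
Proof. by rewrite -(rmorph_nat (@real_complex R)) cmod_nneg. Qed.

Lemma cmod_i : cmod ('i%C : Cplx R) = 1.
Proof. by rewrite /cmod normc_def /= expr0n add0r expr1n sqrtr1. Qed.

Lemma Re_le_cmod z : `|complex.Re z| <= cmod z.
Proof. by rewrite -lecR cmodE normc_ge_Re. Qed.

Lemma cmod_leD z : cmod z <= `|complex.Re z| + `|complex.Im z|.
Proof.
case: z => x y /=.
have -> : (x +i* y)%C = x%:C%C + 'i%C * y%:C%C :> Cplx R.
  by apply/eqP; rewrite eq_complex /=; apply/andP; split; apply/eqP; ring.
by apply: (le_trans (cmodD _ _)); rewrite cmodM cmod_i mul1r !cmod_real.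
Qed.

Lemma Im_le_cmod z : `|complex.Im z| <= cmod z.
Proof.
have -> : complex.Im z = - complex.Re (z * 'i%C).
  by case: z => x y /=; ring.
by rewrite normrN (le_trans (Re_le_cmod _))// cmodM cmod_i mulr1.
Qed.

Lemma cmod_sum (I : Type) (r : seq I) (P : pred I) (G : I -> Cplx R) :
  cmod (\sum_(i <- r | P i) G i) <= \sum_(i <- r | P i) cmod (G i).
Proof.
elim/big_rec2: _ => [|i x z _ IH]; first by rewrite cmod0.
by rewrite (le_trans (cmodD _ _))// lerD2l.
Qed.

(** Radii of balls in [Cplx R] are positive elements of [R[i]]; this replaces them by real
    numbers. *)
Lemma nbhs_cmodP z (P : set (Cplx R)) :
  nbhs z P <-> exists2 d : R, 0 < d & forall y, cmod (y - z) < d -> P y.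
Proof.
split=> [/nbhs_ballP[e /= e0 eP]|[d d0 dP]].
- case: e e0 eP => e e'; rewrite ltcE /= => /andP[/eqP -> e0] eP.
  exists e => // y yz; apply: eP; rewrite -ball_normE /ball_ /=.
  by rewrite distrC -cmodE ltcR.
- apply/nbhs_ballP; exists (d%:C%C) => /=; first by rewrite ltcR.
  move=> y; rewrite -ball_normE /ball_ /= => yz; apply: dP.
  by rewrite -ltcR cmodE distrC.
Qed.

Lemma nbhs2_cmodP z w (P : set (Cplx R * Cplx R)) :
  nbhs (z, w) P <-> exists2 d : R, 0 < d &
    forall y v, cmod (y - z) < d -> cmod (v - w) < d -> P (y, v).
Proof.
split=> [[[A B] /= [/nbhs_cmodP[d1 d10 H1] /nbhs_cmodP[d2 d20 H2]] AB]|[d d0 dP]].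
- exists (Num.min d1 d2) => [|y v]; first by rewrite lt_min d10.
  rewrite !lt_min => /andP[y1 _] /andP[_ v2]; apply: AB; split => /=.
    exact: H1.
  exact: H2.
- exists ([set y | cmod (y - z) < d], [set v | cmod (v - w) < d]) => /=.
    by split; apply/nbhs_cmodP; exists d.
  by move=> -[y v] /= [yz vw]; apply: dP.
Qed.

Lemma open2_cmod (U : set (Cplx R * Cplx R)) z w : open U -> U (z, w) ->
  exists2 d : R, 0 < d &
    forall y v, cmod (y - z) < d -> cmod (v - w) < d -> U (y, v).
Proof. by move=> oU Uzw; apply/nbhs2_cmodP; exact: open_nbhs_nbhs. Qed.

Lemma continuous_cmodP (u : Cplx R -> Cplx R) z :
  {for z, continuous u} <-> forall e : R, 0 < e -> exists2 d : R, 0 < d &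
    forall y, cmod (y - z) < d -> cmod (u y - u z) < e.
Proof.
split=> [cu e e0|H].
  have /cu : nbhs (u z) [set y | cmod (y - u z) < e].
    by apply/nbhs_cmodP; exists e.
  by move/nbhs_cmodP.
move=> P /nbhs_cmodP[e e0 eP]; have [d d0 dP] := H e e0.
by apply/nbhs_cmodP; exists d => // y yz /=; apply: eP; apply: dP.
Qed.

Lemma continuous2_cmod (u : Cplx R * Cplx R -> Cplx R) z w :
  {for (z, w), continuous u} -> forall e : R, 0 < e -> exists2 d : R, 0 < d &
    forall y v, cmod (y - z) < d -> cmod (v - w) < d ->
      cmod (u (y, v) - u (z, w)) < e.
Proof.
move=> cu e e0; have /cu : nbhs (u (z, w)) [set y | cmod (y - u (z, w)) < e].
  by apply/nbhs_cmodP; exists e.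
by move/nbhs2_cmodP.
Qed.

Lemma continuous_curve_cmodP (h : R -> Cplx R) t :
  {for t, continuous h} <-> forall e : R, 0 < e -> exists2 d : R, 0 < d &
    forall s, `|s - t| < d -> cmod (h s - h t) < e.
Proof.
split=> [ch e e0|H].
  have /ch : nbhs (h t) [set y | cmod (y - h t) < e].
    by apply/nbhs_cmodP; exists e.
  move/nbhs_ballP => [d /= d0 dP]; exists d => // s st; apply: dP.
  by rewrite -ball_normE /ball_ /= distrC.
move=> P /nbhs_cmodP[e e0 eP]; have [d d0 dP] := H e e0.
apply/nbhs_ballP; exists d => //= s; rewrite -ball_normE /ball_ /= distrC => st.
by apply: eP; apply: dP.
Qed.

Lemma differentiable_cmod (u : Cplx R -> Cplx R) z : differentiable u z ->
  exists c, forall e : R, 0 < e -> exists2 d : R, 0 < d &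
    forall h, cmod h < d -> cmod (u (z + h) - u z - c * h) <= e * cmod h.
Proof.
move=> du; exists ('d u z 1) => e e0.
have e0' : 0 < e%:C%C :> R[i] by rewrite ltcR.
have /nbhs_cmodP[d d0 dP] := differentiable_bound du e0'.
exists d => // h hd; rewrite -lecR rmorphM /= !cmodE.
have := dP h; rewrite subr0 => /(_ hd).
have -> : 'd u z h = 'd u z 1 * h.
  have -> : h = h *: (1 : Cplx R) by rewrite /GRing.scale /= mulr1.
  by rewrite linearZ /= /GRing.scale /= mulr1 mulrC.
by [].
Qed.

Definition lin2 (a b : Cplx R) (p : Cplx R * Cplx R) : Cplx R :=
  a * p.1 + b * p.2.

Lemma lin2_is_linear (a b : Cplx R) : linear (lin2 a b).
Proof.
move=> k [x y] [x' y']; rewrite /lin2 /= /GRing.scale /=; ring.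
Qed.

HB.instance Definition _ (a b : Cplx R) :=
  GRing.isLinear.Build _ _ _ _ (lin2 a b) (@lin2_is_linear a b).

Lemma norm_pair (p : Cplx R * Cplx R) :
  `|p| = (Num.max (cmod p.1) (cmod p.2))%:C%C.
Proof.
rewrite prod_normE -2!cmodE; case: (leP (cmod p.1)) => h.
  by rewrite max_r// lecR.
by rewrite max_l// lecR ltW.
Qed.

Lemma differentiable2_cmod (u : Cplx R * Cplx R -> Cplx R) z w :
  differentiable u (z, w) ->
  exists a b, forall e : R, 0 < e -> exists2 d : R, 0 < d &
    forall h k, cmod h < d -> cmod k < d ->
      cmod (u (z + h, w + k) - u (z, w) - (a * h + b * k)) <=
        e * (cmod h + cmod k).
Proof.
move=> du; exists ('d u (z, w) (1, 0)), ('d u (z, w) (0, 1)) => e e0.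
have e0' : 0 < e%:C%C :> R[i] by rewrite ltcR.
have /nbhs2_cmodP[d d0 dP] := differentiable_bound du e0'.
exists d => // h k hd kd.
have := dP h k; rewrite !subr0 => /(_ hd kd).
have -> : 'd u (z, w) (h, k) = 'd u (z, w) (1, 0) * h + 'd u (z, w) (0, 1) * k.
  have -> : (h, k) = h *: ((1 : Cplx R), (0 : Cplx R)) +
                     k *: ((0 : Cplx R), (1 : Cplx R)).
    transitivity (h * 1 + k * 0, h * 0 + k * 1) => //.
    by rewrite !mulr0 !mulr1 addr0 add0r.
  by rewrite linearD !linearZ /= /GRing.scale /= ![_ * 'd u _ _]mulrC.
rewrite norm_pair -cmodE -rmorphM lecR => /le_trans; apply.
apply: ler_wpM2l; first exact: ltW.
rewrite ge_max /= lerDl cmod_ge0 /= lerDr; exact: cmod_ge0.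
Qed.

Lemma differentiable2_of_cmod (u : Cplx R * Cplx R -> Cplx R) z w a b :
  (forall e : R, 0 < e -> exists2 d : R, 0 < d &
    forall h k, cmod h < d -> cmod k < d ->
      cmod (u (z + h, w + k) - u (z, w) - (a * h + b * k)) <=
        e * (cmod h + cmod k)) ->
  differentiable u (z, w).
Proof.
move=> H; apply: (@differentiable_of_bound _ _ _ _ (lin2 a b)).
- apply/linear_bounded_continuous/linear_boundedP.
  near=> r => -[h k] /=; rewrite norm_pair.
  have -> : `|lin2 a b (h, k)| = (cmod (lin2 a b (h, k)))%:C%C by [].
  apply: (@le_trans _ _ ((cmod a + cmod b)%:C%C * (Num.max (cmod h) (cmod k))%:C%C)).
    rewrite -rmorphM lecR (le_trans (cmodD _ _))// !cmodM mulrDl.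
    by rewrite lerD// ler_wpM2l ?cmod_ge0// le_max lexx ?orbT.
  rewrite ler_wpM2r//.
    by rewrite lecR le_max cmod_ge0.
  near: r; apply: nbhs_pinfty_ge; apply: ger0_real.
  by rewrite lecR addr_ge0 ?cmod_ge0.
- move=> e e0; have [e' eE] : exists e' : R, e = e'%:C%C.
    by case: e e0 => e e'; rewrite ltcE /= => /andP[/eqP -> _]; exists e.
  rewrite {e}eE ltcR in e0 *.
  have e20 : 0 < e' / 2 by rewrite divr_gt0.
  have [d d0 dP] := H _ e20.
  apply/nbhs2_cmodP; exists d => // h k; rewrite !subr0 => hd kd.
  rewrite norm_pair -cmodE -rmorphM lecR (le_trans (dP _ _ hd kd))//.
  rewrite -mulrA. apply: ler_wpM2l. exact: ltW.
  have hm : cmod h <= Num.max (cmod h) (cmod k) by rewrite le_max lexx.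
  have km : cmod k <= Num.max (cmod h) (cmod k) by rewrite le_max lexx orbT.
  by rewrite /=; lra.
Unshelve. all: by end_near.
Qed.

End Modulus.

Section Differentiable.
Variables (R : realType) (V : normedModType R[i]).
Implicit Types (f g : V -> Cplx R) (x : V).

Lemma differentiable_mul f g x : differentiable f x -> differentiable g x ->
  differentiable (fun y => f y * g y : Cplx R) x.
Proof. exact: differentiableM. Qed.

Lemma differentiable_add f g x : differentiable f x -> differentiable g x ->
  differentiable (fun y => f y + g y) x.
Proof. exact: differentiableD. Qed.

Lemma differentiable_sub f g x : differentiable f x -> differentiable g x ->
  differentiable (fun y => f y - g y) x.
Proof. exact: differentiableB. Qed.

Lemma differentiable_inv f x : differentiable f x -> f x != 0 ->
  differentiable (fun y => (f y)^-1 : Cplx R) x.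
Proof. exact: differentiableV. Qed.

Lemma differentiable_const (c : Cplx R) x : differentiable (fun _ : V => c) x.
Proof. exact: differentiable_cst. Qed.

Lemma differentiable_pow f n x : differentiable f x ->
  differentiable (fun y => f y ^+ n : Cplx R) x.
Proof.
move=> df; elim: n => [|n IH]; first exact: differentiable_const.
have -> : (fun y => f y ^+ n.+1 : Cplx R) = (fun y => f y * f y ^+ n).
  by apply/funext => y; rewrite exprS.
exact: (differentiable_mul df IH).
Qed.

Lemma differentiable_bigsum n (h : nat -> V -> Cplx R) x :
  (forall j, differentiable (h j) x) ->
  differentiable (fun y => \sum_(j < n) h j y) x.
Proof.
move=> dh; elim: n => [|n IH].
  have -> : (fun y => \sum_(j < 0) h j y) = (fun=> 0).
    by apply/funext => y; rewrite big_ord0.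
  exact: differentiable_const.
have -> : (fun y => \sum_(j < n.+1) h j y) =
    (fun y => \sum_(j < n) h j y + h n y).
  by apply/funext => y; rewrite big_ord_recr.
exact: (differentiable_add IH (dh n)).
Qed.

End Differentiable.

Lemma differentiable_var (R : realType) (z : Cplx R) :
  differentiable (fun x : Cplx R => x) z.
Proof. exact: ex_diff. Qed.

(** * Integrals of complex-valued functions *)

Section Cis.
Variable R : realType.

Lemma cis0 : cis 0 = 1 :> Cplx R.
Proof. by rewrite /cis cos0 sin0. Qed.

Lemma cisD (s t : R) : cis (s + t) = cis s * cis t.
Proof.
rewrite /cis cosD sinD; apply/eqP; rewrite eq_complex /=.
by apply/andP; split; apply/eqP; ring.
Qed.

Lemma cis_2pi : cis (2 * pi) = 1 :> Cplx R.
Proof. by rewrite /cis mulr_natl cos2pi sin2pi. Qed.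

Lemma cisN (t : R) : cis (- t) = (cis t)^-1 :> Cplx R.
Proof.
suff h : cis t * cis (- t) = 1.
  have c0 : cis t != 0 :> Cplx R.
    by apply/eqP => c0; move: h; rewrite c0 mul0r => /esym/eqP; rewrite oner_eq0.
  by apply: (mulfI c0); rewrite h mulfV.
by rewrite -cisD subrr cis0.
Qed.

Lemma cmod_cis (t : R) : cmod (cis t) = 1.
Proof. by rewrite /cmod /= cos2Dsin2 sqrtr1. Qed.

Lemma cis_mulrn (n : nat) (t : R) : cis (n%:R * t) = cis t ^+ n.
Proof.
elim: n => [|n IH]; first by rewrite mul0r cis0 expr0.
by rewrite -natr1 mulrDl mul1r cisD IH exprSr.
Qed.

Lemma cmod_polar (r t : R) : 0 <= r -> cmod (r%:C%C * cis t) = r.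
Proof. by move=> r0; rewrite cmodM cmod_cis mulr1 cmod_nneg. Qed.

Lemma continuous_complex (x y : R -> R) (t : R) :
  {for t, continuous x} -> {for t, continuous y} ->
  {for t, continuous (fun s => (x s +i* y s)%C : Cplx R)}.
Proof.
move=> /cvgr_dist_lt cx /cvgr_dist_lt cy; apply/continuous_curve_cmodP => e e0.
have e20 : 0 < e / 2 by rewrite divr_gt0.
have /nbhs_ballP[d1 /= d10 H1] := cx _ e20.
have /nbhs_ballP[d2 /= d20 H2] := cy _ e20.
exists (Num.min d1 d2) => [|s]; first by rewrite lt_min d10.
rewrite lt_min => /andP[s1 s2]; apply: (le_lt_trans (cmod_leD _)).
have h1 : `|x t - x s| < e / 2.
  by apply: H1; rewrite /ball /= distrC.
have h2 : `|y t - y s| < e / 2.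
  by apply: H2; rewrite /ball /= distrC.
by rewrite /= [`|x s - x t|]distrC [`|y s - y t|]distrC; lra.
Qed.

Lemma continuous_cis : continuous (@cis R).
Proof.
by move=> t; apply: continuous_complex;
  [exact: continuous_cos|exact: continuous_sin].
Qed.

Lemma continuous_Re (h : R -> Cplx R) t :
  {for t, continuous h} -> {for t, continuous (fun s => complex.Re (h s))}.
Proof.
move/continuous_curve_cmodP => H; apply/cvgrPdist_lt => e e0.
have [d d0 dP] := H e e0.
apply/nbhs_ballP; exists d => //= s; rewrite /ball /= distrC => st.
by rewrite distrC -raddfB; apply: (le_lt_trans (Re_le_cmod _)); apply: dP.
Qed.

Lemma continuous_Im (h : R -> Cplx R) t :
  {for t, continuous h} -> {for t, continuous (fun s => complex.Im (h s))}.
Proof.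
move/continuous_curve_cmodP => H; apply/cvgrPdist_lt => e e0.
have [d d0 dP] := H e e0.
apply/nbhs_ballP; exists d => //= s; rewrite /ball /= distrC => st.
by rewrite distrC -raddfB; apply: (le_lt_trans (Im_le_cmod _)); apply: dP.
Qed.

Lemma continuous_cmod_curve (h : R -> Cplx R) t :
  {for t, continuous h} -> {for t, continuous (fun s => cmod (h s))}.
Proof.
move/continuous_curve_cmodP => H; apply/cvgrPdist_lt => e e0.
have [d d0 dP] := H e e0.
apply/nbhs_ballP; exists d => //= s; rewrite /ball /= distrC => st.
apply: le_lt_trans (dP s st); rewrite ler_norml.
have h1 := cmodD (h s - h t) (h t); have h2 := cmodD (h t - h s) (h s).
rewrite !subrK in h1 h2; rewrite [cmod (h t - h s)]cmodBC in h2.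
by apply/andP; split; lra.
Qed.

Lemma continuous_curve_comp (u : Cplx R -> Cplx R) (h : R -> Cplx R) t :
  {for t, continuous h} -> {for h t, continuous u} ->
  {for t, continuous (fun s => u (h s))}.
Proof. by move=> ch cu; exact: (continuous_comp ch cu). Qed.

End Cis.

Section Integral.
Variable R : realType.
Local Notation mu := (@lebesgue_measure R).
Implicit Types (a b c : R) (h k : R -> Cplx R).

Definition cont_on (a b : R) (h : R -> Cplx R) :=
  forall t, a <= t <= b -> {for t, continuous h}.

Lemma integrable_cont a b (g : R -> R) :
  (forall t, a <= t <= b -> {for t, continuous g}) ->
  mu.-integrable `[a, b] (EFin \o g).
Proof.
move=> cg; apply: continuous_compact_integrable; first exact: segment_compact.
apply: continuous_in_subspaceT => t; rewrite inE /= in_itv /=; exact: cg.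
Qed.

Lemma integrable_Re a b h : cont_on a b h ->
  mu.-integrable `[a, b] (EFin \o (fun t => complex.Re (h t))).
Proof.
by move=> ch; apply: integrable_cont => t /ch; exact: continuous_Re.
Qed.

Lemma integrable_Im a b h : cont_on a b h ->
  mu.-integrable `[a, b] (EFin \o (fun t => complex.Im (h t))).
Proof.
by move=> ch; apply: integrable_cont => t /ch; exact: continuous_Im.
Qed.

Lemma eq_cintegral a b h k : (forall t, a <= t <= b -> h t = k t) ->
  cintegral a b h = cintegral a b k.
Proof.
move=> hk; rewrite /cintegral; congr (_ +i* _)%C; apply: eq_Rintegral => t;
  by rewrite inE /= in_itv /= => /hk ->.
Qed.

Lemma cintegralD a b h k : cont_on a b h -> cont_on a b k ->
  cintegral a b (fun t => h t + k t) = cintegral a b h + cintegral a b k.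
Proof.
move=> ch ck; rewrite /cintegral.
apply/eqP; rewrite eq_complex /=; apply/andP; split; apply/eqP.
  rewrite -RintegralD//; [|exact: integrable_Re|exact: integrable_Re].
  by apply: eq_Rintegral => t _; rewrite raddfD.
rewrite -RintegralD//; [|exact: integrable_Im|exact: integrable_Im].
by apply: eq_Rintegral => t _; rewrite raddfD.
Qed.

(** The source is normed over [R] and the target over [R[i]], so continuity goes through real and
    imaginary parts. *)
Lemma continuous_cplxM h k (t : R) :
  {for t, continuous h} -> {for t, continuous k} ->
  {for t, continuous (fun s => h s * k s : Cplx R)}.
Proof.
move=> ch ck; have hE : (fun s => h s * k s : Cplx R) = (fun s =>
    (complex.Re (h s) * complex.Re (k s) - complex.Im (h s) * complex.Im (k s))
    +i* (complex.Re (h s) * complex.Im (k s) +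
         complex.Im (h s) * complex.Re (k s)))%C.
  by apply/funext => s; case: (h s) => x y; case: (k s).
have hr := continuous_Re ch; have hi := continuous_Im ch.
have kr := continuous_Re ck; have ki := continuous_Im ck.
rewrite hE; apply: continuous_complex.
  exact: (cvgB (cvgM hr kr) (cvgM hi ki)).
exact: (cvgD (cvgM hr ki) (cvgM hi kr)).
Qed.

Lemma cintegralZ a b (c : Cplx R) h : cont_on a b h ->
  cintegral a b (fun t => c * h t) = c * cintegral a b h.
Proof.
move=> ch; have iR := integrable_Re ch; have iI := integrable_Im ch.
have iZ (x : R) (g : R -> R) : mu.-integrable `[a, b] (EFin \o g) ->
    mu.-integrable `[a, b] (EFin \o (fun t => x * g t)).
  move=> ig.
  have -> : EFin \o (fun t => x * g t) = (fun t => x%:E * (EFin \o g) t)%E by [].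
  exact: integrableZl.
case: c => x y; rewrite /cintegral; apply/eqP; rewrite eq_complex /=.
apply/andP; split; apply/eqP.
  rewrite -RintegralZl// -RintegralZl// -RintegralB//; [|exact: iZ|exact: iZ].
  by apply: eq_Rintegral => t _; case: (h t).
rewrite -RintegralZl// -RintegralZl// -RintegralD//; [|exact: iZ|exact: iZ].
by apply: eq_Rintegral => t _; case: (h t).
Qed.

Lemma Rintegral_itv_cst a b (x : R) : a <= b ->
  \int[mu]_(t in `[a, b]) x = x * (b - a).
Proof.
move=> ab; rewrite Rintegral_cst//; congr (_ * _).
transitivity (fine (b - a)%:E) => //; congr fine.
apply: (eq_trans (lebesgue_measure_itv `[a, b])); rewrite /= lte_fin.
by case: ltgtP ab => //= -> _; rewrite subrr.
Qed.

Lemma cintegral_cst a b (c : Cplx R) : a <= b ->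
  cintegral a b (fun _ => c) = c * (b - a)%:C%C.
Proof.
move=> ab; rewrite /cintegral !Rintegral_itv_cst//; case: c => x y; apply/eqP; rewrite eq_complex /=.
by apply/andP; split; apply/eqP; ring.
Qed.

Lemma cont_onM a b h k : cont_on a b h -> cont_on a b k ->
  cont_on a b (fun t => h t * k t).
Proof. by move=> ch ck t tab; apply: continuous_cplxM; [exact: ch|exact: ck]. Qed.

Lemma cont_onD a b h k : cont_on a b h -> cont_on a b k ->
  cont_on a b (fun t => h t + k t).
Proof. by move=> ch ck t tab; apply: continuousD; [exact: ch|exact: ck]. Qed.

Lemma cont_on_cst a b (c : Cplx R) : cont_on a b (fun=> c).
Proof. by move=> t _; exact: cst_continuous. Qed.

Lemma cont_onS a b a' b' h : a <= a' -> b' <= b ->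
  cont_on a b h -> cont_on a' b' h.
Proof.
move=> aa bb ch t /andP[ta tb]; apply: ch.
by rewrite (le_trans aa ta) (le_trans tb bb).
Qed.

Lemma cont_onZ a b (c : Cplx R) h : cont_on a b h -> cont_on a b (fun t => c * h t).
Proof. by move=> ch; exact: (cont_onM (@cont_on_cst a b c) ch). Qed.

Lemma cont_onB a b h k : cont_on a b h -> cont_on a b k ->
  cont_on a b (fun t => h t - k t).
Proof. by move=> ch ck t tab; apply: continuousB; [exact: ch|exact: ck]. Qed.

Lemma cintegralB a b h k : cont_on a b h -> cont_on a b k ->
  cintegral a b (fun t => h t - k t) = cintegral a b h - cintegral a b k.
Proof.
move=> ch ck; have cNk := cont_onZ (c := -1) ck.
rewrite -[X in _ - X]mul1r -mulNr -(cintegralZ (-1) ck) -(cintegralD ch cNk).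
by apply: eq_cintegral => t _; rewrite mulN1r.
Qed.

Lemma cont_on_sum n a b (h : nat -> R -> Cplx R) :
  (forall i, cont_on a b (h i)) ->
  cont_on a b (fun t => \sum_(i < n) h i t).
Proof.
move=> ch; elim: n => [|n IH].
  under eq_fun do rewrite big_ord0; exact: (@cont_on_cst a b 0).
under eq_fun do rewrite big_ord_recr.
exact: (cont_onD IH (ch n)).
Qed.

Lemma cintegral_sum n a b (h : nat -> R -> Cplx R) :
  (forall i, cont_on a b (h i)) -> a <= b ->
  cintegral a b (fun t => \sum_(i < n) h i t) =
  \sum_(i < n) cintegral a b (h i).
Proof.
move=> ch ab; elim: n => [|n IH].
  under eq_fun do rewrite big_ord0.
  by rewrite cintegral_cst// mul0r big_ord0.
under eq_fun do rewrite big_ord_recr.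
by rewrite (cintegralD (cont_on_sum ch) (ch n)) big_ord_recr IH.
Qed.

Lemma cintegral_split a b c h : a <= b -> b <= c -> cont_on a c h ->
  cintegral a c h = cintegral a b h + cintegral b c h.
Proof.
move=> ab bc ch.
have E (g : R -> R) : (forall t, a <= t <= c -> {for t, continuous g}) ->
    \int[mu]_(t in `[a, c]) g t =
    \int[mu]_(t in `[a, b]) g t + \int[mu]_(t in `[b, c]) g t.
  move=> cg; have ig := integrable_cont cg.
  have := Rintegral_itvB (x := b) ig; rewrite !bnd_simp => /(_ ab bc) E.
  rewrite -(@Rintegral_itv_obnd_cbnd _ b); last first.
    apply: integrableS ig => //; apply: subset_itvr; rewrite bnd_simp //.
  by rewrite -E subrKC.
rewrite /cintegral E; last by move=> t /ch; exact: continuous_Re.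
rewrite E; last by move=> t /ch; exact: continuous_Im.
by [].
Qed.

Lemma cmod_cintegral_le a b h (g : R -> R) : cont_on a b h ->
  (forall t, a <= t <= b -> {for t, continuous g}) ->
  (forall t, a <= t <= b -> cmod (h t) <= g t) ->
  cmod (cintegral a b h) <= \int[mu]_(t in `[a, b]) g t.
Proof.
move=> ch cg hg; set I := cintegral a b h.
have g0 : 0 <= \int[mu]_(t in `[a, b]) g t.
  apply: Rintegral_ge0 => t /=; rewrite in_itv /= => /hg; apply: le_trans.
  exact: cmod_ge0.
have [->|I0] := eqVneq I 0; first by rewrite cmod0.
(* Rotating [h] by the argument of its integral makes that integral real. *)
pose e : Cplx R := (cmod I)%:C%C / I.
have cI : cmod I != 0 by rewrite cmod_eq0.
have e1 : cmod e = 1 by rewrite cmodM cmodV cmod_nneg ?cmod_ge0// mulfV.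
have eI : e * I = (cmod I)%:C%C by rewrite /e mulfVK.
have -> : cmod I = \int[mu]_(t in `[a, b]) complex.Re (e * h t).
  by have := congr1 (@complex.Re R) eI; rewrite -(cintegralZ e ch) /= => ->.
apply: le_Rintegral => //.
- by apply: integrable_Re; exact: (cont_onZ (c := e) ch).
- exact: integrable_cont.
- move=> t /=; rewrite in_itv /= => tab.
  apply: le_trans (ler_norm _) _; apply: le_trans (Re_le_cmod _) _.
  by rewrite cmodM e1 mul1r; exact: hg.
Qed.

Lemma cmod_cintegral_le_cst a b h (C : R) : a <= b -> cont_on a b h ->
  (forall t, a <= t <= b -> cmod (h t) <= C) ->
  cmod (cintegral a b h) <= C * (b - a).
Proof.
move=> ab ch hC.
apply: (le_trans (cmod_cintegral_le ch (fun t _ => @cst_continuous _ _ C t) hC)).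
by rewrite Rintegral_itv_cst.
Qed.

End Integral.

(** * Goursat's lemma *)

Section Cousin.
Variable R : realType.

Lemma nested_intervals (x h : nat -> R) :
  (forall n, x n <= x n.+1) -> (forall n, x n.+1 + h n.+1 <= x n + h n) ->
  (forall n, 0 <= h n) -> exists X, forall n, x n <= X <= x n + h n.
Proof.
move=> x1 h1 h0.
have xm m n : (m <= n)%N -> x m <= x n.
  by move=> mn; apply: (@homo_leq _ _ <=%O) mn => // ? ? ?; exact: le_trans.
have hm m n : (m <= n)%N -> x n + h n <= x m + h m.
  move=> mn; apply: (@homo_leq _ (fun n => x n + h n) (fun a b => b <= a)) mn => //.
  by move=> a b c ba ac; exact: le_trans ac ba.
have xh m n : x m <= x n + h n.
  have [mn|nm] := leqP m n.
    by apply: (le_trans (xm _ _ mn)); rewrite lerDl.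
  by apply: le_trans (hm _ _ (ltnW nm)); rewrite lerDl.
exists (sup (range x)) => n; apply/andP; split.
  apply: ub_le_sup; last by exists n.
  by exists (x 0%N + h 0%N) => _ [m _ <-].
by apply: ge_sup; [exists (x 0%N), 0%N|move=> _ [m _ <-]].
Qed.

Lemma exists_half_pow (h d : R) : 0 < d -> exists n : nat, h / 2 ^+ n < d.
Proof.
move=> d0; have [n hn] : exists n : nat, h / d < n%:R.
  exists (Num.bound `|h / d|); apply: le_lt_trans (ler_norm _) _.
  exact: archi_boundP.
exists n; rewrite ltr_pdivrMr ?exprn_gt0// -ltr_pdivrMl// mulrC.
apply: (lt_trans hn).
by rewrite -natrX ltr_nat ltn_expl.
Qed.

(** If [Pr] failed, each bad square would have a bad quarter, and the bad squares would shrink to a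
    point whose small squares are all good. This bisection supplies the compactness for Goursat's
    lemma, for uniform radii on annuli and for the descent in the radius. *)
Lemma cousin_square (Pr : R -> R -> R -> Prop) (x0 y0 h0 : R) :
  let sub x y h := [/\ x0 <= x, x + h <= x0 + h0, y0 <= y & y + h <= y0 + h0] in
  0 < h0 ->
  (forall x y h, 0 < h -> sub x y h ->
    Pr x y (h / 2) -> Pr (x + h / 2) y (h / 2) ->
    Pr x (y + h / 2) (h / 2) -> Pr (x + h / 2) (y + h / 2) (h / 2) ->
    Pr x y h) ->
  (forall x y, x0 <= x <= x0 + h0 -> y0 <= y <= y0 + h0 ->
    exists2 d, 0 < d & forall x' y' h, 0 < h -> h < d -> sub x' y' h ->
      x' <= x <= x' + h -> y' <= y <= y' + h -> Pr x' y' h) ->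
  Pr x0 y0 h0.
Proof.
move=> sub h00 Hsplit Hloc; apply: contrapT => nP.
pose bad (q : R * R * R) := [/\ sub q.1.1 q.1.2 q.2, 0 < q.2 &
  ~ Pr q.1.1 q.1.2 q.2].
pose child (q q' : R * R * R) := [/\ bad q', q'.2 = q.2 / 2,
  q.1.1 <= q'.1.1 <= q.1.1 + q.2 / 2 & q.1.2 <= q'.1.2 <= q.1.2 + q.2 / 2].
have /choice[nxt nxtP] (q : R * R * R) : exists q', bad q -> child q q'.
  case: q => -[x y] h; apply: contrapT => H.
  have [[[/= sx sxh sy syh] /= hpos nPq]|nb] := pselect (bad (x, y, h)); last first.
    by apply: H; exists (x, y, h).
  apply: nPq; have hh := divr_gt0 hpos (ltr0n R 2).
  have hE : h / 2 + h / 2 = h by field.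
  have K x' y' : x <= x' <= x + h / 2 -> y <= y' <= y + h / 2 -> Pr x' y' (h / 2).
    move=> /andP[xx' x'x] /andP[yy' y'y]; apply: contrapT => nP'; apply: H.
    exists (x', y', h / 2) => _; split => //=; last 2 first.
    - by rewrite xx'.
    - by rewrite yy'.
    by split => //=; split; lra.
  by apply: Hsplit => //; apply: K; apply/andP; split; lra.
pose q n := iter n nxt (x0, y0, h0).
have qbad n : bad (q n).
  elim: n => [|n IH] /=; first by split => //=; split.
  by have [] := nxtP _ IH.
have qc n : child (q n) (q n.+1) by exact: nxtP.
have qh n : (q n).2 = h0 / 2 ^+ n.
  elim: n => [|n IH]; first by rewrite expr0 divr1.
  have [_ -> _ _] := qc n; rewrite IH exprSr invfM; lra.
have [X XP] : exists X, forall n, (q n).1.1 <= X <= (q n).1.1 + (q n).2.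
  apply: nested_intervals => n; have [_ h1 /andP[a b] _] := qc n => //.
    by lra.
  by have [_ /ltW] := qbad n.
have [Y YP] : exists Y, forall n, (q n).1.2 <= Y <= (q n).1.2 + (q n).2.
  apply: nested_intervals => n; have [_ h1 _ /andP[a b]] := qc n => //.
    by lra.
  by have [_ /ltW] := qbad n.
have [d d0 dP] := Hloc X Y (XP 0%N) (YP 0%N).
have [n nd] := exists_half_pow h0 d0.
have [sb hp nPr] := qbad n; apply: nPr; apply: dP => //.
by rewrite qh.
Qed.

End Cousin.

(** * Boundary integrals of holomorphic functions over squares *)

Section Goursat.
Variable R : realType.
Local Notation "x %:C" := (x%:C%C : Cplx R).
Local Notation i := ('i%C : Cplx R).

(* [u x y] stands for a holomorphic function of [l x + i m y], so that
   rectangles of any proportions become squares. *)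
Variables (u : R -> R -> Cplx R) (l m : R) (x0 y0 h0 : R).
Hypothesis h00 : 0 < h0.
Hypothesis du : forall x y, x0 <= x <= x0 + h0 -> y0 <= y <= y0 + h0 ->
  exists c : Cplx R, forall e : R, 0 < e -> exists2 d : R, 0 < d &
    forall s t, `|s| < d -> `|t| < d ->
      cmod (u (x + s) (y + t) - u x y - c * ((l * s)%:C + i * (m * t)%:C))
        <= e * (`|s| + `|t|).

(** The counterclockwise boundary integral of [u] with respect to [l x + i m y], over the square of
    side [h] with lower left corner [(x, y)]. *)
Let B x y h : Cplx R :=
  l%:C * cintegral x (x + h) (fun s => u s y - u s (y + h)) +
  i * m%:C * cintegral y (y + h) (fun t => u (x + h) t - u x t).

Let cux y : y0 <= y <= y0 + h0 -> cont_on x0 (x0 + h0) (u^~ y).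
Proof.
move=> yy x xx; have [c cP] := du xx yy.
apply/continuous_curve_cmodP => e e0.
have [d d0 dP] := cP _ ltr01.
(* The expansion with error constant [1] makes [u] Lipschitz at [x] with constant [M]. *)
pose M := cmod c * `|l| + 1.
have M0 : 0 < M by rewrite ltr_wpDl ?mulr_ge0 ?cmod_ge0.
exists (Num.min d (e / M)) => [|s]; first by rewrite lt_min d0 divr_gt0.
rewrite lt_min ltr_pdivlMr// => /andP[sd se].
have := dP (s - x) 0 sd; rewrite normr0 => /(_ d0).
rewrite subrKC !addr0 mulr0 mulr0 addr0 mul1r => H.
have E := cmod_dist (u s y) (u x y) (u x y + c * (l * (s - x))%:C).
apply: (le_lt_trans E); rewrite [X in _ + cmod X]addrAC subrr add0r.
rewrite opprD addrA cmodM cmod_real normrM.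
by apply: le_lt_trans se; rewrite /M; lra.
Qed.

Let cuy x : x0 <= x <= x0 + h0 -> cont_on y0 (y0 + h0) (u x).
Proof.
move=> xx y yy; have [c cP] := du xx yy.
apply/continuous_curve_cmodP => e e0.
have [d d0 dP] := cP _ ltr01.
pose M := cmod c * `|m| + 1.
have M0 : 0 < M by rewrite ltr_wpDl ?mulr_ge0 ?cmod_ge0.
exists (Num.min d (e / M)) => [|t]; first by rewrite lt_min d0 divr_gt0.
rewrite lt_min ltr_pdivlMr// => /andP[td te].
have := dP 0 (t - y); rewrite normr0 => /(_ d0 td).
rewrite subrKC !addr0 mulr0 !add0r mul1r => H.
have E := cmod_dist (u x t) (u x y) (u x y + c * (i * (m * (t - y))%:C)).
apply: (le_lt_trans E); rewrite [X in _ + cmod X]addrAC subrr add0r.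
rewrite opprD addrA !cmodM cmod_i mul1r cmod_real normrM.
by apply: le_lt_trans te; rewrite /M; lra.
Qed.

Let Ix a b y := cintegral a b (u^~ y).
Let Iy a b x := cintegral a b (u x).

Let BE x y h : 0 < h ->
  [/\ x0 <= x, x + h <= x0 + h0, y0 <= y & y + h <= y0 + h0] ->
  B x y h = l%:C * (Ix x (x + h) y - Ix x (x + h) (y + h)) +
            i * m%:C * (Iy y (y + h) (x + h) - Iy y (y + h) x).
Proof.
move=> hp [x0x xh y0y yh]; rewrite /B cintegralB; last 2 first.
- by move=> t /andP[a b]; apply: cux; apply/andP; split; lra.
- by move=> t /andP[a b]; apply: cux; apply/andP; split; lra.
rewrite cintegralB//.
- by move=> t /andP[a b]; apply: cuy; apply/andP; split; lra.
- by move=> t /andP[a b]; apply: cuy; apply/andP; split; lra.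
Qed.

(** Each inner edge is run twice in opposite directions, so only the outer edges survive. *)
Let B_split x y h : 0 < h ->
  [/\ x0 <= x, x + h <= x0 + h0, y0 <= y & y + h <= y0 + h0] ->
  B x y h = B x y (h / 2) + B (x + h / 2) y (h / 2) +
    (B x (y + h / 2) (h / 2) + B (x + h / 2) (y + h / 2) (h / 2)).
Proof.
move=> hp [x0x xh y0y yh]; have k0 : 0 < h / 2 by rewrite divr_gt0.
rewrite BE// !BE//; try by split; lra.
have SX y' : y0 <= y' <= y0 + h0 ->
    Ix x (x + h) y' = Ix x (x + h / 2) y' + Ix (x + h / 2) (x + h / 2 + h / 2) y'.
  move=> yy; have -> : x + h / 2 + h / 2 = x + h by field.
  apply: cintegral_split; [lra|lra|].
  by move=> t /andP[a b]; apply: (cux yy); apply/andP; split; lra.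
have SY x' : x0 <= x' <= x0 + h0 ->
    Iy y (y + h) x' = Iy y (y + h / 2) x' + Iy (y + h / 2) (y + h / 2 + h / 2) x'.
  move=> xx; have -> : y + h / 2 + h / 2 = y + h by field.
  apply: cintegral_split; [lra|lra|].
  by move=> t /andP[a b]; apply: (cuy xx); apply/andP; split; lra.
rewrite !SX; [|by apply/andP; split; lra|by apply/andP; split; lra].
rewrite !SY; [|by apply/andP; split; lra|by apply/andP; split; lra].
have -> : x + h / 2 + h / 2 = x + h by field.
have -> : y + h / 2 + h / 2 = y + h by field.
ring.
Qed.

(** On a square of side [h] containing [(x, y)], [u] differs from its affine approximation by a
    small multiple of [h], and the boundary has length [O(h)]. *)
Let B_local (e : R) x y : 0 < e ->
  x0 <= x <= x0 + h0 -> y0 <= y <= y0 + h0 ->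
  exists2 d, 0 < d & forall x' y' h, 0 < h -> h < d ->
    [/\ x0 <= x', x' + h <= x0 + h0, y0 <= y' & y' + h <= y0 + h0] ->
    x' <= x <= x' + h -> y' <= y <= y' + h -> cmod (B x' y' h) <= e * h ^+ 2.
Proof.
move=> e0 xx yy; have [c cP] := du xx yy.
pose L := `|l| + `|m| + 1; have L0 : 0 < L by rewrite /L ltr_wpDl// addr_ge0.
(* The error is at most [2 e1 h] at each boundary point, hence [4 e1 h^2] for each pair of opposite
   sides; weighting the pairs by [|l|] and [|m|] leaves at most [4 e1 L h^2]. *)
pose e1 := e / (4 * L); have e10 : 0 < e1 by rewrite divr_gt0// mulr_gt0.
have [d d0 dP] := cP _ e10; exists d => // x' y' h hp hd.
move=> [x0x xh y0y yh] /andP[ax bx] /andP[ay b].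
have y1 : y0 <= y' <= y0 + h0 by apply/andP; split; lra.
have y2 : y0 <= y' + h <= y0 + h0 by apply/andP; split; lra.
have x1 : x0 <= x' <= x0 + h0 by apply/andP; split; lra.
have x2 : x0 <= x' + h <= x0 + h0 by apply/andP; split; lra.
have cX : cont_on x' (x' + h) (fun s => u s y' - u s (y' + h)).
  by apply: (@cont_onS _ _ _ _ _ _ x0x xh); apply: cont_onB; exact: cux.
have cY : cont_on y' (y' + h) (fun t => u (x' + h) t - u x' t).
  by apply: (@cont_onS _ _ _ _ _ _ y0y yh); apply: cont_onB; exact: cuy.
pose A s t := u x y + c * ((l * (s - x))%:C + i * (m * (t - y))%:C).
have H s t : x' <= s <= x' + h -> y' <= t <= y' + h ->
    cmod (u s t - A s t) <= e1 * (2 * h).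
  move=> /andP[s1 s2] /andP[t1 t2]; rewrite /A opprD addrA.
  have sh : `|s - x| <= h by rewrite ler_norml; apply/andP; split; lra.
  have th : `|t - y| <= h by rewrite ler_norml; apply/andP; split; lra.
  have := dP (s - x) (t - y) (le_lt_trans sh hd) (le_lt_trans th hd).
  rewrite !subrKC => /le_trans; apply; apply: ler_wpM2l; [exact: ltW|lra].
(* The four boundary integrals of the affine part cancel. *)
have bX : cmod (cintegral x' (x' + h)
    (fun s => u s y' - u s (y' + h) + c * (i * (m * h)%:C))) <= 4 * e1 * h * h.
  have -> : 4 * e1 * h * h = 4 * e1 * h * (x' + h - x') by ring.
  apply: cmod_cintegral_le_cst; first by lra.
    exact: (cont_onD cX (@cont_on_cst _ _ _ _)).
  move=> s sx.
  have -> : u s y' - u s (y' + h) + c * (i * (m * h)%:C) =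
      (u s y' - A s y') - (u s (y' + h) - A s (y' + h)).
    by rewrite /A !mulrBr !mulrDr !rmorphB !rmorphD /=; ring.
  apply: (le_trans (cmodB _ _)).
  have h1 := H s y' sx; have h2 := H s (y' + h) sx.
  have {}h1 : cmod (u s y' - A s y') <= e1 * (2 * h).
    by apply: h1; rewrite lexx /= lerDl; exact: ltW.
  have {}h2 : cmod (u s (y' + h) - A s (y' + h)) <= e1 * (2 * h).
    by apply: h2; rewrite lexx andbT lerDl; exact: ltW.
  lra.
have bY : cmod (cintegral y' (y' + h)
    (fun t => u (x' + h) t - u x' t - c * (l * h)%:C)) <= 4 * e1 * h * h.
  have -> : 4 * e1 * h * h = 4 * e1 * h * (y' + h - y') by ring.
  apply: cmod_cintegral_le_cst; first by lra.
    exact: (cont_onB cY (@cont_on_cst _ _ _ _)).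
  move=> t ty.
  have -> : u (x' + h) t - u x' t - c * (l * h)%:C =
      (u (x' + h) t - A (x' + h) t) - (u x' t - A x' t).
    by rewrite /A !mulrBr !mulrDr !rmorphB !rmorphD /=; ring.
  apply: (le_trans (cmodB _ _)).
  have h1 := H x' t _ ty; have h2 := H (x' + h) t _ ty.
  have {}h1 : cmod (u x' t - A x' t) <= e1 * (2 * h).
    by apply: h1; rewrite lexx /= lerDl; exact: ltW.
  have {}h2 : cmod (u (x' + h) t - A (x' + h) t) <= e1 * (2 * h).
    by apply: h2; rewrite lexx andbT lerDl; exact: ltW.
  lra.
rewrite (cintegralD cX (@cont_on_cst _ _ _ _)) cintegral_cst in bX; last by lra.
rewrite (cintegralB cY (@cont_on_cst _ _ _ _)) cintegral_cst in bY; last by lra.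
have -> : B x' y' h =
    l%:C * (cintegral x' (x' + h) (fun s => u s y' - u s (y' + h)) +
      c * (i * (m * h)%:C) * (x' + h - x')%:C) +
    i * m%:C * (cintegral y' (y' + h) (fun t => u (x' + h) t - u x' t) -
      c * (l * h)%:C * (y' + h - y')%:C).
  by rewrite /B !rmorphB !rmorphD /= !rmorphM /=; ring.
apply: (le_trans (cmodD _ _)); rewrite !cmodM cmod_i mul1r !cmod_real.
have h1 := ler_wpM2l (normr_ge0 l) bX; have h2 := ler_wpM2l (normr_ge0 m) bY.
apply: (le_trans (lerD h1 h2)).
have -> : `|l| * (4 * e1 * h * h) + `|m| * (4 * e1 * h * h) =
  (4 * (`|l| + `|m|) * e1) * h ^+ 2 by ring.
rewrite ler_wpM2r ?sqr_ge0// /e1 mulrA ler_pdivrMr ?mulr_gt0//.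
have := mulr_gt0 e0 (ltr0n R 4); rewrite /L; lra.
Qed.

(** The bound [e * h ^+ 2] is stable under quartering because four squares of side [h / 2] have the
    area of one of side [h]; [B_local] gives it for small squares, and [e] is arbitrary. *)
Lemma goursat_square :
  l%:C * cintegral x0 (x0 + h0) (fun s => u s y0 - u s (y0 + h0)) +
  i * m%:C * cintegral y0 (y0 + h0) (fun t => u (x0 + h0) t - u x0 t) = 0.
Proof.
suff H e : 0 < e -> cmod (B x0 y0 h0) <= e * h0 ^+ 2.
  apply/eqP; rewrite -cmod_eq0 -[cmod _]/(cmod (B x0 y0 h0)) eq_le cmod_ge0 andbT.
  apply/ler_addgt0Pl => e e0; rewrite addr0.
  have h20 : 0 < h0 ^+ 2 by rewrite exprn_gt0.
  by have := H _ (divr_gt0 e0 h20); rewrite divfK// gt_eqF.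
move=> e0; apply: (@cousin_square R (fun x y h => cmod (B x y h) <= e * h ^+ 2)) => //.
- move=> x y h hp sb H1 H2 H3 H4; rewrite B_split//.
  apply: (le_trans (cmodD _ _)).
  have := lerD (lerD H1 H2) (lerD H3 H4).
  have -> : e * (h / 2) ^+ 2 + e * (h / 2) ^+ 2 +
    (e * (h / 2) ^+ 2 + e * (h / 2) ^+ 2) = e * h ^+ 2 by field.
  by apply: le_trans; apply: lerD; exact: cmodD.
- by move=> x y xx yy; exact: B_local.
Qed.

End Goursat.

(** * Circle means and Cauchy's theorem on annuli *)

Section ExpCis.
Variable R : realType.
Local Notation "x %:C" := (x%:C%C : Cplx R).
Local Notation i := ('i%C : Cplx R).

Lemma is_derive_bound (g : R -> R) (x g' : R) : is_derive x (1 : R) g g' ->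
  forall e, 0 < e -> exists2 d : R, 0 < d &
    forall h, `|h| < d -> `|g (x + h) - g x - g' * h| <= e * `|h|.
Proof.
move=> dg e e0; have dgx : differentiable g x by apply/derivable1_diffP.
have /nbhs_ballP[d /= d0 dP] := differentiable_bound dgx e0.
exists d => // h hd; have := dP h.
rewrite diff1E// /ball /= sub0r normrN => /(_ hd).
by rewrite derive1E (@derive_val _ _ _ _ _ _ _ dg) /GRing.scale /= mulrC.
Qed.

Lemma cis_bound (e : R) : 0 < e -> exists2 d : R, 0 < d &
  forall t, `|t| < d -> cmod (cis t - 1 - i * t%:C) <= e * `|t|.
Proof.
move=> e0; have e20 : 0 < e / 2 by rewrite divr_gt0.
have [d1 d10 H1] := is_derive_bound (is_derive_cos (0 : R)) e20.
have [d2 d20 H2] := is_derive_bound (is_derive_sin (0 : R)) e20.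
exists (Num.min d1 d2) => [|t]; first by rewrite lt_min d10.
rewrite lt_min => /andP[/H1 h1 /H2 h2].
have -> : cis t - 1 - i * t%:C = ((cos t - 1) +i* (sin t - t))%C :> Cplx R.
  by apply/eqP; rewrite eq_complex /=; apply/andP; split; apply/eqP; ring.
apply: (le_trans (cmod_leD _)).
move: h1 h2; rewrite !add0r cos0 sin0 oppr0 mul0r mul1r !subr0 ?addr0 => h1 h2.
rewrite /=; lra.
Qed.

(** First-order expansion of [exp (l s + i t)] at the origin; the factor in [1 * t] matches
    [goursat_square] with [m := 1]. *)
Lemma exp_cis_bound (l e : R) : 0 < e -> exists2 d : R, 0 < d &
  forall s t, `|s| < d -> `|t| < d ->
    cmod ((expR (l * s))%:C * cis t - 1 - ((l * s)%:C + i * (1 * t)%:C))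
      <= e * (`|s| + `|t|).
Proof.
move=> e0; pose L := `|l| + 1; have L0 : 0 < L by rewrite ltr_wpDl.
have eL : 0 < e / L by rewrite divr_gt0.
have [d1 d10 H1] := is_derive_bound (is_derive_expR (0 : R)) eL.
have [d2 d20 H2] := is_derive_bound (is_derive_expR (0 : R)) ltr01.
have e40 : 0 < e / 4 by rewrite divr_gt0.
have [d3 d30 H3] := cis_bound e40.
pose d := Num.min (Num.min (d1 / L) (d2 / L)) (Num.min d3 (Num.min (e / 4) (2^-1) / L)).
have m0 : 0 < Num.min (e / 4) (2^-1) by rewrite lt_min e40 invr_gt0 ltr0n.
exists d => [|s t]; first by rewrite !lt_min d30 !divr_gt0.
rewrite !lt_min !ltr_pdivlMr// => /andP[/andP[s1 s2] /andP[s3 s4]].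
move=> /andP[/andP[t1 t2] /andP[t3 t4]].
move: s4; rewrite lt_min => /andP[s4 s5].
have xs : `|l * s| <= `|s| * L.
  by rewrite normrM mulrC ler_wpM2l// /L lerDl.
set x := l * s in xs *.
have h1 := H1 x (le_lt_trans xs s1); have h2 := H2 x (le_lt_trans xs s2).
have h3 := H3 t t3.
rewrite !add0r expR0 !mul1r in h1 h2.
have x1 : `|expR x - 1| <= 2 * `|x|.
  have -> : expR x - 1 = (expR x - 1 - x) + x by ring.
  by apply: (le_trans (ler_normD _ _)); lra.
have x2 : expR x <= 2.
  have := ler_norm (expR x - 1); lra.
(* The errors of the exponential and of [cis], and a mixed term that is small because [expR x - 1]
   is. *)
have -> : (expR x)%:C * cis t - 1 - (x%:C + i * (1 * t)%:C) =
   (expR x - 1 - x)%:C + (expR x)%:C * (cis t - 1 - i * t%:C) +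
   (expR x - 1)%:C * (i * t%:C).
  by rewrite !rmorphB mul1r /=; ring.
apply: (le_trans (cmodD _ _)).
apply: (le_trans (lerD (cmodD _ _) (lexx _))).
rewrite !cmodM cmod_i mul1r !cmod_real (ger0_norm (expR_ge0 _)).
have a1 : `|expR x - 1 - x| <= e * `|s|.
  apply: (le_trans h1); rewrite mulrAC ler_pdivrMr//.
  by rewrite -mulrA; apply: ler_wpM2l => //; exact: ltW.
have a2 : expR x * cmod (cis t - 1 - i * t%:C) <= 2 * (e / 4 * `|t|).
  by apply: ler_pM; rewrite ?expR_ge0 ?cmod_ge0.
have a3 : `|expR x - 1| * `|t| <= e / 2 * `|t|.
  by apply: ler_wpM2r => //; lra.
lra.
Qed.

End ExpCis.

Section CircleMean.
Variable R : realType.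
Local Notation "x %:C" := (x%:C%C : Cplx R).
Local Notation i := ('i%C : Cplx R).

Lemma pi2_gt0 : 0 < 2 * pi :> R.
Proof. by rewrite mulr_gt0// pi_gt0. Qed.

Definition cmean (r : R) (u : Cplx R -> Cplx R) : Cplx R :=
  ((2 * pi)^-1)%:C * cintegral 0 (2 * pi) (fun t => u (r%:C * cis t)).

(** In the coordinates [log |z|] and [arg z] the annulus is a rectangle, rescaled to the square of
    side [2 * pi]. The edges [arg z = 0] and [arg z = 2 pi] cancel by periodicity, and the other two
    give the circle means. *)
Lemma cmean_annulus (u : Cplx R -> Cplx R) (a b : R) : 0 < a -> a <= b ->
  (forall z, a <= cmod z <= b -> differentiable u z) ->
  cmean a u = cmean b u.
Proof.
move=> a0 ab du; have b0 : 0 < b by exact: lt_le_trans ab.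
have p0 := pi2_gt0.
(* The slope for which [rho] runs from [a] to [b] over an interval of length [2 * pi]. *)
pose l := (ln b - ln a) / (2 * pi).
have l0 : 0 <= l by rewrite divr_ge0 ?subr_ge0 ?ler_ln ?posrE//; exact: ltW.
pose rho x := expR (ln a + l * x).
have rho0 x : 0 < rho x by exact: expR_gt0.
have rhoa : rho 0 = a by rewrite /rho mulr0 addr0 lnK// posrE.
have rhob : rho (2 * pi) = b.
  by rewrite /rho /l divfK ?gt_eqF// subrKC lnK// posrE.
have rhoab x : 0 <= x <= 0 + 2 * pi -> a <= rho x <= b.
  rewrite add0r => /andP[x0 x1]; rewrite -{1}rhoa -rhob !ler_expR !lerD2l.
  by apply/andP; split; apply: ler_wpM2l.
pose v x y := u ((rho x)%:C * cis y).
have := @goursat_square R v l 1 0 0 (2 * pi) p0.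
have H : forall x y : R, 0 <= x <= 0 + 2 * pi -> 0 <= y <= 0 + 2 * pi ->
  exists c : Cplx R, forall e : R, 0 < e -> exists2 d : R, 0 < d &
    forall s t, `|s| < d -> `|t| < d ->
      cmod (v (x + s) (y + t) - v x y - c * ((l * s)%:C + i * (1 * t)%:C))
        <= e * (`|s| + `|t|).
  move=> x y xx yy; set z := (rho x)%:C * cis y.
  have zr : cmod z = rho x by rewrite cmod_polar//; exact: ltW.
  have dz : differentiable u z by apply: du; rewrite zr; exact: rhoab.
  have [c cP] := differentiable_cmod dz.
  have z0 : 0 < cmod z by rewrite zr.
  exists (c * z) => e e0.
  pose K := l + 2; have K0 : 0 < K by rewrite /K; lra.
  have e10 : 0 < e / (2 * cmod z * K) by rewrite divr_gt0// !mulr_gt0.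
  have [d1 d10 H1] := cP _ e10.
  have c10 : 0 < cmod c + 1 by rewrite ltr_wpDl ?cmod_ge0.
  have e20 : 0 < e / (2 * cmod z * (cmod c + 1)) by rewrite divr_gt0// !mulr_gt0.
  have [d2 d20 H2] := exp_cis_bound l e20.
  have [d3 d30 H3] := exp_cis_bound l ltr01.
  pose d4 := d1 / (2 * cmod z * K).
  have d40 : 0 < d4 by rewrite divr_gt0// !mulr_gt0.
  exists (Num.min d2 (Num.min d3 d4)) => [|s t]; first by rewrite !lt_min d20 d30.
  rewrite !lt_min => /andP[s2 /andP[s3 s4]] /andP[t2 /andP[t3 t4]].
  have h2 := H2 s t s2 t2; have h3 := H3 s t s3 t3.
  set E := _ * cis t - 1 - _ in h2 h3.
  set w := (l * s)%:C + i * (1 * t)%:C in E h2 h3 *.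
  (* The point moves by [z] times [exp (l s + i t) - 1], so the derivative to use is [c * z]. *)
  have vE : v (x + s) (y + t) = u (z + z * (w + E)).
    have rE : rho (x + s) = rho x * expR (l * s).
      by rewrite /rho -expRD mulrDr addrA.
    by rewrite /v rE rmorphM cisD; congr u; rewrite /E /z /=; ring.
  have wb : cmod w <= (l + 1) * (`|s| + `|t|).
    apply: (le_trans (cmodD _ _)); rewrite cmodM cmod_i !mul1r !cmod_real normrM.
    rewrite (ger0_norm l0) mulrDl mul1r mulrDr.
    have := mulr_ge0 l0 (normr_ge0 t); have := normr_ge0 s; lra.
  have wEb : cmod (w + E) <= K * (`|s| + `|t|).
    by apply: (le_trans (cmodD _ _)); rewrite /K; lra.
  have kb : cmod (z * (w + E)) <= cmod z * K * (`|s| + `|t|).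
    by rewrite cmodM -mulrA; apply: ler_wpM2l => //; exact: ltW.
  have kd : cmod (z * (w + E)) < d1.
    apply: (le_lt_trans kb).
    have := s4; have := t4; rewrite /d4 !ltr_pdivlMr ?mulr_gt0//; lra.
  rewrite vE -[v x y]/(u z).
  have -> : u (z + z * (w + E)) - u z - c * z * w =
    (u (z + z * (w + E)) - u z - c * (z * (w + E))) + c * z * E by ring.
  apply: (le_trans (cmodD _ _)).
  have := H1 _ kd => h1.
  have a1 : e / (2 * cmod z * K) * cmod (z * (w + E)) <= e / 2 * (`|s| + `|t|).
    apply: le_trans (ler_wpM2l (ltW e10) kb) _.
    rewrite le_eqVlt; apply/orP; left; apply/eqP; field.
    by rewrite !gt_eqF.
  have a2 : cmod (c * z * E) <= e / 2 * (`|s| + `|t|).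
    rewrite (cmodM (c * z) E) (cmodM c z).
    apply: le_trans (ler_wpM2l (mulr_ge0 (cmod_ge0 c) (ltW z0)) h2) _.
    rewrite mulrA; apply: ler_wpM2r; first by rewrite addr_ge0.
    rewrite mulrA ler_pdivrMr ?mulr_gt0//.
    have := mulr_gt0 e0 z0; have := mulr_ge0 (cmod_ge0 c) (ltW (mulr_gt0 e0 z0)).
    lra.
  by apply: (le_trans (lerD h1 (lexx _))); lra.
move=> /(_ H); rewrite /v !add0r.
rewrite (@eq_cintegral _ _ _ _ (fun _ => 0)); last first.
  by move=> s _; rewrite cis0 cis_2pi subrr.
rewrite (cintegral_cst _ (ltW p0)) mul0r mulr0 add0r mulr1 => /eqP.
rewrite mulf_eq0 -cmod_eq0 cmod_i oner_eq0 /=.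
have cu r : a <= r <= b -> cont_on 0 (2 * pi) (fun t => u (r%:C * cis t)).
  move=> /andP[ar rb] t _; apply: continuous_curve_comp.
    by apply: continuous_cplxM; [exact: cst_continuous|exact: continuous_cis].
  apply: differentiable_continuous; apply: du.
  by rewrite cmod_polar ?ar// (le_trans (ltW a0) ar).
rewrite cintegralB; last 2 first.
- by apply: cu; rewrite rhob ab lexx.
- by apply: cu; rewrite rhoa ab lexx.
by rewrite rhoa rhob subr_eq0 /cmean => /eqP ->.
Qed.

Lemma cont_circle (u : Cplx R -> Cplx R) (r : R) : 0 <= r ->
  (forall z, cmod z = r -> {for z, continuous u}) ->
  forall a b, cont_on a b (fun t => u (r%:C * cis t)).
Proof.
move=> r0 cu a b t _; apply: continuous_curve_comp; last first.
  by apply: cu; rewrite cmod_polar.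
by apply: continuous_cplxM; [exact: cst_continuous|exact: continuous_cis].
Qed.

End CircleMean.

(** * Fejér means *)

Section CircleMeanTheory.
Variable R : realType.
Local Notation "x %:C" := (x%:C%C : Cplx R).
Implicit Types (u v : Cplx R -> Cplx R) (r : R).

Lemma pow2_inj (j l : nat) : 2 ^+ j = 2 ^+ l :> R -> j = l.
Proof.
by move/eqP; rewrite -(natrX R 2 j) -(natrX R 2 l) eqr_nat eqn_exp2l// => /eqP.
Qed.

Definition cont_circ r u := cont_on 0 (2 * pi) (fun t => u (r%:C * cis t)).

Lemma cont_circM r u v : cont_circ r u -> cont_circ r v ->
  cont_circ r (fun z => u z * v z).
Proof. by move=> cu cv; exact: (cont_onM cu cv). Qed.

Lemma cont_circB r u v : cont_circ r u -> cont_circ r v ->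
  cont_circ r (fun z => u z - v z).
Proof. by move=> cu cv; exact: (cont_onB cu cv). Qed.

Lemma cont_circ_cst r (c : Cplx R) : cont_circ r (fun=> c).
Proof. exact: cont_on_cst. Qed.

Lemma continuous_cplxX (h : R -> Cplx R) n t :
  {for t, continuous h} -> {for t, continuous (fun s => h s ^+ n)}.
Proof.
move=> ch; elim: n => [|n IH].
  exact: cst_continuous.
have -> : (fun s => h s ^+ n.+1) = (fun s => h s * h s ^+ n).
  by apply/funext => s; rewrite exprS.
exact: (continuous_cplxM ch IH).
Qed.

Lemma cont_circ_mono r j l : cont_circ r (fun z => z ^+ j * z^-1 ^+ l).
Proof.
have cx : cont_on 0 (2 * pi) (fun t => r%:C * cis t).
  apply: (@cont_onZ _ _ _ (r%:C) (@cis R)) => t _; exact: continuous_cis.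
have cxV : cont_on 0 (2 * pi) (fun t => (r%:C * cis t)^-1).
  have -> : (fun t => (r%:C * cis t)^-1) = (fun t => r%:C^-1 * cis (- t)).
    by apply/funext => t; rewrite invfM cisN.
  apply: (@cont_onZ _ _ _ (r%:C^-1) (fun t => cis (- t))) => t _.
  apply: (@continuous_comp _ _ _ (fun t : R => - t) (@cis R)).
    exact: (@opp_continuous R).
  exact: continuous_cis.
apply: (@cont_onM _ _ _ (fun t => (r%:C * cis t) ^+ j)
    (fun t => (r%:C * cis t)^-1 ^+ l)) => t tt.
  exact: (continuous_cplxX (n := j) (cx t tt)).
exact: (continuous_cplxX (n := l) (cxV t tt)).
Qed.

Lemma eq_cmean r u v : (forall t, u (r%:C * cis t) = v (r%:C * cis t)) ->
  cmean r u = cmean r v.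
Proof. by move=> uv; rewrite /cmean; congr (_ * _); apply: eq_cintegral. Qed.

Lemma cmeanZ r c u : cont_circ r u -> cmean r (fun z => c * u z) = c * cmean r u.
Proof. by move=> cu; rewrite /cmean (cintegralZ c cu) mulrCA. Qed.

Lemma cmeanD r u v : cont_circ r u -> cont_circ r v ->
  cmean r (fun z => u z + v z) = cmean r u + cmean r v.
Proof. by move=> cu cv; rewrite /cmean (cintegralD cu cv) mulrDr. Qed.

Lemma cmeanB r u v : cont_circ r u -> cont_circ r v ->
  cmean r (fun z => u z - v z) = cmean r u - cmean r v.
Proof. by move=> cu cv; rewrite /cmean (cintegralB cu cv) mulrBr. Qed.

Lemma cont_circ_sum r n (w : nat -> Cplx R -> Cplx R) :
  (forall j, cont_circ r (w j)) ->
  cont_circ r (fun z => \sum_(j < n) w j z).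
Proof. by move=> cw; apply: (cont_on_sum (h := fun j t => w j (r%:C * cis t))). Qed.

Lemma cmean_sum r n (w : nat -> Cplx R -> Cplx R) :
  (forall j, cont_circ r (w j)) ->
  cmean r (fun z => \sum_(j < n) w j z) = \sum_(j < n) cmean r (w j).
Proof.
move=> cw; rewrite /cmean.
rewrite (cintegral_sum _ (h := fun j t => w j (r%:C * cis t)))//.
  by rewrite big_distrr.
exact: ltW (pi2_gt0 R).
Qed.

Lemma cmean_cst r (c : Cplx R) : cmean r (fun=> c) = c.
Proof.
rewrite /cmean cintegral_cst ?(ltW (pi2_gt0 R))// subr0 mulrCA -rmorphM.
by rewrite mulVf ?gt_eqF ?pi2_gt0// mulr1.
Qed.

Lemma cmod_cmean_le r u (M : R) : cont_circ r u ->
  (forall t, 0 <= t <= 2 * pi -> cmod (u (r%:C * cis t)) <= M) ->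
  cmod (cmean r u) <= M.
Proof.
move=> cu uM; have p0 := pi2_gt0 R.
rewrite /cmean cmodM cmod_nneg ?invr_ge0 ?(ltW p0)// ler_pdivrMl// [X in _ <= X]mulrC.
apply: (le_trans (cmod_cintegral_le_cst (ltW p0) cu uM)).
by rewrite subr0.
Qed.

(* Scaling the circle by [2] multiplies this mean by [2 ^ (l - j)], whereas
   [cmean_annulus] says that it does not change. *)
Lemma cmean_mono r j l : 0 < r -> j != l ->
  cmean r (fun z => z ^+ l * z^-1 ^+ j) = 0.
Proof.
move=> r0 jl; set g := fun z : Cplx R => _.
have r20 : 0 < 2 * r by rewrite mulr_gt0.
have E1 : cmean r g = cmean (2 * r) g.
  apply: (@cmean_annulus R g r (2 * r) r0); first by lra.
  move=> z /andP[rz _]; have z0 : z != 0 by rewrite -cmod_gt0; exact: lt_le_trans rz.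
  apply: (differentiable_mul (differentiable_pow l (differentiable_var z))).
  apply: (differentiable_pow (f := fun x : Cplx R => x^-1) j).
  exact: (differentiable_inv (differentiable_var z) z0).
pose k : Cplx R := 2 ^+ l * 2^-1 ^+ j.
have E2 : cmean (2 * r) g = k * cmean r g.
  rewrite -cmeanZ; last exact: cont_circ_mono.
  rewrite /cmean; congr (_ * _); apply: eq_cintegral => t _.
  have -> : (2 * r)%:C * cis t = 2 * (r%:C * cis t).
    by rewrite rmorphM rmorph_nat mulrA.
  move: (r%:C * cis t) => w; rewrite /g /k.
  by rewrite (exprMn l 2 w) (invfM 2 w) (exprMn j 2^-1 w^-1); exact: mulrACA.
have k1 : k != 1.
  apply/eqP => kE; have two0 : (2 : Cplx R) != 0 by rewrite pnatr_eq0.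
  have : k * 2 ^+ j = 2 ^+ l.
    by rewrite /k -mulrA -(exprMn j) (mulVf two0) expr1n mulr1.
  rewrite kE mul1r => /(congr1 (@cmod R)).
  by rewrite (cmodX 2 j) (cmodX 2 l) (cmod_natr R 2) => /pow2_inj /eqP; apply/negP.
have : (k - 1) * cmean r g = 0 by rewrite mulrBl mul1r -E2 -E1 subrr.
by move/eqP; rewrite mulf_eq0 subr_eq0 (negPf k1) /= => /eqP.
Qed.

(* Summing over pairs [(j, l)] gives [z^(j - l)] its Fejér weight
   [(N + 1 - |j - l|) / (N + 1)] and avoids integer exponents. *)
Definition fejer N r u (z : Cplx R) : Cplx R :=
  N.+1%:R^-1 * \sum_(j < N.+1) \sum_(l < N.+1)
    cmean r (fun x => u x * (x ^+ l * x^-1 ^+ j)) * (z ^+ j * z^-1 ^+ l).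

Let geo N (q : Cplx R) := \sum_(j < N.+1) q ^+ j.

(** The Fejér kernel at [z / x], written as a square so that it is visibly nonnegative. *)
Definition fejer_kernel N (z x : Cplx R) : R :=
  N.+1%:R^-1 * cmod (geo N (z / x)) ^+ 2.

Lemma fejer_kernel_ge0 N z x : 0 <= fejer_kernel N z x.
Proof. by rewrite mulr_ge0 ?invr_ge0 ?sqr_ge0. Qed.

(** The quotient [q := z / x] has modulus [1], so its conjugate is [x / z] and the square of the
    modulus expands into the double sum of [fejer]. *)
Lemma fejer_kernelE N r z x : 0 < r -> cmod z = r -> cmod x = r ->
  (fejer_kernel N z x)%:C = N.+1%:R^-1 * \sum_(j < N.+1) \sum_(l < N.+1)
    (x ^+ l * x^-1 ^+ j) * (z ^+ j * z^-1 ^+ l).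
Proof.
move=> r0 zr xr; rewrite /fejer_kernel rmorphM fmorphV rmorph_nat; congr (_ * _).
rewrite rmorphXn /= cmodE sqr_normc.
have z0 : z != 0 by rewrite -cmod_gt0 zr.
have x0 : x != 0 by rewrite -cmod_gt0 xr.
set q := z / x.
have q1 : q * (q^*)%C = 1.
  rewrite -sqr_normc -cmodE cmodM cmodV zr xr mulfV ?gt_eqF//.
  by rewrite expr1n.
have q0 : q != 0 by rewrite mulf_neq0// invr_eq0.
have qV : (q^*)%C = x / z.
  by apply: (mulfI q0); rewrite q1 /q mulrA divfK// mulfV.
have -> : ((geo N q)^*)%C = \sum_(l < N.+1) (x / z) ^+ l.
  rewrite /geo raddf_sum; apply: eq_bigr => l _.
  by rewrite -qV; exact: (rmorphXn (@conjc R)).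
rewrite mulr_suml; apply: eq_bigr => j _; rewrite mulr_sumr; apply: eq_bigr => l _.
by rewrite /q !exprMn; ring.
Qed.

(** Telescoping: [(1 - q) * geo N q = 1 - q ^+ N.+1] has modulus at most [2], while
    [|x - z| = r |1 - q|]. *)
Lemma fejer_kernel_far N r z x d : 0 < r -> cmod z = r -> cmod x = r ->
  0 < d -> d <= cmod (x - z) ->
  fejer_kernel N z x <= 4 * r ^+ 2 / (N.+1%:R * d ^+ 2).
Proof.
move=> r0 zr xr d0 xz; rewrite /fejer_kernel.
have x0 : x != 0 by rewrite -cmod_gt0 xr.
set q := z / x; have q1 : cmod q = 1 by rewrite cmodM cmodV zr xr mulfV ?gt_eqF.
have E : cmod (geo N q) * cmod (x - z) <= 2 * r.
  have -> : x - z = x * (1 - q) by rewrite mulrBr mulr1 /q mulrCA mulfV// mulr1.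
  rewrite mulrC cmodM -mulrA -cmodM.
  have -> : (1 - q) * geo N q = 1 - q ^+ N.+1.
    by rewrite -opprB mulNr -subrX1 opprB.
  rewrite xr mulrC ler_pM2r//; apply: (le_trans (cmodB _ _)).
  by rewrite cmod1 cmodX q1 expr1n.
have g0 := cmod_ge0 (geo N q).
have gd : cmod (geo N q) * d <= 2 * r.
  by apply: le_trans E; apply: ler_wpM2l.
have -> : 4 * r ^+ 2 / (N.+1%:R * d ^+ 2) = N.+1%:R^-1 * (4 * r ^+ 2 / d ^+ 2).
  by rewrite invfM mulrCA.
apply: ler_wpM2l; first by rewrite invr_ge0.
rewrite ler_pdivlMr ?exprn_gt0// -exprMn.
have -> : 4 * r ^+ 2 = (2 * r) ^+ 2 by ring.
by rewrite ler_sqr// nnegrE ?mulr_ge0 ?(ltW r0) ?(ltW d0).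
Qed.

Lemma cont_circ_kernel N r z : 0 < r -> cmod z = r ->
  cont_circ r (fun x => (fejer_kernel N z x)%:C).
Proof.
move=> r0 zr; rewrite /cont_circ.
have -> : (fun t => (fejer_kernel N z (r%:C * cis t))%:C) =
   (fun t => (fun x => N.+1%:R^-1 * \sum_(j < N.+1) \sum_(l < N.+1)
    ((z ^+ j * z^-1 ^+ l) * (x ^+ l * x^-1 ^+ j))) (r%:C * cis t)).
  apply/funext => t; rewrite (@fejer_kernelE N r)//; last first.
    by rewrite cmod_polar//; exact: ltW.
  by congr (_ * _); apply: eq_bigr => j _; apply: eq_bigr => l _; exact: mulrC.
apply: (@cont_onZ).
apply: (@cont_circ_sum r N.+1 (fun j x => \sum_(l < N.+1)
    ((z ^+ j * z^-1 ^+ l) * (x ^+ l * x^-1 ^+ j)))) => j.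
apply: (@cont_circ_sum r N.+1 (fun l x =>
    ((z ^+ j * z^-1 ^+ l) * (x ^+ l * x^-1 ^+ j)))) => l.
exact: (cont_circM (@cont_circ_cst r (z ^+ j * z^-1 ^+ l)) (@cont_circ_mono r l j)).
Qed.

Lemma fejerE N r u z : 0 < r -> cmod z = r -> cont_circ r u ->
  fejer N r u z = cmean r (fun x => u x * (fejer_kernel N z x)%:C).
Proof.
move=> r0 zr cu.
have cmn j l : cont_circ r (fun x => (z ^+ j * z^-1 ^+ l) *
    (u x * (x ^+ l * x^-1 ^+ j))).
  apply: cont_circM; first exact: (@cont_circ_cst r (z ^+ j * z^-1 ^+ l)).
  exact: (cont_circM cu (@cont_circ_mono r l j)).
rewrite (@eq_cmean r _ (fun x => N.+1%:R^-1 * \sum_(j < N.+1) \sum_(l < N.+1)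
    ((z ^+ j * z^-1 ^+ l) * (u x * (x ^+ l * x^-1 ^+ j))))); last first.
  move=> t; rewrite (@fejer_kernelE N r)//; last first.
    by rewrite cmod_polar//; exact: ltW.
  rewrite mulrCA; congr (_ * _); rewrite mulr_sumr; apply: eq_bigr => j _.
  by rewrite mulr_sumr; apply: eq_bigr => l _; ring.
pose w2 j x := \sum_(l < N.+1) ((z ^+ j * z^-1 ^+ l) * (u x * (x ^+ l * x^-1 ^+ j))).
have c2 j : cont_circ r (w2 j) by exact: (cont_circ_sum (cmn j)).
rewrite (@cmeanZ r _ (fun x => \sum_(j < N.+1) w2 j x) (cont_circ_sum c2)).
rewrite /fejer; congr (_ * _).
rewrite (@cmean_sum r N.+1 w2 c2); apply: eq_bigr => j _.
rewrite (cmean_sum _ (cmn j)); apply: eq_bigr => l _.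
by rewrite (cmeanZ _ (cont_circM cu (@cont_circ_mono r l j))) [LHS]mulrC.
Qed.

(** This is the Fejér mean of the constant [1]: off-diagonal moments vanish and each of the [N.+1]
    diagonal terms is [1]. *)
Lemma cmean_fejer_kernel N r z : 0 < r -> cmod z = r ->
  cmean r (fun x => (fejer_kernel N z x)%:C) = 1.
Proof.
move=> r0 zr; have z0 : z != 0 by rewrite -cmod_gt0 zr.
have := @fejerE N r (fun=> 1) z r0 zr (@cont_circ_cst r 1).
rewrite (@eq_cmean r (fun x => 1 * _) (fun x => (fejer_kernel N z x)%:C)); last first.
  by move=> t; rewrite mul1r.
move=> <-; rewrite /fejer.
rewrite (eq_bigr (fun=> 1)); last first.
  move=> j _; rewrite (bigD1 j)//= [X in _ + X]big1 ?addr0; last first.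
    move=> l lj; rewrite (@eq_cmean r _ (fun x => x ^+ l * x^-1 ^+ j)); last first.
      by move=> t; rewrite mul1r.
    by rewrite cmean_mono// ?mul0r// eq_sym.
  rewrite (@eq_cmean r _ (fun=> 1)); last first.
    move=> t; rewrite mul1r -exprMn mulfV ?expr1n//.
    by rewrite -cmod_gt0 cmod_polar//; exact: ltW.
  by rewrite cmean_cst mul1r -exprMn mulfV// expr1n.
by rewrite sumr_const card_ord -mulr_natr mul1r mulVf// pnatr_eq0.
Qed.

(** The kernel is nonnegative of mean [1]: points within [d] of [z] contribute at most [e], and the
    others at most [2 B] times the bound of [fejer_kernel_far]. The error is explicit in [N] and
    [r], so that one [N] can later serve all radii. *)
Lemma fejer_approx N r u z (B d e : R) : 0 < r -> cmod z = r -> 0 < d ->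
  0 <= e -> cont_circ r u ->
  (forall t, 0 <= t <= 2 * pi -> cmod (u (r%:C * cis t)) <= B) ->
  cmod (u z) <= B ->
  (forall t, cmod (r%:C * cis t - z) < d ->
     cmod (u (r%:C * cis t) - u z) <= e) ->
  cmod (fejer N r u z - u z) <= e + 8 * B * r ^+ 2 / (N.+1%:R * d ^+ 2).
Proof.
move=> r0 zr d0 e0 cu uB zB ue.
have B0 : 0 <= B by apply: le_trans zB; exact: cmod_ge0.
have ck := @cont_circ_kernel N r z r0 zr.
have p0 := pi2_gt0 R.
pose kap t := fejer_kernel N z (r%:C * cis t).
have cmx : cont_on 0 (2 * pi) (fun t => (kap t)%:C) by exact: ck.
have kapc t : 0 <= t <= 2 * pi -> {for t, continuous kap}.
  by move=> tt; have /continuous_Re := cmx t tt.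
have E1 : (2 * pi)^-1 * \int[lebesgue_measure]_(t in `[0, 2 * pi]) kap t = 1.
  have := cmean_fejer_kernel N r0 zr.
  by rewrite /cmean /cintegral => /(congr1 (@complex.Re R)) /=; rewrite mul0r subr0.
have -> : fejer N r u z - u z =
    cmean r (fun x => (u x - u z) * (fejer_kernel N z x)%:C).
  rewrite fejerE// -[X in _ - X]mulr1 -(cmean_fejer_kernel N r0 zr) -(cmeanZ (u z) ck).
  rewrite -cmeanB; last 2 first.
  - exact: (cont_circM cu ck).
  - exact: (cont_circM (@cont_circ_cst r (u z)) ck).
  by apply: eq_cmean => t; rewrite mulrBl.
set C := 8 * B * r ^+ 2 / (N.+1%:R * d ^+ 2).
have C0 : 0 <= C.
  by rewrite divr_ge0 ?mulr_ge0 ?exprn_ge0// ?(ltW r0) ?(ltW d0).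
(* The near and far bounds are added, so that one continuous function dominates the integrand on the
   whole circle. *)
have kapg t : 0 <= t <= 2 * pi -> {for t, continuous (fun t => e * kap t + C)}.
  move=> tt; have ck' : kap @ t --> kap t by exact: kapc.
  exact: (cvgD (cvgM (cvg_cst e) ck') (cvg_cst C)).
rewrite /cmean cmodM cmod_nneg ?invr_ge0 ?(ltW p0)//.
rewrite ler_pdivrMl//.
have chh : cont_on 0 (2 * pi)
    (fun t => (u (r%:C * cis t) - u z) * (kap t)%:C).
  exact: (cont_circM (cont_circB cu (@cont_circ_cst r (u z))) ck).
apply: (le_trans (cmod_cintegral_le chh kapg _)).
  move=> t tt; set x := r%:C * cis t; rewrite cmodM cmod_nneg ?fejer_kernel_ge0//.
  have k0 : 0 <= kap t by exact: fejer_kernel_ge0.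
  have [h|h] := ltP (cmod (x - z)) d.
    apply: (@le_trans _ _ (e * kap t)); last by rewrite lerDl.
    by apply: ler_wpM2r => //; exact: ue.
  apply: (@le_trans _ _ C); last by rewrite lerDr mulr_ge0.
  have h1 : cmod (u x - u z) <= 2 * B.
    by apply: (le_trans (cmodB _ _)); have := uB t tt; rewrite -/x; lra.
  have xr : cmod x = r by rewrite cmod_polar//; exact: ltW.
  have h2 := @fejer_kernel_far N r z x d r0 zr xr d0 h.
  apply: (le_trans (ler_pM (cmod_ge0 _) k0 h1 h2)).
  by rewrite /C mulrA; apply: ler_wpM2r; [rewrite invr_ge0 mulr_ge0// ?exprn_ge0// ltW|lra].
have ik : lebesgue_measure.-integrable `[0, 2 * pi] (EFin \o kap).
  exact: integrable_cont.
have ic (c : R) : lebesgue_measure.-integrable `[(0 : R), 2 * pi] (EFin \o (fun _ => c)).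
  by apply: integrable_cont => t _; exact: cst_continuous.
rewrite RintegralD//; last first.
  by apply: integrable_cont => t tt; exact: (cvgM (cvg_cst e) (kapc t tt)).
rewrite RintegralZl// Rintegral_itv_cst ?(ltW p0)//.
have -> : \int[lebesgue_measure]_(t in `[0, 2 * pi]) kap t = 2 * pi.
  have /(congr1 ( *%R (2 * pi))) := E1.
  by rewrite (mulVKf (lt0r_neq0 p0)) mulr1.
by rewrite /= subr0 le_eqVlt; apply/orP; left; apply/eqP; ring.
Qed.

End CircleMeanTheory.

(** * Cesàro means of power series *)

Section PowerSeries.
Variable R : realType.
Local Notation "x %:C" := (x%:C%C : Cplx R).
Implicit Types (u v : Cplx R -> Cplx R) (r : R).

Lemma cont_on_bounded a b (h : R -> Cplx R) : a <= b -> cont_on a b h ->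
  exists B, forall t, a <= t <= b -> cmod (h t) <= B.
Proof.
move=> ab ch.
have [|c _ cP] := @EVT_max R (fun t => cmod (h t)) a b ab.
  apply: continuous_in_subspaceT => t; rewrite inE /= in_itv /= => tt.
  exact: (continuous_cmod_curve (ch t tt)).
by exists (cmod (h c)) => t tt; apply: cP; rewrite in_itv.
Qed.

(** In row [j] the pairs with [l > j] carry negative powers, whose coefficients vanish by
    hypothesis; the others, reindexed by [m = j - l], form a partial sum of a power series. The
    Fejér mean is thus a Cesàro mean. *)
Lemma fejer_partial_sums N r u z : 0 < r -> cmod z = r ->
  (forall m, cmean r (fun x => u x * x ^+ m.+1) = 0) ->
  fejer N r u z = N.+1%:R^-1 * \sum_(j < N.+1) \sum_(m < j.+1)
    cmean r (fun x => u x * x^-1 ^+ m) * z ^+ m.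
Proof.
move=> r0 zr u0; have z0 : z != 0 by rewrite -cmod_gt0 zr.
have xn0 t : r%:C * cis t != 0 by rewrite -cmod_gt0 cmod_polar// ltW.
rewrite /fejer; congr (_ * _); apply: eq_bigr => j _.
pose G l := cmean r (fun x => u x * (x ^+ l * x^-1 ^+ j)) * (z ^+ j * z^-1 ^+ l).
rewrite -(big_mkord xpredT G) (big_cat_nat (n := j.+1))//=.
rewrite [X in _ + X]big1_seq ?addr0; last first.
  move=> l; rewrite mem_index_iota /= => /andP[jl _].
  rewrite /G (@eq_cmean _ r _ (fun x => u x * x ^+ (l - j.+1).+1)); last first.
    move=> t; move: (xn0 t); move: (r%:C * cis t) => x x0; congr (_ * _).
    rewrite -{1}(subnK jl) addnS -addSn exprD -mulrA -exprMn mulfV//.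
    by rewrite expr1n mulr1.
  by rewrite u0 mul0r.
rewrite big_nat_rev /= big_mkord; apply: eq_bigr => m _.
have mj : (m <= j)%N by rewrite -ltnS.
rewrite add0n subSS /G.
have K (x : Cplx R) (a b : nat) : (a <= b)%N -> x != 0 ->
    x ^+ (b - a) * x^-1 ^+ b = x^-1 ^+ a.
  move=> ab x0; rewrite -{2}(subnK ab) exprD mulrA -exprMn mulfV//.
  by rewrite expr1n mul1r.
congr (_ * _).
  by apply: eq_cmean => t; rewrite (K _ _ _ mj (xn0 t)).
have := K z^-1 _ _ mj; rewrite invrK invr_eq0 => /(_ z0) <-; exact: mulrC.
Qed.

(** The Fejér means at [z] tend to [u z] by continuity, and they are averages of partial sums that
    are eventually within [e] of [L]. Thus [u z] is located without knowing that its series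
    converges to it. *)
Lemma partial_sums_limit u r z (L : Cplx R) (e : R) n : 0 < r -> cmod z = r ->
  (forall x, cmod x = r -> {for x, continuous u}) ->
  (forall m, cmean r (fun x => u x * x ^+ m.+1) = 0) ->
  (forall j, (n <= j)%N -> cmod (\sum_(m < j.+1)
     cmean r (fun x => u x * x^-1 ^+ m) * z ^+ m - L) <= e) ->
  cmod (u z - L) <= e.
Proof.
move=> r0 zr cu u0 sL.
set s := fun j => \sum_(m < j.+1) cmean r (fun x => u x * x^-1 ^+ m) * z ^+ m.
have {}sL j : (n <= j)%N -> cmod (s j - L) <= e by exact: sL.
have e0 : 0 <= e by apply: le_trans (sL n (leqnn n)); exact: cmod_ge0.
have ccu := cont_circle (ltW r0) cu.
have [B1 B1P] := cont_on_bounded (ltW (pi2_gt0 R)) (ccu 0 (2 * pi)).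
pose B := Num.max B1 (cmod (u z)).
have uB t : 0 <= t <= 2 * pi -> cmod (u (r%:C * cis t)) <= B.
  by move=> tt; rewrite le_max B1P.
have zB : cmod (u z) <= B by rewrite le_max lexx orbT.
have B0 : 0 <= B by apply: le_trans zB; exact: cmod_ge0.
apply/ler_addgt0Pl => eta0 eta00; pose eta := eta0 / 3.
have eta_gt0 : 0 < eta by rewrite divr_gt0.
have /continuous_cmodP/(_ _ eta_gt0)[d d0 dP] := cu z zr.
(* [K] collects the first [n] partial sums, about which nothing is assumed. *)
pose K := \sum_(j < n) cmod (s j - L).
have K0 : 0 <= K by apply: sumr_ge0 => j _; exact: cmod_ge0.
have Kk k : \sum_(j < n + k) cmod (s j - L) <= K + k%:R * e.
  elim: k => [|k IH]; first by rewrite mul0r addr0 addn0.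
  rewrite addnS big_ord_recr /= -natr1 mulrDl mul1r addrA; apply: lerD => //.
  by apply: sL; rewrite leq_addr.
(* [N.+1 >= X] makes both [K / N.+1] and the error of [fejer_approx] at most [eta]. *)
pose X := K / eta + 8 * B * r ^+ 2 / (d ^+ 2 * eta).
have X1 : 0 <= K / eta by rewrite divr_ge0// ltW.
have X2 : 0 <= 8 * B * r ^+ 2 / (d ^+ 2 * eta).
  by rewrite divr_ge0 ?mulr_ge0 ?exprn_ge0// ltW.
have XN := archi_boundP (addr_ge0 X1 X2); set k := Num.bound _ in XN.
pose N := (n + k)%N.
have NX : X <= N.+1%:R.
  apply: (le_trans (ltW XN)); rewrite ler_nat /N.
  by apply: leqW; exact: leq_addl.
have N0 : 0 < N.+1%:R :> R by rewrite ltr0n.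
have F1 : cmod (fejer N r u z - u z) <= eta + eta.
  have := fejer_approx N r0 zr d0 (ltW eta_gt0) (ccu 0 (2 * pi)) uB zB
    (fun t h => ltW (dP _ h)).
  move=> /le_trans; apply; rewrite lerD2l.
  rewrite ler_pdivrMr ?mulr_gt0 ?exprn_gt0//.
  have : 8 * B * r ^+ 2 / (d ^+ 2 * eta) <= N.+1%:R by rewrite /X in NX; lra.
  by rewrite ler_pdivrMr ?mulr_gt0 ?exprn_gt0//; lra.
have F2 : cmod (fejer N r u z - L) <= eta + e.
  rewrite (@fejer_partial_sums N r u z r0 zr u0).
  have -> : N.+1%:R^-1 * (\sum_(j < N.+1) s j) - L =
      N.+1%:R^-1 * \sum_(j < N.+1) (s j - L).
    have N1 : N.+1%:R != 0 :> Cplx R by rewrite pnatr_eq0.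
    rewrite sumrB sumr_const card_ord mulrBr -[L *+ _]mulr_natl mulrA.
    by rewrite (mulVf N1) mul1r.
  rewrite cmodM cmodV cmod_natr ler_pdivrMl//.
  apply: (le_trans (cmod_sum _ _ _)).
  rewrite /N -addnS; apply: (le_trans (Kk k.+1)).
  rewrite mulrDr; apply: lerD.
    have : K / eta <= N.+1%:R by rewrite /X in NX; lra.
    by rewrite ler_pdivrMr// /N addnS.
  by apply: ler_wpM2r => //; rewrite ler_nat leq_addl.
have -> : u z - L = (fejer N r u z - L) - (fejer N r u z - u z) by ring.
apply: (le_trans (cmodB _ _)); rewrite /eta in F1 F2; lra.
Qed.

End PowerSeries.

(** * Taylor expansion on the unit disc *)

Section Taylor.
Variable R : realType.
Local Notation "x %:C" := (x%:C%C : Cplx R).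
Implicit Types (u v : Cplx R -> Cplx R) (r : R).


(** The mean is the same on every circle of radius [p <= r], and for [p <= 1] it is at most
    [M p^(m+1) <= M p], which tends to [0] with [p]. *)
Lemma cmean_punctured_disc u r (M : R) m : 0 < r ->
  (forall z, 0 < cmod z <= r -> differentiable u z) ->
  (forall z, 0 < cmod z <= r -> cmod (u z) <= M) ->
  cmean r (fun x => u x * x ^+ m.+1) = 0.
Proof.
move=> r0 du uM.
have dum z : 0 < cmod z <= r -> differentiable (fun x => u x * x ^+ m.+1) z.
  move=> zr; exact: (differentiable_mul (du z zr)
    (differentiable_pow m.+1 (differentiable_var z))).
have rr : 0 < cmod (r%:C) <= r by rewrite cmod_nneg ?lexx ?r0// ltW.
have M0 : 0 <= M by apply: le_trans (uM _ rr); exact: cmod_ge0.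
have B (p : R) : 0 < p -> p <= r -> p <= 1 ->
    cmod (cmean r (fun x => u x * x ^+ m.+1)) <= M * p.
  move=> p0 pr p1.
  have <- : cmean p (fun x => u x * x ^+ m.+1) =
            cmean r (fun x => u x * x ^+ m.+1).
    apply: (@cmean_annulus R (fun x => u x * x ^+ m.+1) p r p0 pr) => z.
    move=> /andP[pz zr]; apply: dum.
    by rewrite zr (lt_le_trans p0 pz).
  apply: cmod_cmean_le.
    apply: cont_circle => [|z zp]; first exact: ltW.
    by apply: differentiable_continuous; apply: dum; rewrite zp p0.
  move=> t _; have pc : cmod (p%:C * cis t) = p by rewrite cmod_polar// ltW.
  rewrite cmodM cmodX pc; apply: ler_pM; rewrite ?cmod_ge0 ?exprn_ge0 ?(ltW p0)//.
    by apply: uM; rewrite pc p0.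
  by rewrite exprS ler_piMr ?(ltW p0)// exprn_ile1// ltW.
apply/eqP; rewrite -cmod_eq0 eq_le cmod_ge0 andbT.
apply/ler_addgt0Pl => e e0; rewrite addr0.
have M1 : 0 < M + 1 by rewrite ltr_wpDl.
pose p := Num.min (Num.min r 1) (e / (M + 1)).
have p0 : 0 < p by rewrite !lt_min r0 ltr01 divr_gt0.
have pr : p <= r by rewrite !ge_min lexx.
have p1 : p <= 1 by rewrite !ge_min lexx orbT.
have pe : p * (M + 1) <= e by rewrite -ler_pdivlMr// ge_min lexx orbT.
by apply: (le_trans (B p p0 pr p1)); lra.
Qed.

Lemma geometric_sum_le (q : R) k : 0 <= q -> q <= 1 / 2 ->
  \sum_(m < k) q ^+ m <= 2.
Proof.
move=> q0 q1; suff : \sum_(m < k) q ^+ m <= 2 - 2 * q ^+ k.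
  by move=> H; apply: (le_trans H); rewrite gerBl mulr_ge0// exprn_ge0.
elim: k => [|k IH]; first by rewrite big_ord0 expr0; lra.
rewrite big_ord_recr /= exprS.
have q2 : 2 * q * q ^+ k <= 1 * q ^+ k.
  by apply: ler_wpM2r; [rewrite exprn_ge0|lra].
lra.
Qed.

(** The coefficients are means over the unit circle and, by [cmean_annulus], also over [|x| = |z|].
    There [partial_sums_limit] applies with the [n]-th partial sum as [L]: since [|c j| <= M] and
    [|z| <= 1 / 2], a geometric sum bounds the distance of the later partial sums to it. *)
Lemma taylor_unit_disc u (M : R) :
  (forall z, cmod z <= 1 -> differentiable u z) ->
  (forall z, cmod z <= 1 -> cmod (u z) <= M) ->
  exists c : nat -> Cplx R, (forall j, cmod (c j) <= M) /\
    forall n z, cmod z <= 1 / 2 ->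
      cmod (u z - \sum_(j < n) c j * z ^+ j) <= 2 * M * cmod z ^+ n.
Proof.
move=> du uM; have M0 : 0 <= M.
  by apply: le_trans (uM 0 _); rewrite ?cmod_ge0// cmod0.
pose c j := cmean 1 (fun x => u x * x^-1 ^+ j).
have dinv j z : 0 < cmod z -> cmod z <= 1 ->
    differentiable (fun x => u x * x^-1 ^+ j) z.
  move=> z0 z1; have zn0 : z != 0 by rewrite -cmod_gt0.
  apply: (differentiable_mul (du z z1)
    (differentiable_pow (f := fun x : Cplx R => x^-1) j _)).
  exact: (differentiable_inv (differentiable_var z) zn0).
have cM j : cmod (c j) <= M.
  apply: cmod_cmean_le.
    apply: cont_circle => [|z z1]; first exact: ler01.
    by apply: differentiable_continuous; apply: dinv; rewrite z1.
  move=> t _; have pc : cmod (1%:C * cis t) = 1 by rewrite cmod_polar.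
  rewrite cmodM cmodX cmodV pc invr1 expr1n mulr1.
  by apply: uM; rewrite pc.
have H0 n z : 0 < cmod z -> cmod z <= 1 / 2 ->
    cmod (u z - \sum_(j < n) c j * z ^+ j) <= 2 * M * cmod z ^+ n.
  move=> z0 z2; set r := cmod z in z0 z2 *.
  have cr j : cmean r (fun x => u x * x^-1 ^+ j) = c j.
    apply: (@cmean_annulus R (fun x => u x * x^-1 ^+ j) r 1 z0); first by lra.
    by move=> x /andP[xr x1]; apply: dinv => //; exact: lt_le_trans xr.
  apply: (@partial_sums_limit R u r z _ _ n z0 erefl).
  - move=> x xr; apply: differentiable_continuous; apply: du.
    by rewrite xr; lra.
  - move=> m; apply: (@cmean_punctured_disc u r M m z0).
      by move=> x /andP[_ xr]; apply: du; lra.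
    by move=> x /andP[_ xr]; apply: uM; lra.
  - move=> j nj; rewrite (eq_bigr (fun m : 'I_j.+1 => c m * z ^+ m)); last first.
      by move=> m _; rewrite cr.
    have -> : j.+1 = (n + (j.+1 - n))%N by rewrite subnKC// leqW.
    rewrite big_split_ord /= addrAC subrr add0r.
    apply: (le_trans (cmod_sum _ _ _)).
    apply: (@le_trans _ _ (\sum_(m < j.+1 - n) M * r ^+ n * r ^+ m)).
      apply: ler_sum => m _; rewrite cmodM cmodX exprD -/r mulrA.
      by rewrite -!mulrA; apply: ler_wpM2r => //; rewrite mulr_ge0 ?exprn_ge0 ?ltW.
    rewrite -mulr_sumr.
    have Mr : 0 <= M * r ^+ n by rewrite mulr_ge0// exprn_ge0// ltW.
    have := ler_wpM2l Mr (geometric_sum_le (j.+1 - n) (ltW z0) z2); lra.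
exists c; split => // n z z2.
have [->|z0] := eqVneq z 0; last by apply: H0 => //; rewrite cmod_gt0.
(* The origin lies on no circle of positive radius; its value comes from the case [n = 1] at small
   real [p] and from continuity. *)
have u0 : u 0 = c 0%N.
  apply/eqP; rewrite -subr_eq0 -cmod_eq0 eq_le cmod_ge0 andbT.
  apply/ler_addgt0Pl => e e0; rewrite addr0.
  have cu0 : {for (0 : Cplx R), continuous u}.
    by apply: differentiable_continuous; apply: du; rewrite cmod0.
  have e20 : 0 < e / 2 by rewrite divr_gt0.
  have /continuous_cmodP/(_ _ e20)[d d0 dP] := cu0.
  have M1 : 0 < 2 * M + 1 by lra.
  pose p := Num.min (Num.min (d / 2) (1 / 2)) (e / 2 / (2 * M + 1)).
  have p0 : 0 < p by rewrite !lt_min !divr_gt0.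
  have pd : p <= d / 2 by rewrite !ge_min lexx.
  have p1 : p <= 1 / 2 by rewrite !ge_min lexx orbT.
  have pe : p * (2 * M + 1) <= e / 2 by rewrite -ler_pdivlMr// ge_min lexx orbT.
  have cp : cmod (p%:C) = p by rewrite cmod_nneg// ltW.
  have h1 := H0 1%N (p%:C); rewrite cp big_ord1 expr0 mulr1 expr1 in h1.
  have h2 := dP (p%:C); rewrite subr0 cp in h2.
  have -> : u 0 - c 0%N = (u (p%:C) - c 0%N) - (u (p%:C) - u 0) by ring.
  apply: (le_trans (cmodB _ _)).
  have {}h1 := h1 p0 p1; have {}h2 : cmod (u p%:C - u 0) < e / 2 by apply: h2; lra.
  lra.
case: n => [|n].
  rewrite big_ord0 subr0 expr0 mulr1.
  by have := uM 0; rewrite cmod0 => /(_ ler01); lra.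
rewrite big_ord_recl /= expr0 mulr1 big1 ?addr0; last first.
  by move=> j _; rewrite expr0n /= mulr0.
by rewrite u0 subrr cmod0 expr0n /= mulr0.
Qed.

End Taylor.

(** * Holomorphic dependence on parameters *)

Section Radial.
Variable R : realType.
Local Notation "x %:C" := (x%:C%C : Cplx R).

Lemma continuous_radial (r t : R) :
  {for t, continuous (fun s => r%:C * cis s)}.
Proof.
exact: (continuous_cplxM (h := fun=> r%:C) (@cst_continuous _ _ (r%:C) t)
  (@continuous_cis R t)).
Qed.

End Radial.

Section ParametricMean.
Variable R : realType.
Local Notation "x %:C" := (x%:C%C : Cplx R).

Lemma differentiable_comp2 (V : normedModType R[i])
    (f : Cplx R * Cplx R -> Cplx R) (g h : V -> Cplx R) x :
  differentiable g x -> differentiable h x -> differentiable f (g x, h x) ->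
  differentiable (fun y => f (g y, h y)) x.
Proof.
move=> dg dh df; exact: (differentiable_comp (differentiable_pair dg dh) df).
Qed.

(** Along the complex line through [(z, w)] in the direction [(h, k)], Taylor's formula gives a
    second-order remainder that depends only on [M] and [d]. This uniformity, absent from mere
    differentiability, is what allows differentiation under the mean. *)
Lemma quadratic_remainder (f : Cplx R * Cplx R -> Cplx R) z w a b (d M : R) :
  0 < d ->
  (forall y v, cmod (y - z) < d -> cmod (v - w) < d ->
    differentiable f (y, v) /\ cmod (f (y, v)) <= M) ->
  (forall e : R, 0 < e -> exists2 d' : R, 0 < d' &
    forall h k, cmod h < d' -> cmod k < d' ->
      cmod (f (z + h, w + k) - f (z, w) - (a * h + b * k)) <=
        e * (cmod h + cmod k)) ->
  forall h k, cmod h + cmod k <= d / 4 ->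
    cmod (f (z + h, w + k) - f (z, w) - (a * h + b * k)) <=
      8 * M / d ^+ 2 * (cmod h + cmod k) ^+ 2.
Proof.
move=> d0 fd fab h k hk; set sg := cmod h + cmod k in hk *.
have sg0 : 0 <= sg by rewrite addr_ge0 ?cmod_ge0.
have [/eqP sgE|sgN] := eqVneq sg 0.
  have h0 : h = 0.
    apply/eqP; rewrite -cmod_eq0; move: sgE.
    by rewrite /sg paddr_eq0 ?cmod_ge0// => /andP[].
  have k0 : k = 0.
    apply/eqP; rewrite -cmod_eq0; move: sgE.
    by rewrite /sg paddr_eq0 ?cmod_ge0// => /andP[].
  rewrite (eqP sgE) h0 k0 !addr0 !mulr0 addr0 subr0 subrr cmod0.
  by rewrite expr0n /= mulr0.
have {}sg0 : 0 < sg by rewrite lt_neqAle eq_sym sgN.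
(* Scaled so that the unit disc of the line is mapped into the bidisc of radius [d / 2]. *)
pose l := (d / 2 / sg); have l0 : 0 < l by rewrite !divr_gt0.
pose h' := l%:C * h; pose k' := l%:C * k.
have lsg : l * sg = d / 2 by rewrite /l divfK// gt_eqF.
have hb : cmod h' <= d / 2.
  rewrite cmodM cmod_nneg ?(ltW l0)// -lsg ler_pM2l// lerDl; exact: cmod_ge0.
have kb : cmod k' <= d / 2.
  rewrite cmodM cmod_nneg ?(ltW l0)// -lsg ler_pM2l// lerDr; exact: cmod_ge0.
pose u s := f (z + s * h', w + s * k').
have inb s : cmod s <= 1 ->
    cmod (z + s * h' - z) < d /\ cmod (w + s * k' - w) < d.
  have E (x y : Cplx R) : x + y - x = y by rewrite addrAC subrr add0r.
  move=> s1; rewrite !E (cmodM s h') (cmodM s k').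
  have dd : 1 * (d / 2) < d by lra.
  by split; apply: le_lt_trans dd; apply: ler_pM; rewrite ?cmod_ge0.
have du s : cmod s <= 1 -> differentiable u s.
  move=> /inb[h1 h2]; have [df _] := fd _ _ h1 h2.
  have da (x y : Cplx R) : differentiable (fun s : Cplx R => x + s * y) s.
    exact: (differentiable_add (differentiable_const _ _)
      (differentiable_mul (differentiable_var s) (differentiable_const _ _))).
  exact: (differentiable_comp2 (da z h') (da w k') df).
have uM s : cmod s <= 1 -> cmod (u s) <= M.
  by move=> /inb[h1 h2]; have [_] := fd _ _ h1 h2.
have [c [_ cP]] := taylor_unit_disc du uM.
have M0 : 0 <= M.
  by apply: le_trans (uM 0 _); rewrite ?cmod_ge0// cmod0.
have u0 : u 0 = c 0%N.
  have := cP 1%N 0; rewrite cmod0 big_ord1 expr0 mulr1 expr1 mulr0 => H.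
  apply/eqP; rewrite -subr_eq0 -cmod_eq0 eq_le cmod_ge0 andbT; apply: H; lra.
have u0E : u 0 = f (z, w) by rewrite /u !mul0r !addr0.
have c2 s : cmod s <= 1 / 2 -> cmod (u s - u 0 - c 1%N * s) <= 2 * M * cmod s ^+ 2.
  move=> s2; have := cP 2%N s s2.
  by rewrite !big_ord_recl big_ord0 /= expr0 mulr1 addr0 expr1 u0 opprD addrA.
(* Both sides are the derivative of [u] at [0]; the two expansions are compared at a small real
   [p]. *)
have c1 : c 1%N = a * h' + b * k'.
  apply/eqP; rewrite -subr_eq0 -cmod_eq0 eq_le cmod_ge0 andbT.
  apply/ler_addgt0Pl => e e0; rewrite addr0.
  have ed0 : 0 < e / (2 * d) by rewrite divr_gt0// mulr_gt0.
  have [d' d'0 d'P] := fab _ ed0.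
  have M1 : 0 < 2 * M + 1 by lra.
  pose p := Num.min (Num.min (d' / d) (1 / 2)) (e / 2 / (2 * M + 1)).
  have p0 : 0 < p by rewrite !lt_min !divr_gt0.
  have pd : p * d <= d' by rewrite -ler_pdivlMr// !ge_min lexx.
  have p1 : p <= 1 / 2 by rewrite !ge_min lexx orbT.
  have pe : p * (2 * M + 1) <= e / 2 by rewrite -ler_pdivlMr// ge_min lexx orbT.
  have cp : cmod (p%:C) = p by rewrite cmod_nneg// ltW.
  have ph : cmod (p%:C * h') <= p * (d / 2).
    by rewrite cmodM cp; apply: ler_wpM2l => //; exact: ltW.
  have pk : cmod (p%:C * k') <= p * (d / 2).
    by rewrite cmodM cp; apply: ler_wpM2l => //; exact: ltW.
  have pd2 : p * (d / 2) < d'.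
    have := mulr_gt0 p0 d0; lra.
  have h1 := d'P _ _ (le_lt_trans ph pd2) (le_lt_trans pk pd2).
  have h2 := c2 p%:C; rewrite cp in h2; have {}h2 := h2 p1.
  rewrite -u0E -/(u p%:C) in h1.
  have h3 : e / (2 * d) * (cmod (p%:C * h') + cmod (p%:C * k')) <= e / 2 * p.
    apply: (@le_trans _ _ (e / (2 * d) * (p * d))).
      by apply: ler_wpM2l; [exact: ltW|lra].
    rewrite le_eqVlt; apply/orP; left; apply/eqP; field; exact: lt0r_neq0.
  have : cmod ((c 1%N - (a * h' + b * k')) * p%:C) <= e * p.
    have -> : (c 1%N - (a * h' + b * k')) * p%:C =
      (u p%:C - u 0 - (a * (p%:C * h') + b * (p%:C * k'))) -
      (u p%:C - u 0 - c 1%N * p%:C) by ring.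
    apply: (le_trans (cmodB _ _)).
    have h4 : 2 * M * p ^+ 2 <= e / 2 * p.
      rewrite expr2 mulrA; apply: ler_wpM2r; first exact: ltW.
      lra.
    by apply: (le_trans (lerD (le_trans h1 h3) (le_trans h2 h4))); lra.
  by rewrite cmodM cp ler_pM2r.
(* The point of the line that gives back [(h, k)]. It is at most [1 / 2] because
   [cmod h + cmod k <= d / 4], and [2 M s^2] is the bound claimed. *)
pose s := l^-1.
have s0 : 0 < s by rewrite invr_gt0.
have sE : s = 2 * sg / d.
  by rewrite /s /l; field; rewrite !gt_eqF.
have s2 : cmod (s%:C) <= 1 / 2.
  by rewrite cmod_nneg ?(ltW s0)// sE ler_pdivrMr//; lra.
have sl : s%:C * l%:C = 1 by rewrite -rmorphM mulVf ?gt_eqF.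
have := c2 _ s2; rewrite c1 u0E /u /h' /k'.
have -> : s%:C * (l%:C * h) = h by rewrite mulrA sl mul1r.
have -> : s%:C * (l%:C * k) = k by rewrite mulrA sl mul1r.
have -> : (a * (l%:C * h) + b * (l%:C * k)) * s%:C = a * h + b * k.
  transitivity (s%:C * l%:C * (a * h + b * k)); first by ring.
  by rewrite sl mul1r.
move=> /le_trans; apply; rewrite cmod_nneg ?(ltW s0)// sE.
rewrite le_eqVlt; apply/orP; left; apply/eqP; field; exact: lt0r_neq0.
Qed.

End ParametricMean.

(** * Differentiation under the circle mean *)

Section DifferentiableMean.
Variable R : realType.
Local Notation "x %:C" := (x%:C%C : Cplx R).

(** [A] is within [C s] of the quotient [g s t / s], uniformly in [t], so it is a uniform limit of
    continuous functions. *)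
Lemma cont_on_of_quotients a b (A : R -> Cplx R) (g : R -> R -> Cplx R)
    (C s0 : R) : 0 < s0 ->
  (forall s, 0 < s <= s0 -> cont_on a b (g s)) ->
  (forall s t, 0 < s <= s0 -> cmod (g s t - A t * s%:C) <= C * s ^+ 2) ->
  cont_on a b A.
Proof.
move=> s00 cg gA t tab; apply/continuous_curve_cmodP => e e0.
have C0 : 0 <= C.
  have := gA s0 t; rewrite s00 lexx => /(_ isT) /(le_trans (cmod_ge0 _)).
  by rewrite pmulr_lge0// exprn_gt0.
have C1 : 0 < 4 * C + 1 by lra.
pose s := Num.min s0 (e / (4 * C + 1)).
have sp : 0 < s by rewrite lt_min s00 divr_gt0.
have ss : 0 < s <= s0 by rewrite sp ge_min lexx.
have se : s * (4 * C + 1) <= e by rewrite -ler_pdivlMr// ge_min lexx orbT.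
have es0 : 0 < e * s / 2 by rewrite divr_gt0// mulr_gt0.
have /continuous_curve_cmodP/(_ _ es0)[d d0 dP] := cg s ss t tab.
exists d => // x xt.
have h1 := gA s x ss; have h2 := gA s t ss; have h3 := dP x xt.
have : cmod ((A x - A t) * s%:C) < e * s.
  have -> : (A x - A t) * s%:C = (g s t - A t * s%:C) - (g s x - A x * s%:C) +
    (g s x - g s t) by ring.
  apply: (le_lt_trans (cmodD _ _)).
  apply: (le_lt_trans (lerD (le_trans (cmodB _ _) (lerD h2 h1)) (lexx _))).
  have h4 : (2 * C * s) * s <= (e / 2) * s by apply: ler_wpM2r; [exact: ltW|lra].
  by rewrite expr2; lra.
by rewrite cmodM cmod_nneg ?(ltW sp)// ltr_pM2r.
Qed.

(** The differential is the mean of the differentials of [K x]. These are continuous in [x] as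
    uniform limits of difference quotients, and [quadratic_remainder] bounds the error uniformly on
    the circle. *)
Lemma differentiable_cmean (K : Cplx R -> Cplx R * Cplx R -> Cplx R)
    r z w (d M : R) : 0 < r -> 0 < d ->
  (forall x y v, cmod x = r -> cmod (y - z) < d -> cmod (v - w) < d ->
    differentiable (K x) (y, v) /\ cmod (K x (y, v)) <= M) ->
  (forall y v, cmod (y - z) < d -> cmod (v - w) < d ->
    cont_circ r (fun x => K x (y, v))) ->
  differentiable (fun p => cmean r (fun x => K x p)) (z, w).
Proof.
move=> r0 d0 HK HC.
have zz : cmod (z - z) < d by rewrite subrr cmod0.
have ww : cmod (w - w) < d by rewrite subrr cmod0.
pose lin_at (x : Cplx R) (q : Cplx R * Cplx R) :=
  forall e : R, 0 < e -> exists2 d' : R, 0 < d' &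
    forall h k, cmod h < d' -> cmod k < d' ->
      cmod (K x (z + h, w + k) - K x (z, w) - (q.1 * h + q.2 * k)) <=
        e * (cmod h + cmod k).
(* [q x] is the gradient of [K x] at [(z, w)], with the default [(0, 0)] off the circle. *)
have /choice[q qP] x : exists q, cmod x = r -> lin_at x q.
  have [xr|nxr] := pselect (cmod x = r); last by exists (0, 0).
  have [dKx _] := HK x z w xr zz ww.
  by have [a [b ab]] := differentiable2_cmod dKx; exists (a, b).
set C := 8 * M / d ^+ 2.
have Q x h k : cmod x = r -> cmod h + cmod k <= d / 4 ->
    cmod (K x (z + h, w + k) - K x (z, w) - ((q x).1 * h + (q x).2 * k)) <=
      C * (cmod h + cmod k) ^+ 2.
  move=> xr; apply: (quadratic_remainder d0 _ (qP x xr)) => y v.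
  exact: HK.
have rt t : cmod (r%:C * cis t) = r by rewrite cmod_polar// ltW.
have M0 : 0 <= M.
  by have [_] := HK _ z w (rt 0) zz ww; apply: le_trans; exact: cmod_ge0.
have C0 : 0 <= C by apply: divr_ge0; [rewrite mulr_ge0|exact: sqr_ge0].
have shift h k : cmod h < d -> cmod k < d ->
    cont_circ r (fun x => K x (z + h, w + k) - K x (z, w)).
  move=> hd kd; apply: (cont_circB (HC (z + h) (w + k) _ _) (HC z w zz ww)).
    by rewrite addrAC subrr add0r.
  by rewrite addrAC subrr add0r.
have d40 : 0 < d / 4 by rewrite divr_gt0.
have c1 : cont_circ r (fun x => (q x).1).
  apply: (@cont_on_of_quotients _ _ (fun t => (q (r%:C * cis t)).1)
    (fun s t => K (r%:C * cis t) (z + s%:C, w + 0) - K (r%:C * cis t) (z, w))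
    C (d / 4) d40).
    move=> s /andP[s0 s1]; apply: shift; first by rewrite cmod_nneg ?(ltW s0)//; lra.
    by rewrite cmod0.
  move=> s t /andP[s0 s1]; have := @Q (r%:C * cis t) s%:C 0 (rt t).
  by rewrite cmod0 cmod_nneg ?(ltW s0)// !addr0 mulr0 addr0; apply.
have c2 : cont_circ r (fun x => (q x).2).
  apply: (@cont_on_of_quotients _ _ (fun t => (q (r%:C * cis t)).2)
    (fun s t => K (r%:C * cis t) (z + 0, w + s%:C) - K (r%:C * cis t) (z, w))
    C (d / 4) d40).
    move=> s /andP[s0 s1]; apply: shift; first by rewrite cmod0.
    by rewrite cmod_nneg ?(ltW s0)//; lra.
  move=> s t /andP[s0 s1]; have := @Q (r%:C * cis t) 0 s%:C (rt t).
  by rewrite cmod0 cmod_nneg ?(ltW s0)// !addr0 mulr0 !add0r; apply.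
pose al := cmean r (fun x => (q x).1); pose be := cmean r (fun x => (q x).2).
apply: (@differentiable2_of_cmod _ _ _ _ al be) => e e0.
have C1 : 0 < C + 1 by lra.
pose d1 := Num.min (d / 8) (e / (2 * (C + 1))).
have d10 : 0 < d1 by rewrite lt_min !divr_gt0// mulr_gt0.
have d1d : d1 <= d / 8 by rewrite ge_min lexx.
have d1e : d1 * (2 * (C + 1)) <= e by rewrite -ler_pdivlMr ?mulr_gt0// ge_min lexx orbT.
exists d1 => // h k hd kd.
have hd' : cmod h < d by lra.
have kd' : cmod k < d by lra.
have cb : cont_circ r (fun x => (q x).1 * h + (q x).2 * k).
  exact: (cont_onD (cont_onM c1 (@cont_on_cst _ _ _ h))
    (cont_onM c2 (@cont_on_cst _ _ _ k))).
have zhd : cmod (z + h - z) < d by rewrite addrAC subrr add0r.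
have wkd : cmod (w + k - w) < d by rewrite addrAC subrr add0r.
have ck1 := HC _ _ zhd wkd; have ck2 := HC _ _ zz ww.
have lin : cmean r (fun x => (q x).1 * h + (q x).2 * k) = al * h + be * k.
  rewrite (cmeanD (u := fun x => (q x).1 * h) (v := fun x => (q x).2 * k)
    (cont_onM c1 (@cont_on_cst _ _ _ h)) (cont_onM c2 (@cont_on_cst _ _ _ k))).
  rewrite (@eq_cmean _ r _ (fun x => h * (q x).1)); last by move=> t; exact: mulrC.
  rewrite (@eq_cmean _ r (fun x => (q x).2 * k) (fun x => k * (q x).2)); last first.
    by move=> t; exact: mulrC.
  by rewrite (cmeanZ h c1) (cmeanZ k c2) mulrC [k * _]mulrC.
rewrite -lin -(cmeanB ck1 ck2) -(cmeanB (cont_circB ck1 ck2) cb).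
have s0 : 0 <= cmod h + cmod k by rewrite addr_ge0 ?cmod_ge0.
apply: (@le_trans _ _ (C * (cmod h + cmod k) ^+ 2)).
  apply: (cmod_cmean_le (cont_circB (cont_circB ck1 ck2) cb)) => t _.
  by apply: Q => //; lra.
rewrite expr2 mulrA; apply: ler_wpM2r => //.
apply: (@le_trans _ _ (C * (2 * d1))); first by apply: ler_wpM2l => //; lra.
lra.
Qed.

End DifferentiableMean.

(** * The identity theorem in one variable *)

Section Identity.
Variable R : realType.
Local Notation "x %:C" := (x%:C%C : Cplx R).
Implicit Types (u v : Cplx R -> Cplx R) (c : Cplx R).

(** Near [c] the first nonzero Taylor coefficient would dominate the rest and exclude zeros other
    than [c]; so all coefficients vanish. *)
Lemma identity_local u c (d : R) : 0 < d ->
  (forall y, cmod (y - c) < d -> differentiable u y) ->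
  (forall e : R, 0 < e -> exists2 y, 0 < cmod (y - c) < e & u y = 0) ->
  exists2 e : R, 0 < e & forall y, cmod (y - c) < e -> u y = 0.
Proof.
move=> d0 du u0.
have cu : {for c, continuous u}.
  by apply: differentiable_continuous; apply: du; rewrite subrr cmod0.
have /continuous_cmodP/(_ _ ltr01)[d1 d10 d1P] := cu.
pose r := Num.min d d1 / 2.
have m0 : 0 < Num.min d d1 by rewrite lt_min d0.
have r0 : 0 < r by rewrite divr_gt0.
have rd : r < d.
  by rewrite /r ltr_pdivrMr// (@le_lt_trans _ _ d)// ?ge_min ?lexx//; lra.
have rd1 : r < d1.
  by rewrite /r ltr_pdivrMr// (@le_lt_trans _ _ d1)// ?ge_min ?lexx ?orbT//; lra.
(* Rescaled to the unit disc, where the values stay within [1] of [u c]. *)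
pose v s := u (c + r%:C * s).
have inr s : cmod s <= 1 -> cmod (c + r%:C * s - c) <= r.
  move=> s1; rewrite addrAC subrr add0r cmodM cmod_nneg ?(ltW r0)//.
  by rewrite -[X in _ <= X]mulr1; apply: ler_wpM2l => //; exact: ltW.
have dv s : cmod s <= 1 -> differentiable v s.
  move=> /inr sr.
  have da : differentiable (fun s : Cplx R => c + r%:C * s) s.
    exact: (differentiable_add (differentiable_const _ _)
      (differentiable_mul (differentiable_const _ _) (differentiable_var s))).
  exact: (differentiable_comp da (du _ (le_lt_trans sr rd))).
pose M := cmod (u c) + 1.
have vM s : cmod s <= 1 -> cmod (v s) <= M.
  move=> /inr sr; have h := d1P _ (le_lt_trans sr rd1).
  have -> : v s = (u (c + r%:C * s) - u c) + u c by rewrite subrK.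
  by apply: (le_trans (cmodD _ _)); rewrite /M; lra.
have M0 : 0 <= M by rewrite addr_ge0 ?cmod_ge0.
have [b [_ bP]] := taylor_unit_disc dv vM.
have b0 n : b n = 0.
  elim/ltn_ind: n => n IH.
  apply/eqP; rewrite -cmod_eq0 eq_le cmod_ge0 andbT.
  apply/ler_addgt0Pl => e e0; rewrite addr0.
  have M1 : 0 < 2 * M + 1 by lra.
  pose p := Num.min (1 / 2) (e / (2 * M + 1)).
  have p0 : 0 < p by rewrite lt_min !divr_gt0.
  have p1 : p <= 1 / 2 by rewrite ge_min lexx.
  have pe : p * (2 * M + 1) <= e by rewrite -ler_pdivlMr// ge_min lexx orbT.
  have [y /andP[y0 yp] uy] := u0 _ (mulr_gt0 r0 p0).
  pose s := r^-1%:C * (y - c).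
  have cs : cmod s = r^-1 * cmod (y - c) by rewrite cmodM cmod_nneg ?invr_ge0 ?(ltW r0).
  have sp : cmod s < p by rewrite cs ltr_pdivrMl.
  have s0 : 0 < cmod s by rewrite cs mulr_gt0// invr_gt0.
  have vs : v s = 0.
    rewrite /v /s mulrA -rmorphM mulfV ?gt_eqF// mul1r addrC subrK //.
  have := bP n.+1 s; rewrite vs big_ord_recr /= big1; last first.
    by move=> j _; rewrite IH// mul0r.
  rewrite !add0r cmodN cmodM cmodX exprS mulrA => H.
  have {}H := H (ltW (lt_le_trans sp p1)).
  have sn : 0 < cmod s ^+ n by rewrite exprn_gt0.
  rewrite ler_pM2r// in H; apply: (le_trans H).
  have : 2 * M * cmod s <= 2 * M * p by apply: ler_wpM2l; [lra|exact: ltW].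
  lra.
exists (r / 2) => [|y yr]; first by rewrite divr_gt0.
pose s := r^-1%:C * (y - c).
have cs : cmod s = r^-1 * cmod (y - c) by rewrite cmodM cmod_nneg ?invr_ge0 ?(ltW r0).
have s2 : cmod s <= 1 / 2 by rewrite cs ler_pdivrMl//; lra.
have vs : v s = u y.
  by rewrite /v /s mulrA -rmorphM mulfV ?gt_eqF// mul1r addrC subrK.
rewrite -vs; apply/eqP; rewrite -cmod_eq0 eq_le cmod_ge0 andbT.
apply/ler_addgt0Pl => e e0; rewrite addr0.
have [n nP] := exists_half_pow (2 * M) e0.
have := bP n s s2; rewrite big1 ?subr0; last by move=> j _; rewrite b0 mul0r.
move=> /le_trans; apply; apply: le_trans (ltW nP).
apply: ler_wpM2l; first by lra.
rewrite -exprVn; apply: lerXn2r; rewrite ?nnegrE ?cmod_ge0//.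
by lra.
Qed.

(** Connectedness of [[0, 1]] through a supremum [m]: zeros accumulate at [m] from below, so
    [identity_local] carries vanishing past [m] unless [m = 1], where it gives the conclusion. *)
Lemma identity_segment u :
  (forall s : R, 0 <= s <= 1 -> exists2 d : R, 0 < d &
    forall y, cmod (y - s%:C) < d -> differentiable u y) ->
  (exists2 e : R, 0 < e & forall s : R, 0 <= s < e -> u s%:C = 0) ->
  u 1 = 0.
Proof.
move=> du [e0 e00 ue0].
pose S : set R := [set s | 0 <= s <= 1 /\ forall x : R, 0 <= x <= s -> u x%:C = 0].
(* [t0 > 0] keeps [m] away from [0], so that there are points of the segment below [m]. *)
pose t0 := Num.min (e0 / 2) 1.
have t00 : 0 < t0 by rewrite lt_min ltr01 divr_gt0.
have t0e : t0 <= e0 / 2 by rewrite ge_min lexx.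
have t01 : t0 <= 1 by rewrite ge_min lexx orbT.
have St0 : S t0.
  split; first by rewrite (ltW t00).
  by move=> x /andP[x0 xt]; apply: ue0; rewrite x0/=; lra.
have ubS : ubound S 1 by move=> s [/andP[]].
pose m := sup S.
have tm : t0 <= m by apply: ub_le_sup => //; exists 1.
have m1 : m <= 1 by apply: ge_sup => //; exists t0.
have below x : 0 <= x -> x < m -> u x%:C = 0.
  move=> x0 /sup_gt -/(_ (ex_intro _ t0 St0))[s [_ sP] xs].
  by apply: sP; rewrite x0 ltW.
have m01 : 0 <= m <= 1 by rewrite m1 andbT; lra.
have [d d0 dP] := du m m01.
have [|e ep eP] := identity_local d0 dP.
  move=> e ep; pose x := m - Num.min (e / 2) (t0 / 2).
  have k0 : 0 < Num.min (e / 2) (t0 / 2) by rewrite lt_min !divr_gt0.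
  have ke : Num.min (e / 2) (t0 / 2) <= e / 2 by rewrite ge_min lexx.
  have kt : Num.min (e / 2) (t0 / 2) <= t0 / 2 by rewrite ge_min lexx orbT.
  exists (x%:C); last by apply: below; rewrite /x; lra.
  rewrite -rmorphB cmod_real /x addrAC subrr add0r normrN gtr0_norm//.
  by rewrite k0 /=; lra.
have near x : `|x - m| < e -> u x%:C = 0.
  by move=> h; apply: eP; rewrite -rmorphB cmod_real.
have [m1'|m1'] := ltP m 1; last first.
  have -> : (1 : Cplx R) = (1 : R)%:C by rewrite rmorph1.
  by apply: near; rewrite (_ : 1 - m = 0) ?normr0//; lra.
pose s := Num.min 1 (m + e / 2).
have ms : m < s by rewrite lt_min m1'/=; lra.
have s1 : s <= 1 by rewrite ge_min lexx.
have se : s <= m + e / 2 by rewrite ge_min lexx orbT.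
suff sm : s <= m by have := le_lt_trans sm ms; rewrite ltxx.
apply: ub_le_sup; first by exists 1.
split; first by rewrite s1 andbT; lra.
move=> x /andP[x0 xs]; have [xm|mx] := ltP x m; first exact: below.
by apply: near; rewrite ger0_norm ?subr_ge0//; lra.
Qed.

End Identity.

(** * Means along graphs *)

Section Uniform.
Variable R : realType.
Local Notation "x %:C" := (x%:C%C : Cplx R).

Lemma cmod_dist_le (z w : Cplx R) : `|cmod z - cmod w| <= cmod (z - w).
Proof.
rewrite ler_norml; have h1 := cmodD (z - w) w; have h2 := cmodD (w - z) z.
rewrite !subrK in h1 h2; rewrite [cmod (w - z)]cmodBC in h2.
by apply/andP; split; lra.
Qed.

(** Compactness, stated for any property that is monotone in its radius. A negative [a] turns the
    annulus into a closed disc. *)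
Lemma annulus_uniform (a b : R) (good : Cplx R -> R -> Prop) :
  (forall x d d', d' <= d -> good x d -> good x d') ->
  (forall x, a <= cmod x <= b -> exists2 d : R, 0 < d &
     forall y, a <= cmod y <= b -> cmod (y - x) < d -> good y d) ->
  exists2 d : R, 0 < d & forall y, a <= cmod y <= b -> good y d.
Proof.
move=> gm loc; pose c := `|b| + 1; have c0 : 0 < c by rewrite ltr_wpDl.
pose Pr (x y h : R) := exists2 d : R, 0 < d & forall z, a <= cmod z <= b ->
  x <= complex.Re z <= x + h -> y <= complex.Im z <= y + h -> good z d.
have P0 : Pr (- c) (- c) (2 * c).
  apply: cousin_square; first by lra.
    move=> x y h h0 _ [d1 d10 H1] [d2 d20 H2] [d3 d30 H3] [d4 d40 H4].
    pose d := Num.min (Num.min d1 d2) (Num.min d3 d4).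
    exists d => [|z zab]; first by rewrite !lt_min d10 d20 d30.
    move=> /andP[zx zx'] /andP[zy zy'].
    have [xm|xm] := leP (complex.Re z) (x + h / 2);
      have [ym|ym] := leP (complex.Im z) (y + h / 2).
    - by apply: (gm z d1); [rewrite !ge_min lexx|apply: H1; rewrite ?zx ?zy].
    - apply: (gm z d3); first by rewrite !ge_min lexx !orbT.
      by apply: H3 => //; apply/andP; split => //; lra.
    - apply: (gm z d2); first by rewrite !ge_min lexx !orbT.
      by apply: H2 => //; apply/andP; split => //; lra.
    - apply: (gm z d4); first by rewrite !ge_min lexx !orbT.
      by apply: H4 => //; apply/andP; split => //; lra.
  move=> x y _ _; pose p : Cplx R := (x +i* y)%C.
  (* A point of the square off the closed annulus has a neighbourhood that misses it, where nothing
     is to be shown. *)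
  have [d d0 dP] : exists2 d : R, 0 < d & forall z, a <= cmod z <= b ->
      cmod (z - p) < d -> good z d.
    have [pab|] := boolP (a <= cmod p <= b); first exact: loc.
    rewrite negb_and -!ltNge => /orP[pa|pb].
      exists (a - cmod p) => [|z /andP[za _] zp]; first by rewrite subr_gt0.
      by have := ler_norm (cmod z - cmod p); have := cmod_dist_le z p; lra.
    exists (cmod p - b) => [|z /andP[_ zb] zp]; first by rewrite subr_gt0.
    have := ler_norm (cmod p - cmod z); have := cmod_dist_le p z.
    by rewrite [cmod (p - z)]cmodBC; lra.
  exists (d / 2) => [|x' y' h h0 hd _ /andP[x1 x2] /andP[y1 y2]].
    by rewrite divr_gt0.
  exists d => // z zab /andP[zx zx'] /andP[zy zy']; apply: dP => //.
  apply: (le_lt_trans (cmod_leD _)); rewrite !raddfB /=.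
  have hx : `|complex.Re z - x| <= h by rewrite ler_norml; apply/andP; split; lra.
  have hy : `|complex.Im z - y| <= h by rewrite ler_norml; apply/andP; split; lra.
  lra.
have [d d0 dP] := P0; exists d => // z zab; apply: dP => //.
- have := Re_le_cmod z; rewrite ler_norml => /andP[z1 z2].
  by have := ler_norm b; case/andP: zab => _ zb h; apply/andP; split; rewrite /c; lra.
- have := Im_le_cmod z; rewrite ler_norml => /andP[z1 z2].
  by have := ler_norm b; case/andP: zab => _ zb h; apply/andP; split; rewrite /c; lra.
Qed.

Lemma circle_uniform (r : R) (good : Cplx R -> R -> Prop) :
  (forall x d d', d' <= d -> good x d -> good x d') ->
  (forall x, cmod x = r -> exists2 d : R, 0 < d &
     forall y, cmod (y - x) < d -> good y d) ->
  exists2 d : R, 0 < d & forall y, cmod y = r -> good y d.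
Proof.
move=> gm loc; have [|d d0 dP] := @annulus_uniform r r good gm.
  move=> x; rewrite -eq_le => /eqP xr; have [d d0 dP] := loc x (esym xr).
  by exists d => // y _; exact: dP.
by exists d => // y yr; apply: dP; rewrite yr lexx.
Qed.

End Uniform.

Lemma differentiable_fst (R : realType) (q : Cplx R * Cplx R) :
  differentiable (fun p : Cplx R * Cplx R => p.1) q.
Proof.
apply: (@linear_differentiable _ _ _ (fst : {linear _ -> _})) => p.
exact: cvg_fst.
Qed.

Lemma differentiable_snd (R : realType) (q : Cplx R * Cplx R) :
  differentiable (fun p : Cplx R * Cplx R => p.2) q.
Proof.
apply: (@linear_differentiable _ _ _ (snd : {linear _ -> _})) => p.
exact: cvg_snd.
Qed.

Section GraphMean.
Variable R : realType.
Local Notation "x %:C" := (x%:C%C : Cplx R).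
Variables (Om : set (Cplx R * Cplx R)) (f : Cplx R * Cplx R -> Cplx R).
Hypotheses (oOm : open Om) (hf : holomorphic_on Om f).

(** One number [d] serves as radius and, through [d^-1], as bound; the conclusion is then monotone
    in [d], as [circle_uniform] requires. *)
Lemma holomorphic_locally_bounded z w : Om (z, w) ->
  exists2 d : R, 0 < d & forall y v, cmod (y - z) < d -> cmod (v - w) < d ->
    Om (y, v) /\ cmod (f (y, v)) <= d^-1.
Proof.
move=> zw; have [d1 d10 d1P] := open2_cmod oOm zw.
have [d2 d20 d2P] := continuous2_cmod (differentiable_continuous (hf zw)) ltr01.
pose M := cmod (f (z, w)) + 1.
have M0 : 0 < M by rewrite ltr_wpDl ?cmod_ge0.
pose d := Num.min (Num.min d1 d2) M^-1.
have dd1 : d <= d1 by rewrite !ge_min lexx.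
have dd2 : d <= d2 by rewrite !ge_min lexx orbT.
have dM : d <= M^-1 by rewrite ge_min lexx orbT.
have d0 : 0 < d by rewrite !lt_min d10 d20 invr_gt0.
exists d => // y v yz vw; split; first by apply: d1P; lra.
apply: (@le_trans _ _ M); last by rewrite -[M]invrK lef_pV2 ?posrE ?invr_gt0.
have := cmodD (f (y, v) - f (z, w)) (f (z, w)); rewrite subrK => H.
have {}d2P : cmod (f (y, v) - f (z, w)) < 1 by apply: d2P; lra.
by rewrite /M; lra.
Qed.

Lemma differentiable_graph (P : Cplx R -> Cplx R) x :
  differentiable P x -> Om (x, P x) -> differentiable (fun x => f (x, P x)) x.
Proof.
by move=> dP xP; exact: (differentiable_comp2 (differentiable_var x) dP (hf xP)).
Qed.

(** [circle_uniform] gives one radius and one bound for [f] along the graphs of [P + s Q] with [s]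
    near [s0], after which [differentiable_cmean] applies. *)
Lemma differentiable_graph_mean (P Q : Cplx R -> Cplx R) (r : R) (s0 : Cplx R) :
  0 < r ->
  (forall x, cmod x = r -> differentiable P x) ->
  (forall x, cmod x = r -> differentiable Q x) ->
  (forall x, cmod x = r -> Om (x, P x + s0 * Q x)) ->
  exists2 d : R, 0 < d & forall y, cmod (y - s0) < d ->
    differentiable (fun s : Cplx R => cmean r (fun x => f (x, P x + s * Q x))) y.
Proof.
move=> r0 dP dQ xO.
pose good (x : Cplx R) (d : R) := forall s : Cplx R, cmod (s - s0) < d ->
  Om (x, P x + s * Q x) /\ cmod (f (x, P x + s * Q x)) <= d^-1.
have [||d d0 dgood] := @circle_uniform R r (fun x d => 0 < d -> good x d).
- move=> x d d' dd gx d'0 s sd; have dp := lt_le_trans d'0 dd.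
  have [h1 h2] := gx dp s (lt_le_trans sd dd); split => //.
  by apply: (le_trans h2); rewrite lef_pV2.
- move=> x xr; have [d d0 H] := holomorphic_locally_bounded (xO x xr).
  have cPQ : differentiable (fun p : Cplx R * Cplx R => P p.1 + p.2 * Q p.1) (x, s0).
    have d1 : differentiable (fun p : Cplx R * Cplx R => p.1) (x, s0).
      exact: differentiable_fst.
    have d2 : differentiable (fun p : Cplx R * Cplx R => p.2) (x, s0).
      exact: differentiable_snd.
    have dP1 : differentiable (fun p : Cplx R * Cplx R => P p.1) (x, s0).
      exact: (differentiable_comp d1 (dP x xr)).
    have dQ1 : differentiable (fun p : Cplx R * Cplx R => Q p.1) (x, s0).
      exact: (differentiable_comp d1 (dQ x xr)).
    exact: (differentiable_add dP1 (differentiable_mul d2 dQ1)).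
  have [d1 d10 H1] := continuous2_cmod (differentiable_continuous cPQ) d0.
  pose d2 := Num.min d d1.
  have d2d : d2 <= d by rewrite ge_min lexx.
  have d2d1 : d2 <= d1 by rewrite ge_min lexx orbT.
  have d20 : 0 < d2 by rewrite lt_min d0.
  exists d2 => // y yx _ s ss.
  have [||h1 h2] := H y (P y + s * Q y).
  + by lra.
  + by apply: H1; lra.
  + by split => //; apply: (le_trans h2); rewrite lef_pV2.
exists (d / 2) => [|y ys]; first by rewrite divr_gt0.
have yd s : cmod (s - y) < d / 2 -> cmod (s - s0) < d.
  by have := cmod_dist s s0 y; lra.
(* The second coordinate is a dummy: [differentiable_cmean] has two parameters, and only [s] varies
   here. *)
pose K x (p : Cplx R * Cplx R) := f (x, P x + p.1 * Q x).
have d20 : 0 < d / 2 by rewrite divr_gt0.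
have dK : differentiable (fun p => cmean r (fun x => K x p)) (y, 0).
  apply: (@differentiable_cmean R K r y 0 (d / 2) d^-1 r0 d20).
    move=> x s v xr sy _; have [h1 h2] := dgood x xr d0 s (yd s sy).
    split; last exact: h2.
    have d1 : differentiable (fun p : Cplx R * Cplx R => p.1) (s, v).
      exact: differentiable_fst.
    have d2 : differentiable (fun p : Cplx R * Cplx R => P x + p.1 * Q x) (s, v).
      exact: (differentiable_add (differentiable_const _ _)
        (differentiable_mul d1 (differentiable_const _ _))).
    exact: (differentiable_comp2 (differentiable_const x (s, v)) d2 (hf h1)).
  move=> s v sy _.
  apply: (@cont_circle R (fun x => K x (s, v)) r (ltW r0)) => x xr.
  have [h1 _] := dgood x xr d0 s (yd s sy).
  apply: differentiable_continuous.
  exact: (differentiable_graph (P := fun x => P x + s * Q x)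
    (differentiable_add (dP x xr)
      (differentiable_mul (differentiable_const s x) (dQ x xr))) h1).
exact: (differentiable_comp2 (f := fun p => cmean r (fun x => K x p))
  (differentiable_var y) (differentiable_const 0 y) dK).
Qed.

End GraphMean.

(** * Laurent polynomials *)

Section Laurent.
Variable R : realType.
Local Notation "x %:C" := (x%:C%C : Cplx R).
Implicit Types (a b : nat -> nat -> Cplx R).

(** Indexed by pairs as in [fejer], with [a j l] attached to [z^(j - l)]; distinct arrays may give
    the same Laurent polynomial, which is harmless. *)
Definition laurent N a (z : Cplx R) : Cplx R :=
  \sum_(j < N.+1) \sum_(l < N.+1) a j l * (z ^+ j * z^-1 ^+ l).

(** The parameter is complex because the identity theorem is applied to it; its real values in
    [[0, 1]] give the segment from [a] to [b]. *)
Definition segment_coef a b (s : Cplx R) j l : Cplx R :=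
  a j l + s * (b j l - a j l).

Lemma laurent_segment N a b s z :
  laurent N (segment_coef a b s) z =
  laurent N a z + s * (laurent N b z - laurent N a z).
Proof.
rewrite /laurent mulrBr !mulr_sumr -sumrB -big_split /=; apply: eq_bigr => j _.
rewrite !mulr_sumr -sumrB -big_split /=; apply: eq_bigr => l _.
by rewrite /segment_coef; ring.
Qed.

Lemma laurentB N a b z :
  laurent N a z - laurent N b z = laurent N (fun j l => a j l - b j l) z.
Proof.
rewrite /laurent -sumrB; apply: eq_bigr => j _.
by rewrite -sumrB; apply: eq_bigr => l _; ring.
Qed.

Lemma differentiable_laurent N a z : z != 0 -> differentiable (laurent N a) z.
Proof.
move=> z0; rewrite /laurent.
apply: (@differentiable_bigsum R _ N.+1 (fun j (z : Cplx R) =>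
  \sum_(l < N.+1) a j l * (z ^+ j * z^-1 ^+ l))) => j.
apply: (@differentiable_bigsum R _ N.+1 (fun l (z : Cplx R) =>
  a j l * (z ^+ j * z^-1 ^+ l))) => l.
have dzV := differentiable_inv (differentiable_var z) z0.
exact: (differentiable_mul (differentiable_const (a j l) z)
  (differentiable_mul (differentiable_pow j (differentiable_var z))
    (differentiable_pow l dzV))).
Qed.

Lemma cmod_laurent_le N (r : R) : 0 < r -> r <= 1 ->
  exists2 B : R, 0 < B & forall a (e : R),
    (forall j l, (j <= N)%N -> (l <= N)%N -> cmod (a j l) <= e) ->
    forall z, r <= cmod z <= 1 -> cmod (laurent N a z) <= B * e.
Proof.
(* [q] bounds every monomial with exponents at most [N] on [r <= |z| <= 1]. *)
move=> r0 r1; pose q := r^-1 ^+ N.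
have rV1 : 1 <= r^-1 by rewrite invf_ge1.
have q0 : 0 < q by rewrite exprn_gt0// invr_gt0.
exists (N.+1%:R * (N.+1%:R * q)) => [|a e ae z /andP[rz z1]].
  by rewrite !mulr_gt0.
have z0 : 0 < cmod z by exact: lt_le_trans rz.
have e0 : 0 <= e by apply: le_trans (ae 0%N 0%N _ _); rewrite ?cmod_ge0.
have term (j l : 'I_N.+1) : cmod (a j l * (z ^+ j * z^-1 ^+ l)) <= q * e.
  rewrite !cmodM !cmodX cmodV mulrC [q * e]mulrC mulrC.
  apply: ler_pM; rewrite ?cmod_ge0 ?mulr_ge0 ?exprn_ge0 ?invr_ge0 ?cmod_ge0//.
    by apply: ae; rewrite -ltnS.
  rewrite -[q]mul1r; apply: ler_pM; rewrite ?exprn_ge0 ?invr_ge0 ?cmod_ge0//.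
    by rewrite exprn_ile1// cmod_ge0.
  apply: (@le_trans _ _ (r^-1 ^+ l)).
    apply: lerXn2r; rewrite ?nnegrE ?invr_ge0 ?cmod_ge0 ?(ltW r0)//.
    by rewrite lef_pV2.
  by apply: ler_weXn2l => //; rewrite -ltnS.
apply: (le_trans (cmod_sum _ _ _)).
apply: (@le_trans _ _ (\sum_(j < N.+1) N.+1%:R * (q * e))).
  apply: ler_sum => j _; apply: (le_trans (cmod_sum _ _ _)).
  apply: (@le_trans _ _ (\sum_(l < N.+1) q * e)); first exact: ler_sum.
  by rewrite sumr_const card_ord mulr_natl.
by rewrite sumr_const card_ord -mulr_natl; lra.
Qed.

Definition const_coef (w : Cplx R) (j l : nat) : Cplx R :=
  if (j == 0%N) && (l == 0%N) then w else 0.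

Lemma laurent_const N w z : laurent N (const_coef w) z = w.
Proof.
rewrite /laurent (bigD1 ord0)//= (bigD1 ord0)//= /const_coef /= !expr0 !mulr1.
rewrite big1; last first.
  move=> l l0; case: eqP => [l0'|]; last by rewrite mul0r.
  by move: l0; rewrite -(inj_eq val_inj) /= l0'.
rewrite big1 ?addr0// => j j0; rewrite big1// => l _.
case: eqP => [j0'|]; last by rewrite mul0r.
by move: j0; rewrite -(inj_eq val_inj) /= j0'.
Qed.

End Laurent.

(** * Gaps between circle means *)

Section Chain.
Variable R : realType.
Local Notation "x %:C" := (x%:C%C : Cplx R).
Variables (Om : set (Cplx R * Cplx R)) (f : Cplx R * Cplx R -> Cplx R).
Hypotheses (oOm : open Om) (hf : holomorphic_on Om f).
Hypothesis circOm : circle `*` disc `<=` Om.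

Lemma cmod_discP (z : Cplx R) : (`|z| < 1) = (cmod z < 1).
Proof. by rewrite -cmodE (ltcR _ 1). Qed.

Lemma cmod_circleP (z : Cplx R) : (`|z| = 1) <-> (cmod z = 1).
Proof.
split=> [h|h]; first by apply: complexI; rewrite cmodE h.
by rewrite -cmodE h.
Qed.

Lemma circle_disc z w : cmod z = 1 -> cmod w < 1 -> Om (z, w).
Proof.
move=> z1 w1; apply: circOm; split => /=; first exact/cmod_circleP.
by rewrite /disc /= cmod_discP.
Qed.

Definition graph_mean (r : R) N (b : nat -> nat -> Cplx R) :=
  cmean r (fun z => f (z, laurent N b z)).

Definition mean_gap (r : R) N b := graph_mean 1 N b - graph_mean r N b.

Lemma graph_mean_local r N a b (s : Cplx R) : 0 < r ->
  (forall z, cmod z = r -> Om (z, laurent N (segment_coef a b s) z)) ->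
  exists2 d : R, 0 < d & forall y : Cplx R, cmod (y - s) < d ->
    differentiable (fun s => graph_mean r N (segment_coef a b s)) y.
Proof.
move=> r0 zO; have zn0 z : cmod z = r -> z != 0 by rewrite -cmod_gt0 => ->.
have [||z zr|d d0 dP] := @differentiable_graph_mean R Om f oOm hf (laurent N a)
    (fun z => laurent N b z - laurent N a z) r s r0.
- by move=> z zr; apply: differentiable_laurent; exact: zn0.
- move=> z zr; exact: (differentiable_sub (differentiable_laurent N b (zn0 z zr))
    (differentiable_laurent N a (zn0 z zr))).
- by have := zO z zr; rewrite laurent_segment.
exists d; first exact: d0.
move=> y yd; have := dP y yd; congr (differentiable _ _).
apply/funext => s'; rewrite /graph_mean; apply: eq_cmean => t.
by rewrite laurent_segment.
Qed.

Lemma segment_coef1 (a b : nat -> nat -> Cplx R) : segment_coef a b 1 = b.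
Proof.
apply/funext => j; apply/funext => l.
by rewrite /segment_coef mul1r addrC subrK.
Qed.

(** The gap is holomorphic in the parameter of the segment as soon as the graphs over the two
    circles stay in [Om]; the annulus between them, where Cauchy's theorem would be needed, does not
    enter. *)
Lemma mean_gap_segment r N a b : 0 < r ->
  (forall (s : R) z, 0 <= s <= 1 -> cmod z = 1 \/ cmod z = r ->
    Om (z, laurent N (segment_coef a b s%:C) z)) ->
  (exists2 e : R, 0 < e & forall s : R, 0 <= s < e ->
    mean_gap r N (segment_coef a b s%:C) = 0) ->
  mean_gap r N b = 0.
Proof.
move=> r0 zO gap0; rewrite -[b in LHS](segment_coef1 a b).
apply: (@identity_segment R (fun s => mean_gap r N (segment_coef a b s))) => //.
move=> s s01.
have [|d1 d10 H1] := @graph_mean_local 1 N a b s%:C ltr01.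
  by move=> z z1; apply: zO => //; left.
have [|d2 d20 H2] := @graph_mean_local r N a b s%:C r0.
  by move=> z zr; apply: zO => //; right.
exists (Num.min d1 d2) => [|y]; first by rewrite lt_min d10.
rewrite lt_min => /andP[y1 y2].
exact: (differentiable_sub (H1 y y1) (H2 y y2)).
Qed.

(** The means over the unit circle cancel, so [Om] has to contain the graph only over
    [r <= |z| <= r']. *)
Lemma mean_gap_radius r r' N b : 0 < r -> r <= r' ->
  (forall z, r <= cmod z <= r' -> Om (z, laurent N b z)) ->
  mean_gap r N b = mean_gap r' N b.
Proof.
move=> r0 rr zO; rewrite /mean_gap /graph_mean.
rewrite (@cmean_annulus R (fun z => f (z, laurent N b z)) r r')// => z zr.
have z0 : z != 0.
  by rewrite -cmod_gt0; case/andP: zr => rz _; exact: lt_le_trans rz.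
exact: (differentiable_graph hf (differentiable_laurent N b z0) (zO z zr)).
Qed.

(** The tube is centred at the value over [z] itself and extends to radii near [r], which leaves
    room for changing radius and coefficients at once. *)
Lemma graph_tube N b r : 0 < r ->
  (forall z, cmod z = r -> Om (z, laurent N b z)) ->
  exists2 d : R, 0 < d & forall z v, 0 < cmod z -> `|cmod z - r| < d ->
    cmod (v - laurent N b z) < d -> Om (z, v).
Proof.
move=> r0 zO.
have [||d d0 dP] := @circle_uniform R r (fun x d => forall y v,
    cmod (y - x) < d -> cmod (v - laurent N b y) < d -> Om (y, v)).
- by move=> x d d' dd H y v yx vy; apply: H; exact: lt_le_trans dd.
- move=> x xr; have x0 : x != 0 by rewrite -cmod_gt0 xr.
  have [d d0 dP] := open2_cmod oOm (zO x xr).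
  have cL := differentiable_continuous (differentiable_laurent N b x0).
  have d20 : 0 < d / 2 by rewrite divr_gt0.
  have /continuous_cmodP/(_ _ d20)[d1 d10 d1P] := cL.
  pose e := Num.min (d1 / 2) (d / 2).
  have e1 : e <= d1 / 2 by rewrite ge_min lexx.
  have e2 : e <= d / 2 by rewrite ge_min lexx orbT.
  exists e => [|x' xx y v yx vy]; first by rewrite lt_min !divr_gt0.
  have yx' := cmod_dist y x x'.
  apply: dP; first lra.
  have h := d1P y; have {}h : cmod (laurent N b y - laurent N b x) < d / 2.
    by apply: h; lra.
  apply: (le_lt_trans (cmod_dist v (laurent N b x) (laurent N b y))).
  have -> : d = d / 2 + d / 2 by field.
  exact: (ltrD (lt_le_trans vy e2) h).
exists d => // z v z0 zr vz.
(* Radial projection to the circle moves [z] by exactly [|cmod z - r|]. *)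
pose k := r / cmod z; have k0 : 0 < k by rewrite divr_gt0.
apply: (dP (k%:C * z)) => //; first by rewrite cmodM cmod_nneg ?(ltW k0)// divfK// gt_eqF.
have -> : z - k%:C * z = (1 - k)%:C * z by rewrite rmorphB mulrBl mul1r.
rewrite cmodM cmod_real.
suff -> : `|1 - k| * cmod z = `|cmod z - r| by [].
rewrite -[X in _ * X](gtr0_norm z0) -normrM; congr `|_|.
by rewrite /k mulrBl mul1r divfK// gt_eqF.
Qed.

End Chain.

(** * Descent in the radius *)

Section Descent.
Variable R : realType.
Local Notation "x %:C" := (x%:C%C : Cplx R).
Variables (Om : set (Cplx R * Cplx R)) (f : Cplx R * Cplx R -> Cplx R).
Hypotheses (oOm : open Om) (hf : holomorphic_on Om f).
Hypothesis circOm : circle `*` disc `<=` Om.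

Definition coef_close N (a b : nat -> nat -> Cplx R) (e : R) :=
  forall j l, (j <= N)%N -> (l <= N)%N -> cmod (b j l - a j l) <= e.

(** An open condition on the coefficients: vanishing at [a] alone could not be propagated by the
    identity theorem. *)
Definition gap_vanishes_near r N (a : nat -> nat -> Cplx R) :=
  exists2 d : R, 0 < d & forall b, coef_close N a b d -> mean_gap f r N b = 0.

Lemma cmod_convex (x y : Cplx R) (s e : R) : 0 <= s <= 1 ->
  cmod x < e -> cmod y < e -> cmod (x + s%:C * (y - x)) < e.
Proof.
move=> /andP[s0 s1] xe ye.
have -> : x + s%:C * (y - x) = (1 - s)%:C * x + s%:C * y.
  by rewrite rmorphB /=; ring.
apply: (le_lt_trans (cmodD _ _)); rewrite !cmodM !cmod_nneg ?subr_ge0//.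
set mx := Num.max (cmod x) (cmod y).
have xm : cmod x <= mx by rewrite le_max lexx.
have ym : cmod y <= mx by rewrite le_max lexx orbT.
have me : mx < e by rewrite gt_max xe.
apply: le_lt_trans me.
have h1 : (1 - s) * cmod x <= (1 - s) * mx by apply: ler_wpM2l => //; lra.
have h2 : s * cmod y <= s * mx by apply: ler_wpM2l.
lra.
Qed.

Lemma laurent_close N (r B e : R) a b z :
  (forall a (e : R),
    (forall j l, (j <= N)%N -> (l <= N)%N -> cmod (a j l) <= e) ->
    forall z, r <= cmod z <= 1 -> cmod (laurent N a z) <= B * e) ->
  coef_close N a b e -> r <= cmod z <= 1 ->
  cmod (laurent N b z - laurent N a z) <= B * e.
Proof. by move=> HB ab zr; rewrite laurentB; apply: HB. Qed.

Variables (r1 : R) (N : nat) (a : R -> nat -> nat -> Cplx R).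
Hypotheses (r10 : 0 < r1) (r11 : r1 < 1).
Hypothesis a_circle : forall r z, r1 <= r <= 1 -> cmod z = 1 ->
  cmod (laurent N (a r) z) < 1.
Hypothesis a_graph : forall r z, r1 <= r <= 1 -> cmod z = r ->
  Om (z, laurent N (a r) z).
Hypothesis a_cont : forall r e, r1 <= r <= 1 -> 0 < e ->
  exists2 h : R, 0 < h & forall r', r1 <= r' <= 1 -> `|r' - r| < h ->
    coef_close N (a r) (a r') e.

(* First the coefficients are moved from [a r'] to [b] at the outer radius [r'],
   by the identity theorem; only then is the radius lowered to [r]. *)
Let gap_local r0 : r1 <= r0 <= 1 -> exists2 h : R, 0 < h &
  forall r r', r1 <= r -> r <= r0 -> r0 <= r' -> r' <= 1 -> r' - r < h ->
    gap_vanishes_near r' N (a r') -> gap_vanishes_near r N (a r).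
Proof.
move=> r0r; have r00 : 0 < r0 by case/andP: r0r => h _; exact: lt_le_trans h.
have [B B0 BP] := cmod_laurent_le N r10 (ltW r11).
have [d1 d10 T1] := graph_tube oOm r00 (fun z zr => a_graph r0r zr).
have [d2 d20 T2] := graph_tube oOm ltr01
  (fun z zr => circle_disc circOm zr (a_circle r0r zr)).
pose d := Num.min d1 d2.
have d0 : 0 < d by rewrite lt_min d10.
have dd1 : d <= d1 by rewrite ge_min lexx.
have dd2 : d <= d2 by rewrite ge_min lexx orbT.
(* Coefficients within [2 e] of [a r0] change the values by at most [B * (2 * e) = d / 2], which
   keeps the graphs in both tubes. *)
pose e := d / (4 * B); have e0 : 0 < e by rewrite divr_gt0// mulr_gt0.
have Be : B * (2 * e) < d.
  have -> : B * (2 * e) = d / 2 by rewrite /e; field; exact: lt0r_neq0.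
  lra.
have [h h0 hP] := a_cont r0r e0.
have [r1r0 r01] := andP r0r.
exists (Num.min h d) => [|r r' rr rr0 r0r' r'1]; first by rewrite lt_min h0.
rewrite lt_min => /andP[rh rd] [d' d'0 d'P].
have rr1 : r1 <= r <= 1 by rewrite rr (le_trans rr0 r01).
have rr1' : r1 <= r' <= 1 by rewrite r'1 (le_trans r1r0 r0r').
have ca : coef_close N (a r0) (a r) e.
  by apply: hP => //; rewrite ler0_norm ?subr_le0//; lra.
have ca' : coef_close N (a r0) (a r') e.
  by apply: hP => //; rewrite ger0_norm ?subr_ge0//; lra.
exists e => // b cb.
have cb0 : coef_close N (a r0) b (2 * e).
  move=> j l jN lN; apply: (le_trans (cmod_dist _ _ (a r j l))).
  by have := cb j l jN lN; have := ca j l jN lN; lra.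
have small c z : coef_close N (a r0) c (2 * e) -> r1 <= cmod z <= 1 ->
    cmod (laurent N c z - laurent N (a r0) z) < d.
  by move=> cc zr; apply: le_lt_trans Be; exact: (laurent_close BP cc zr).
have r'0 : 0 < r' by exact: lt_le_trans r0r'.
have r_gt0 : 0 < r by exact: lt_le_trans rr.
have cseg (s : R) : 0 <= s <= 1 ->
    coef_close N (a r0) (segment_coef (a r') b s%:C) (2 * e).
  move=> s01 j l jN lN; rewrite /segment_coef.
  have -> : a r' j l + s%:C * (b j l - a r' j l) - a r0 j l =
      (a r' j l - a r0 j l) +
      s%:C * ((b j l - a r0 j l) - (a r' j l - a r0 j l)) by ring.
  apply/ler_addgt0Pl => eta eta0; apply: ltW; apply: cmod_convex => //.
    by have := ca' j l jN lN; lra.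
  by have := cb0 j l jN lN; lra.
rewrite (@mean_gap_radius _ Om f hf r r') //; last 2 first.
- exact: le_trans r0r'.
- move=> z /andP[rz zr'].
  have z0 : 0 < cmod z by exact: lt_le_trans rz.
  apply: T1 => //.
    by apply: lt_le_trans dd1; rewrite ltr_norml; apply/andP; split; lra.
  apply: lt_le_trans dd1; apply: small => //.
  by rewrite (le_trans rr rz) (le_trans zr' r'1).
apply: (@mean_gap_segment _ Om f oOm hf r' N (a r') b r'0).
  move=> s z s01 [z1|zr'].
    apply: T2; rewrite ?z1 ?subrr ?normr0//; apply: lt_le_trans dd2.
    by apply: small; [exact: cseg|rewrite z1 lexx andbT; exact: ltW].
  apply: T1; rewrite ?zr'//.
    by apply: lt_le_trans dd1; rewrite ger0_norm ?subr_ge0//; lra.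
  by apply: lt_le_trans dd1; apply: small; [exact: cseg|rewrite zr'].
(* [b] lies within [3 e] of [a r'], so for [s < d' / (3 e)] the segment is still where the gap is
   known to vanish. *)
have e3 : 0 < 3 * e by lra.
have d3 : 0 < d' / (3 * e) by exact: divr_gt0.
exists (d' / (3 * e)) => // s /andP[s0 sd]; apply: d'P => j l jN lN.
rewrite /segment_coef addrAC subrr add0r cmodM cmod_nneg//.
have b1 : cmod (b j l - a r' j l) <= 3 * e.
  apply: (le_trans (cmod_dist _ _ (a r0 j l))).
  rewrite [cmod (a r0 j l - _)]cmodBC.
  by have := cb0 j l jN lN; have := ca' j l jN lN; lra.
apply: (@le_trans _ _ (s * (3 * e))); first by apply: ler_wpM2l.
by rewrite -(ler_pdivlMr _ _ e3); exact: ltW.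
Qed.

Lemma gap_vanishes_inner : gap_vanishes_near r1 N (a r1).
Proof.
have top : gap_vanishes_near 1 N (a 1).
  by exists 1 => // b _; rewrite /mean_gap subrr.
(* Cousin's lemma in one variable, with [y] idle: an interval is good if vanishing passes from its
   right end to its left end, and this composes over adjacent halves. *)
pose Pr (x y h : R) := gap_vanishes_near (x + h) N (a (x + h)) ->
  gap_vanishes_near x N (a x).
have H : Pr r1 0 (1 - r1).
  apply: cousin_square; first by rewrite subr_gt0.
    move=> x y h _ _ H1 H2 _ _ Hxh; apply: H1; apply: H2.
    by have -> : x + h / 2 + h / 2 = x + h by field.
  move=> x y xx _; have [|h h0 hP] := gap_local (r0 := x).
    by rewrite subrKC in xx.
  exists h => // x' y' k k0 kh [xa xb _ _] /andP[x1 x2] _.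
  apply: hP => //; first by rewrite subrKC in xb.
  by rewrite addrAC subrr add0r.
by apply: H; rewrite subrKC.
Qed.

Variables (w0 : Cplx R) (eps : R).
Hypothesis center : forall z w, cmod z <= r1 -> cmod (w - w0) < eps -> Om (z, w).
Hypothesis a_near : forall z, cmod z = r1 -> cmod (laurent N (a r1) z - w0) < eps.

(** The segment from [a r1] to the constant [w] keeps its values in two convex sets: the unit disc
    over [|z| = 1] and the ball of radius [eps] about [w0] over [|z| = r1]. *)
Let gap_const w : cmod w < 1 -> cmod (w - w0) < eps ->
  mean_gap f r1 N (const_coef w) = 0.
Proof.
move=> w1 ww; have [d d0 dP] := gap_vanishes_inner.
have rr : r1 <= r1 <= 1 by rewrite lexx ltW.
apply: (@mean_gap_segment _ Om f oOm hf r1 N (a r1) _ r10).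
  move=> s z s01; rewrite laurent_segment laurent_const => -[z1|zr].
    apply: circle_disc => //; apply: cmod_convex => //.
    exact: a_circle.
  apply: center; first by rewrite zr.
  set L := laurent N (a r1) z.
  have -> : L + s%:C * (w - L) - w0 =
      (L - w0) + s%:C * ((w - w0) - (L - w0)) by ring.
  by apply: cmod_convex => //; exact: a_near.
(* [T] dominates every coefficient difference; the added [1] makes it positive. *)
pose T := \sum_(j < N.+1) \sum_(l < N.+1)
  cmod (const_coef w j l - a r1 j l) + 1.
have T0 : 0 < T.
  by rewrite ltr_wpDl// sumr_ge0// => j _; apply: sumr_ge0 => l _; exact: cmod_ge0.
exists (d / T) => [|s /andP[s0 sd]]; first by rewrite divr_gt0.
apply: dP => j l jN lN.
rewrite /segment_coef addrAC subrr add0r cmodM cmod_nneg//.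
apply: (@le_trans _ _ (s * T)); last by rewrite -ler_pdivlMr//; exact: ltW.
apply: ler_wpM2l => //; rewrite /T.
have jN1 : (j < N.+1)%N by rewrite ltnS.
have lN1 : (l < N.+1)%N by rewrite ltnS.
rewrite (bigD1 (Ordinal jN1))//= (bigD1 (Ordinal lN1))//= -!addrA lerDl.
rewrite addr_ge0//; first by apply: sumr_ge0 => ? _; exact: cmod_ge0.
rewrite addr_ge0//; apply: sumr_ge0 => ? _; apply: sumr_ge0 => ? _.
exact: cmod_ge0.
Qed.

(** Near [w0] the gap and the inner mean both vanish, hence so does the outer mean; the identity
    theorem spreads this along the segment from [w1] to any [w]. The starting point [w1] is separate
    because [w0] need not lie in the disc. *)
Lemma circle_mean_vanishes (w1 : Cplx R) :
  cmod w1 < 1 -> cmod (w1 - w0) < eps ->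
  (forall w, cmod w < 1 -> cmod (w - w0) < eps ->
     cmean r1 (fun z => f (z, w)) = 0) ->
  forall w, cmod w < 1 -> cmean 1 (fun z => f (z, w)) = 0.
Proof.
move=> w11 w1w inner w wlt.
have base v : cmod v < 1 -> cmod (v - w0) < eps -> cmean 1 (fun z => f (z, v)) = 0.
  move=> v1 vw; have := gap_const v1 vw.
  rewrite /mean_gap /graph_mean.
  have E r : cmean r (fun z => f (z, laurent N (const_coef v) z)) =
      cmean r (fun z => f (z, v)).
    by apply: eq_cmean => t; rewrite laurent_const.
  by rewrite !E inner// subr0.
pose u (s : Cplx R) := cmean 1 (fun z => f (z, w1 + s * (w - w1))).
have -> : cmean 1 (fun z => f (z, w)) = u 1 by rewrite /u mul1r subrKC.
apply: identity_segment.
  move=> s s01.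
  apply: (@differentiable_graph_mean _ Om f oOm hf (fun=> w1) (fun=> w - w1) 1
    s%:C ltr01).
  - by move=> x _; exact: differentiable_const.
  - by move=> x _; exact: differentiable_const.
  - by move=> x x1; apply: circle_disc => //; exact: cmod_convex.
pose k := cmod (w - w1) + 1; have k0 : 0 < k by rewrite ltr_wpDl ?cmod_ge0.
pose g := eps - cmod (w1 - w0); have g0 : 0 < g by rewrite subr_gt0.
exists (Num.min 1 (g / k)) => [|s /andP[s0]]; first by rewrite lt_min ltr01 divr_gt0.
rewrite lt_min ltr_pdivlMr// => /andP[s1 sg].
apply: base; first by apply: cmod_convex => //; rewrite s0 ltW.
rewrite addrAC; apply: (le_lt_trans (cmodD _ _)).
by rewrite cmodM cmod_nneg//; move: sg; rewrite /g /k; lra.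
Qed.

End Descent.

(** * The Cauchy integral extension *)

Section Extension.
Variable R : realType.
Local Notation "x %:C" := (x%:C%C : Cplx R).
Variables (Om : set (Cplx R * Cplx R)) (f : Cplx R * Cplx R -> Cplx R).
Hypotheses (oOm : open Om) (hf : holomorphic_on Om f).
Hypothesis circOm : circle `*` disc `<=` Om.
Hypothesis vanish : forall w m, cmod w < 1 ->
  cmean 1 (fun z => f (z, w) * z ^+ m.+1) = 0.

Lemma exists_pow_lt (r e : R) : 0 <= r -> r < 1 -> 0 < e ->
  exists n, forall j, (n <= j)%N -> r ^+ j < e.
Proof.
move=> r0 r1 e0; have cr : (fun n => r ^+ n) @ \oo --> (0 : R).
  by apply: cvg_expr; rewrite ger0_norm.
have /cvgrPdist_lt/(_ e e0)[n _ nP] := cr; exists n => j nj.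
by have := nP j nj; rewrite /= sub0r normrN ger0_norm// exprn_ge0.
Qed.

(** The Cauchy integral over the unit circle; the factor [x] in the numerator is that of
    [dx = i x dt]. *)
Let cauchy (p : Cplx R * Cplx R) : Cplx R :=
  cmean 1 (fun x => f (x, p.2) * (x / (x - p.1))).

Let circ_slice w : cmod w < 1 -> exists2 d : R, 0 < d &
  forall x v, cmod x = 1 -> cmod (v - w) < d ->
    Om (x, v) /\ cmod (f (x, v)) <= d^-1.
Proof.
move=> w1; have [||d d0 dP] := @circle_uniform R 1 (fun x d => 0 < d ->
    forall v, cmod (v - w) < d -> Om (x, v) /\ cmod (f (x, v)) <= d^-1).
- move=> x d d' dd H d'0 v vd.
  have [h1 h2] := H (lt_le_trans d'0 dd) v (lt_le_trans vd dd); split => //.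
  by apply: (le_trans h2); rewrite lef_pV2 ?posrE// (lt_le_trans d'0 dd).
- move=> x x1; have [d d0 H] := holomorphic_locally_bounded oOm hf
    (circle_disc circOm x1 w1).
  by exists d => // y yx _ v vw; exact: H.
by exists d => // x v x1 vw; exact: (dP x x1 d0 v vw).
Qed.

Let differentiable_cauchy z w : cmod z < 1 -> cmod w < 1 ->
  differentiable cauchy (z, w).
Proof.
move=> z1 w1; have [d d0 dP] := circ_slice w1.
(* Half the distance from [z] to the circle: for [y] within [k] of [z] the kernel is bounded by
   [k^-1]. *)
pose k := (1 - cmod z) / 2; have k0 : 0 < k by rewrite divr_gt0// subr_gt0.
pose e := Num.min d k; have e0 : 0 < e by rewrite lt_min d0.
have ed : e <= d by rewrite ge_min lexx.
have ek : e <= k by rewrite ge_min lexx orbT.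
have xy x y : cmod x = 1 -> cmod (y - z) < e -> k <= cmod (x - y).
  move=> x1 yz; have := cmodD (y - z) z; have := cmodD (x - y) y.
  by rewrite !subrK x1; rewrite /k in ek *; lra.
have xy0 x y : cmod x = 1 -> cmod (y - z) < e -> x - y != 0.
  by move=> x1 yz; rewrite -cmod_gt0; exact: lt_le_trans (xy x y x1 yz).
apply: (@differentiable_cmean R (fun x p => f (x, p.2) * (x / (x - p.1))) 1 z w
  e (d^-1 * k^-1) ltr01 e0).
  move=> x y v x1 yz vw; have [h1 h2] := dP x v x1 (lt_le_trans vw ed); split.
    have xyn := xy0 x y x1 yz.
    have dfx : differentiable (fun p : Cplx R * Cplx R => f (x, p.2)) (y, v).
      exact: (differentiable_comp2 (differentiable_const x (y, v))
        (differentiable_snd (y, v)) (hf h1)).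
    have dxy : differentiable (fun p : Cplx R * Cplx R => x - p.1) (y, v).
      exact: (differentiable_sub (differentiable_const x (y, v))
        (differentiable_fst (y, v))).
    exact: (differentiable_mul dfx (differentiable_mul
      (differentiable_const x (y, v)) (differentiable_inv dxy xyn))).
  rewrite !cmodM cmodV x1 mul1r; apply: ler_pM; rewrite ?invr_ge0 ?cmod_ge0//.
  have h := xy x y x1 yz.
  by rewrite lef_pV2 ?posrE// (lt_le_trans k0 h).
move=> y v yz vw.
apply: (@cont_circle R (fun x => f (x, v) * (x / (x - y))) 1 ler01) => x x1.
have [h1 _] := dP x v x1 (lt_le_trans vw ed).
apply: differentiable_continuous.
exact: (differentiable_mul
  (differentiable_comp2 (differentiable_var x) (differentiable_const v x) (hf h1))
  (differentiable_mul (differentiable_var x) (differentiable_inv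
    (differentiable_sub (differentiable_var x) (differentiable_const y x))
    (xy0 x y x1 yz)))).
Qed.

(** By [vanish] only nonnegative powers occur on [|x| = r], and their coefficients may be computed
    on the unit circle. Summing the geometric series under that mean, the partial sums tend to the
    Cauchy integral, and [partial_sums_limit] identifies the limit with [f (z, w)]. *)
Let cauchy_formula z w (d : R) : cmod w < 1 -> d <= 1 -> cmod z < 1 ->
  `|cmod z - 1| < d ->
  (forall y, `|cmod y - 1| < d -> Om (y, w)) -> f (z, w) = cauchy (z, w).
Proof.
move=> w1 d1 z1 zd yO; set r := cmod z in z1 zd.
(* Here [d <= 1] keeps [z] away from the origin. *)
have r0 : 0 < r by move: zd; rewrite ltr_norml => /andP[]; lra.
pose u x := f (x, w).
have du y : r <= cmod y <= 1 -> differentiable u y.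
  move=> /andP[ry y1].
  have yw : Om (y, w).
    by apply: yO; move: zd; rewrite !ltr_norml => /andP[? ?]; apply/andP; split; lra.
  exact: (differentiable_comp2 (differentiable_var y) (differentiable_const w y)
    (hf yw)).
have yn0 y : r <= cmod y <= 1 -> y != 0.
  by move=> /andP[ry _]; rewrite -cmod_gt0; exact: lt_le_trans ry.
have dinv m y : r <= cmod y <= 1 -> differentiable (fun x => u x * x^-1 ^+ m) y.
  move=> yr; exact: (differentiable_mul (du y yr) (differentiable_pow m
    (differentiable_inv (differentiable_var y) (yn0 y yr)))).
have dpow m y : r <= cmod y <= 1 -> differentiable (fun x => u x * x ^+ m) y.
  move=> yr; exact: (differentiable_mul (du y yr) (differentiable_pow m
    (differentiable_var y))).
have rr y : cmod y = r -> r <= cmod y <= 1 by move=> ->; rewrite lexx ltW.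
have r1 y : cmod y = 1 -> r <= cmod y <= 1 by move=> ->; rewrite lexx andbT ltW.
have [d2 d20 d2P] := circ_slice w1.
have uB x : cmod x = 1 -> cmod (u x) <= d2^-1.
  by move=> x1; have [] := d2P x w x1 _; rewrite ?subrr ?cmod0.
have B0 : 0 < d2^-1 by rewrite invr_gt0.
have cc (v : Cplx R -> Cplx R) : (forall y, r <= cmod y <= 1 -> differentiable v y) ->
    cont_circ 1 v.
  move=> dv; apply: (@cont_circle R v 1 ler01) => y y1.
  by apply: differentiable_continuous; apply: dv; exact: r1.
have xz x : cmod x = 1 -> x - z != 0.
  move=> x1; apply/eqP => /subr0_eq xzE.
  by move: x1; rewrite xzE -/r => r1E; move: z1; rewrite r1E ltxx.
have cauchyc : cont_circ 1 (fun x => u x * (x / (x - z))).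
  apply: (@cont_circle R (fun x => u x * (x / (x - z))) 1 ler01) => y y1.
  apply: differentiable_continuous.
  exact: (differentiable_mul (du y (r1 y y1)) (differentiable_mul
    (differentiable_var y) (differentiable_inv (differentiable_sub
    (differentiable_var y) (differentiable_const z y)) (xz y y1)))).
apply/eqP; rewrite -subr_eq0 -cmod_eq0 eq_le cmod_ge0 andbT.
apply/ler_addgt0Pl => e e0; rewrite addr0.
have s0 : 0 < 1 - r by rewrite subr_gt0.
(* Chosen so that the geometric remainder, at most [d2^-1 * r ^+ j.+1 / (1 - r)], is at most [e]. *)
have [n nP] := exists_pow_lt (ltW r0) z1 (divr_gt0 (mulr_gt0 e0 s0) B0).
apply: (@partial_sums_limit R u r z (cauchy (z, w)) e n r0 erefl).
- by move=> x xr; apply: differentiable_continuous; apply: du; exact: rr.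
- move=> m; rewrite (cmean_annulus r0 (ltW z1) (dpow m.+1)).
  exact: vanish.
- move=> j nj.
  rewrite (eq_bigr (fun m : 'I_j.+1 => cmean 1 (fun x => z ^+ m * (u x * x^-1 ^+ m)))); last first.
    move=> m _; rewrite (cmean_annulus r0 (ltW z1) (dinv m)) mulrC.
    by rewrite (cmeanZ (z ^+ m) (cc _ (dinv m))).
  have csum m : cont_circ 1 (fun x => z ^+ m * (u x * x^-1 ^+ m)).
    exact: (cont_circM (@cont_circ_cst R 1 (z ^+ m)) (cc _ (dinv m))).
  rewrite -(@cmean_sum R 1 j.+1 (fun m x => z ^+ m * (u x * x^-1 ^+ m)) csum).
  rewrite -(cmeanB (cont_circ_sum csum) cauchyc).
  apply: (cmod_cmean_le (cont_circB (cont_circ_sum csum) cauchyc)) => t _.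
  have x1 : cmod (1%:C * cis t) = 1 by rewrite cmod_polar.
  move: (1%:C * cis t) x1 => x x1.
  have x0 : x != 0 by rewrite -cmod_gt0 x1.
  have xzn := xz x x1.
  (* The remainder of the geometric series for [x / (x - z)] in powers of [z / x]. *)
  have -> : \sum_(m < j.+1) z ^+ m * (u x * x^-1 ^+ m) - u x * (x / (x - z)) =
      - (u x * (x / (x - z)) * (z / x) ^+ j.+1).
    have q1 : z / x - 1 != 0.
      rewrite -(mulfV x0) -mulrBl mulf_neq0 ?invr_eq0//.
      by rewrite -opprB oppr_eq0.
    have -> : \sum_(m < j.+1) z ^+ m * (u x * x^-1 ^+ m) =
        u x * \sum_(m < j.+1) (z / x) ^+ m.
      rewrite mulr_sumr; apply: eq_bigr => m _.
      by rewrite (exprMn m z x^-1) mulrCA.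
    have -> : \sum_(m < j.+1) (z / x) ^+ m = ((z / x) ^+ j.+1 - 1) / (z / x - 1).
      by apply: (mulfI q1); rewrite -subrX1 mulrCA mulfV// mulr1.
    have -> : x / (x - z) = - (z / x - 1)^-1.
      have -> : z / x - 1 = - ((x - z) / x) by rewrite mulrBl mulfV// opprB.
      by rewrite invrN opprK (invfM (x - z)) invrK mulrC.
    ring.
  rewrite cmodN !cmodM cmodV cmodX cmodM cmodV x1 mul1r invr1 mulr1 -/r.
  have xzb : 1 - r <= cmod (x - z).
    by have := cmodD (x - z) z; rewrite subrK x1 -/r; lra.
  have h1 : (cmod (x - z))^-1 <= (1 - r)^-1.
    by rewrite lef_pV2 ?posrE// (lt_le_trans s0 xzb).
  have h2 := nP j.+1 (leqW nj).
  have h3 : cmod (u x) * (cmod (x - z))^-1 <= d2^-1 * (1 - r)^-1.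
    by apply: ler_pM; rewrite ?invr_ge0 ?cmod_ge0//; exact: uB.
  apply: (@le_trans _ _ (d2^-1 * (1 - r)^-1 * (e * (1 - r) / d2^-1))).
    apply: ler_pM => //; rewrite ?mulr_ge0 ?invr_ge0 ?cmod_ge0 ?exprn_ge0 ?(ltW r0)//.
    exact: ltW.
  rewrite le_eqVlt; apply/orP; left; apply/eqP; field.
  by rewrite !gt_eqF.
Qed.

Lemma differentiable_near_eq (g h : Cplx R * Cplx R -> Cplx R) z w (d : R) :
  0 < d ->
  (forall y v, cmod (y - z) < d -> cmod (v - w) < d -> g (y, v) = h (y, v)) ->
  differentiable h (z, w) -> differentiable g (z, w).
Proof.
move=> d0 gh /differentiable2_cmod[a [b H]].
apply: (@differentiable2_of_cmod _ _ _ _ a b) => e e0.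
have [d' d'0 H'] := H e e0.
exists (Num.min d d') => [|h1 k1]; first by rewrite lt_min d0.
rewrite !lt_min => /andP[h1d h1d'] /andP[k1d k1d'].
rewrite !gh ?subrr ?cmod0//; first exact: H'.
  by rewrite addrAC subrr add0r.
by rewrite addrAC subrr add0r.
Qed.

(** The condition concerns a full annulus around the circle and not only a neighbourhood of the
    point, because [cauchy_formula] moves circles through all radii between [|z|] and [1]. *)
Definition collar : set (Cplx R * Cplx R) := [set p | cmod p.2 < 1 /\
  exists d : R, [/\ d <= 1, `|cmod p.1 - 1| < d & forall y v,
    `|cmod y - 1| < d -> cmod (v - p.2) < d -> Om (y, v)]].

Lemma collar_open z w : collar (z, w) -> exists2 d : R, 0 < d &
  forall y v, cmod (y - z) < d -> cmod (v - w) < d -> collar (y, v).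
Proof.
move=> [/= w1 [d [d1 zd H]]].
pose k := (d - `|cmod z - 1|) / 2.
have k0 : 0 < k by rewrite divr_gt0// subr_gt0.
exists (Num.min k (1 - cmod w)) => [|y v]; first by rewrite lt_min k0 subr_gt0.
rewrite !lt_min => /andP[yz _] /andP[vw vw1]; split => /=.
  by have := cmodD (v - w) w; rewrite subrK; lra.
have z0 := normr_ge0 (cmod z - 1).
exists (d - k); split; first by lra.
  have := ler_normD (cmod y - cmod z) (cmod z - 1); rewrite subrKA.
  by have := cmod_dist_le y z; rewrite /k in yz *; lra.
move=> y' v' y'd v'd; apply: H; first by lra.
by have := cmod_dist v' w v; lra.
Qed.

Lemma circle_collar z w : cmod z = 1 -> cmod w < 1 -> collar (z, w).
Proof.
move=> z1 w1; split => //=.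
have [||d d0 dP] := @circle_uniform R 1 (fun x d => forall y v,
    cmod (y - x) < d -> cmod (v - w) < d -> Om (y, v)).
- by move=> x d d' dd H y v yx vw; apply: H; exact: lt_le_trans dd.
- move=> x x1; have [d d0 dP] := open2_cmod oOm (circle_disc circOm x1 w1).
  exists (d / 2) => [|x' xx y v yx vw]; first by rewrite divr_gt0.
  by apply: dP; [have := cmod_dist y x x'; lra|lra].
pose e := Num.min d 1.
have e0 : 0 < e by rewrite lt_min d0 ltr01.
have ed : e <= d by rewrite ge_min lexx.
have e1 : e <= 1 by rewrite ge_min lexx orbT.
exists e; split => //; first by rewrite z1 subrr normr0.
move=> y v ye ve.
have y0 : 0 < cmod y by move: ye; rewrite ltr_norml => /andP[]; lra.
(* Radial projection to the unit circle, as in [graph_tube]. *)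
pose k := (cmod y)^-1; have k0 : 0 < k by rewrite invr_gt0.
apply: (dP (k%:C * y)); last exact: lt_le_trans ed.
  by rewrite cmodM cmod_nneg ?(ltW k0)// mulVf// gt_eqF.
have -> : y - k%:C * y = (1 - k)%:C * y by rewrite rmorphB mulrBl mul1r.
apply: lt_le_trans ed; rewrite cmodM cmod_real.
suff -> : `|1 - k| * cmod y = `|cmod y - 1| by [].
rewrite -[X in _ * X](gtr0_norm y0) -normrM; congr `|_|.
by rewrite /k mulrBl mul1r mulVf// gt_eqF.
Qed.

(** [g] is the Cauchy integral inside the unit circle and [f] elsewhere. On the collar
    [cauchy_formula] makes the two agree, which gives holomorphy across the circle; [Om2] lies in
    [|z| >= 1], where [g] is [f] by definition. *)
Lemma extension (Om2 : set (Cplx R * Cplx R)) : open Om2 -> Om2 `<=` Om ->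
  (forall p, Om2 p -> 1 <= cmod p.1) ->
  exists (W : set (Cplx R * Cplx R)) (g : Cplx R * Cplx R -> Cplx R),
    [/\ open W, closed_disc `*` disc `|` Om2 `<=` W, holomorphic_on W g
      & forall p, Om2 p -> g p = f p].
Proof.
move=> oOm2 Om2Om Om2z.
pose bidisc : set (Cplx R * Cplx R) := [set p | cmod p.1 < 1 /\ cmod p.2 < 1].
pose g p := if cmod p.1 < 1 then cauchy p else f p.
have bidisc_open z w : bidisc (z, w) -> exists2 d : R, 0 < d &
    forall y v, cmod (y - z) < d -> cmod (v - w) < d -> bidisc (y, v).
  move=> [/= z1 w1]; exists (Num.min (1 - cmod z) (1 - cmod w)) => [|y v].
    by rewrite lt_min !subr_gt0 z1.
  rewrite !lt_min => /andP[yz _] /andP[_ vw]; split => /=.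
    by have := cmodD (y - z) z; rewrite subrK; lra.
  by have := cmodD (v - w) w; rewrite subrK; lra.
have gcollar p : collar p -> g p = f p.
  case: p => z w [/= w1 [d [d1 zd H]]]; rewrite /g /=.
  case: ifP => // z1; apply/esym; apply: (cauchy_formula w1 d1 z1 zd) => y yd.
  by apply: H => //; rewrite subrr cmod0; exact: le_lt_trans zd.
have collarOm z w : collar (z, w) -> Om (z, w).
  move=> [/= w1 [d [d1 zd H]]]; apply: H => //.
  by rewrite subrr cmod0; exact: le_lt_trans zd.
have gOm2 p : Om2 p -> g p = f p.
  by move=> /Om2z p1; rewrite /g ltNge p1.
exists (bidisc `|` collar `|` Om2), g; split => //.
- rewrite openE => -[z w] [[b|c]|o]; apply/nbhs2_cmodP.
  + have [d d0 dP] := bidisc_open z w b.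
    by exists d => // y v yz vw; left; left; exact: dP.
  + have [d d0 dP] := collar_open c.
    by exists d => // y v yz vw; left; right; exact: dP.
  + have [d d0 dP] := open2_cmod oOm2 o.
    by exists d => // y v yz vw; right; exact: dP.
- move=> [z w] [[/= z1 w1]|o]; last by right.
  left; move: z1 w1; rewrite /closed_disc /disc /= cmod_discP -cmodE (lecR _ 1).
  rewrite le_eqVlt => /orP[/eqP z1|z1] w1; last by left.
  by right; exact: circle_collar.
- move=> [z w] [[b|c]|o].
  + have [d d0 dP] := bidisc_open z w b; have [/= z1 w1] := b.
    apply: (differentiable_near_eq d0 _ (differentiable_cauchy z1 w1)).
    by move=> y v yz vw; have [/= y1 _] := dP y v yz vw; rewrite /g /= y1.
  + have [d d0 dP] := collar_open c.
    apply: (differentiable_near_eq d0 _ (hf (collarOm _ _ c))).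
    by move=> y v yz vw; apply: gcollar; exact: dP.
  + have [d d0 dP] := open2_cmod oOm2 o.
    apply: (differentiable_near_eq d0 _ (hf (Om2Om _ o))).
    by move=> y v yz vw; apply: gOm2; exact: dP.
Qed.

End Extension.

(** * The Fourier condition *)

Section Assembly.
Variable R : realType.
Local Notation "x %:C" := (x%:C%C : Cplx R).

Lemma cmod_dist_half (z w v : Cplx R) (e : R) :
  cmod (z - v) <= e / 2 -> cmod (w - v) <= e / 2 -> cmod (z - w) <= e.
Proof.
move=> zv wv; apply: (le_trans (cmod_dist z w v)); rewrite [cmod (v - w)]cmodBC.
by rewrite [leRHS]splitr; exact: lerD.
Qed.

Lemma sum_le_esum (phi : int -> R) (s : seq int) : (forall n, 0 <= phi n) ->
  uniq s ->
  ((\sum_(n <- s) phi n)%:E <= \esum_(n in [set: int]) (phi n)%:E)%E.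
Proof.
move=> phi0 us; apply: esum_ge; exists [set` s]; first by split; [exact: finite_seq|].
by rewrite -fsbig_seq// -sumEFin.
Qed.

Lemma cmean_fourier_coef (F : Cplx R -> Cplx R) (r : R) (j l : nat) :
  cont_circ r F ->
  cmean r (fun x => F x * (x ^+ l * x^-1 ^+ j)) =
  (r ^+ l * r^-1 ^+ j)%:C * fourier_coef F r (j%:Z - l%:Z).
Proof.
move=> cF; rewrite /fourier_coef mulrCA /cmean; congr (_ * _).
have ccis (k : R) : cont_on 0 (2 * pi) (fun t => cis (- (k * t))).
  move=> t _; apply: (@continuous_comp _ _ _ (fun t : R => - (k * t)) (@cis R)).
    have kt : (fun t : R => k * t) @ t --> k * t.
      exact: mulrl_continuous.
    exact: (cvgN kt).
  exact: continuous_cis.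
rewrite -(cintegralZ _ (cont_onM cF (ccis _))).
apply: eq_cintegral => t _; rewrite [RHS]mulrCA; congr (_ * _).
have K (x y : Cplx R) : (x * y) ^+ l * (x * y)^-1 ^+ j =
    (x ^+ l * x^-1 ^+ j) * (y ^+ l * y^-1 ^+ j).
  rewrite (exprMn l x y); have -> : (x * y)^-1 = x^-1 * y^-1 by exact: invfM.
  by rewrite (exprMn j x^-1 y^-1); exact: mulrACA.
rewrite K; congr (_ * _).
  by rewrite rmorphM !rmorphXn /= fmorphV.
rewrite -cisN -!cis_mulrn -cisD; congr cis.
by rewrite rmorphB /= -!pmulrn; ring.
Qed.

(** Up to the factor [N.+1%:R^-1], the coefficients of the Fejér mean have as moduli the terms of
    the series in the hypothesis. *)
Lemma cmod_cmean_fourier (F : Cplx R -> Cplx R) (r : R) (j l : nat) : 0 < r ->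
  cont_circ r F ->
  cmod (cmean r (fun x => F x * (x ^+ l * x^-1 ^+ j))) =
  cmod (fourier_coef F r (j%:Z - l%:Z)) / r ^ (j%:Z - l%:Z).
Proof.
move=> r0 cF; rewrite cmean_fourier_coef// cmodM cmod_nneg; last first.
  by rewrite mulr_ge0 ?exprn_ge0 ?invr_ge0 ?(ltW r0).
rewrite mulrC; congr (_ * _).
rewrite expfzDr ?gt_eqF// -exprnP -exprnN invfM invrK mulrC exprVn.
by [].
Qed.

Lemma finite_min (n : nat) (P : nat -> R -> Prop) :
  (forall j d d', d' <= d -> P j d -> P j d') ->
  (forall j, (j <= n)%N -> exists2 d : R, 0 < d & P j d) ->
  exists2 d : R, 0 < d & forall j, (j <= n)%N -> P j d.
Proof.
move=> mono; elim: n => [|n IH] H.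
  have [d d0 dP] := H 0%N (leqnn _); exists d => // j.
  by rewrite leqn0 => /eqP ->.
have [|d1 d10 H1] := IH; first by move=> j jn; apply: H; exact: leqW.
have [d2 d20 H2] := H n.+1 (leqnn _).
exists (Num.min d1 d2) => [|j]; first by rewrite lt_min d10.
rewrite leq_eqVlt => /orP[/eqP ->|jn].
  by apply: mono H2; rewrite ge_min lexx orbT.
by apply: mono (H1 j jn); rewrite ge_min lexx.
Qed.

Lemma fejer_laurent (N : nat) (r : R) (F : Cplx R -> Cplx R) z :
  fejer N r F z = laurent N (fun j l => N.+1%:R^-1 *
    cmean r (fun x => F x * (x ^+ l * x^-1 ^+ j))) z.
Proof.
rewrite /fejer /laurent mulr_sumr; apply: eq_bigr => j _.
by rewrite mulr_sumr; apply: eq_bigr => l _; exact: mulrA.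
Qed.

Lemma inv_succ_le1 n : n.+1%:R^-1 <= 1 :> R.
Proof. by rewrite invf_le1 ?ler1n// ltr0n. Qed.

Lemma scaled_circle (u : Cplx R -> Cplx R) (r r' t : R) : 0 < r ->
  u ((r' / r)%:C * (r%:C * cis t)) = u (r'%:C * cis t).
Proof. by move=> r0; rewrite mulrA -rmorphM divfK// gt_eqF. Qed.

Lemma cmean_scale (u : Cplx R -> Cplx R) (r r' : R) : 0 < r ->
  cmean r' u = cmean r (fun x => u ((r' / r)%:C * x)).
Proof.
move=> r0; rewrite /cmean; congr (_ * _); apply: eq_cintegral => t _.
by rewrite scaled_circle.
Qed.

Lemma cont_circ_scale (u : Cplx R -> Cplx R) (r r' : R) : 0 < r ->
  cont_circ r' u -> cont_circ r (fun x => u ((r' / r)%:C * x)).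
Proof.
move=> r0; rewrite /cont_circ.
have -> : (fun t => u ((r' / r)%:C * (r%:C * cis t))) =
    (fun t => u (r'%:C * cis t)); last by [].
by apply/funext => t; exact: scaled_circle.
Qed.

Variable F : Cplx R -> Cplx R.
Hypothesis cF : forall x, cmod x <= 1 -> forall e : R, 0 < e ->
  exists2 d : R, 0 < d & forall y, cmod y <= 1 -> cmod (y - x) < d ->
    cmod (F y - F x) < e.
Hypothesis sumF : forall r : R, 0 < r -> r <= 1 ->
  (\esum_(n in [set: int]) (cmod (fourier_coef F r n) / r ^ n)%:E < 1)%E.

Lemma cmod_range (z : Cplx R) : cmod z <= 1 -> -1 <= cmod z <= 1.
Proof.
by move=> z1; apply/andP; split => //; apply: le_trans (cmod_ge0 z); rewrite lerN10.
Qed.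

Lemma uniformly_continuous_disc (e : R) : 0 < e -> exists2 d : R, 0 < d &
  forall x y, cmod x <= 1 -> cmod y <= 1 -> cmod (y - x) < d ->
    cmod (F y - F x) < e.
Proof.
move=> e0; have e20 : 0 < e / 2 by rewrite divr_gt0.
have [||d d0 dP] := @annulus_uniform R (-1) 1 (fun x d => forall y,
    cmod y <= 1 -> cmod (y - x) < d -> cmod (F y - F x) < e).
- by move=> x d d' dd H y y1 yx; apply: H => //; exact: lt_le_trans dd.
- move=> x /andP[_ x1]; have [d d0 dP] := cF x1 e20.
  exists (d / 2) => [|x' /andP[_ x'1] xx y y1 yx]; first by rewrite divr_gt0.
  have h1 : cmod (F y - F x) < e / 2.
    by apply: dP => //; have := cmod_dist y x x'; lra.
  have h2 : cmod (F x' - F x) < e / 2 by apply: dP => //; lra.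
  have := cmod_dist (F y) (F x') (F x); rewrite [cmod (F x - F x')]cmodBC; lra.
by exists d => // x y x1 y1; apply: dP => //; exact: cmod_range.
Qed.

Lemma bounded_disc : exists2 B : R, 0 < B & forall x, cmod x <= 1 -> cmod (F x) <= B.
Proof.
have [d d0 dP] := uniformly_continuous_disc ltr01.
have [||d1 d10 d1P] := @annulus_uniform R (-1) 1 (fun x d => 0 < d ->
    cmod (F x) <= d^-1).
- move=> x e e' ee H e'0; apply: (le_trans (H (lt_le_trans e'0 ee))).
  by rewrite lef_pV2 ?posrE// (lt_le_trans e'0 ee).
- move=> x /andP[_ x1]; have M0 : 0 < cmod (F x) + 1 by rewrite ltr_wpDl ?cmod_ge0.
  exists (Num.min d (cmod (F x) + 1)^-1) => [|y /andP[_ y1]].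
    by rewrite lt_min d0 invr_gt0.
  rewrite lt_min => /andP[yx _] m0.
  apply: (@le_trans _ _ (cmod (F x) + 1)).
    have := dP x y x1 y1 yx; have := cmodD (F y - F x) (F x); rewrite subrK; lra.
  rewrite -[leLHS]invrK lef_pV2 ?posrE ?invr_gt0//.
  by rewrite ge_min lexx orbT.
exists d1^-1 => [|x x1]; first by rewrite invr_gt0.
by apply: d1P => //; exact: cmod_range.
Qed.

Lemma cont_circ_F (r : R) : 0 < r -> r <= 1 -> cont_circ r F.
Proof.
move=> r0 r1 t _; apply/continuous_curve_cmodP => e e0.
have [d d0 dP] := uniformly_continuous_disc e0.
have := @continuous_radial R r t.
move=> /continuous_curve_cmodP/(_ _ d0)[h h0 hP].
exists h => // s st; apply: dP; rewrite ?cmod_polar ?(ltW r0)//.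
exact: hP.
Qed.

Definition fejer_coef N (r : R) (j l : nat) : Cplx R :=
  N.+1%:R^-1 * cmean r (fun x => F x * (x ^+ l * x^-1 ^+ j)).

(** In each row [j] the indices [j - l] are distinct, so the moduli in that row add up to at most
    the whole series divided by [N.+1]; there are [N.+1] rows. *)
Lemma fejer_coef_circle N (r : R) z : 0 < r -> r <= 1 -> cmod z = 1 ->
  cmod (laurent N (fejer_coef N r) z) < 1.
Proof.
move=> r0 r1 z1; pose phi n := cmod (fourier_coef F r n) / r ^ n.
have phi0 n : 0 <= phi n by rewrite divr_ge0 ?cmod_ge0// exprz_ge0// ltW.
have sF : (\esum_(n in [set: int]) (phi n)%:E < 1)%E := sumF r0 r1.
have s0 : (0 <= \esum_(n in [set: int]) (phi n)%:E)%E.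
  by apply: esum_ge0 => n _; rewrite lee_fin.
set S := (\esum_(n in _) _)%E in sF s0.
have Sfin : S \is a fin_num.
  by rewrite ge0_fin_numE// (lt_trans sF)// ltry.
have S1 : fine S < 1 by rewrite -lte_fin fineK.
apply: le_lt_trans S1.
have row (j : 'I_N.+1) : \sum_(l < N.+1) cmod (fejer_coef N r j l) <=
    N.+1%:R^-1 * fine S.
  have -> : \sum_(l < N.+1) cmod (fejer_coef N r j l) =
      N.+1%:R^-1 * \sum_(n <- [seq j%:Z - l%:Z | l <- iota 0 N.+1]) phi n.
    rewrite big_map mulr_sumr -[iota 0 N.+1]/(index_iota 0 N.+1) big_mkord.
    apply: eq_bigr => l _.
    rewrite /fejer_coef cmodM cmodV cmod_natr cmod_cmean_fourier//.
    exact: cont_circ_F.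
  apply: ler_wpM2l; first by rewrite invr_ge0.
  rewrite -lee_fin fineK//; apply: sum_le_esum => //.
  rewrite map_inj_uniq ?iota_uniq// => x y /= /(congr1 (fun n => j%:Z - n)).
  by rewrite !subKr => -[].
apply: (le_trans (cmod_sum _ _ _)).
apply: (@le_trans _ _ (\sum_(j < N.+1) N.+1%:R^-1 * fine S)).
  apply: ler_sum => j _; apply: le_trans (row j).
  apply: (le_trans (cmod_sum _ _ _)); apply: ler_sum => l _.
  have zz1 : cmod (z ^+ j * z^-1 ^+ l) = 1.
    by rewrite cmodM !cmodX cmodV z1 invr1 !expr1n mulr1.
  by rewrite (cmodM (fejer_coef N r j l)) zz1 mulr1.
by rewrite sumr_const card_ord -[leLHS]mulr_natl mulrA mulfV ?mul1r// pnatr_eq0.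
Qed.

(** The mean over [|x| = r'] is pulled back to [|x| = r] by radial scaling, after which uniform
    continuity of the integrand near the circle suffices; only finitely many coefficients are
    involved. *)
Lemma fejer_coef_continuous N (r1 r e : R) : 0 < r1 -> r1 <= r <= 1 -> 0 < e ->
  exists2 h : R, 0 < h & forall r', r1 <= r' <= 1 -> `|r' - r| < h ->
    coef_close N (fejer_coef N r) (fejer_coef N r') e.
Proof.
move=> r10 rr e0.
pose G j l x := F x * (x ^+ l * x^-1 ^+ j).
pose P j l h := forall r', r1 <= r' <= 1 -> `|r' - r| < h ->
  cmod (fejer_coef N r' j l - fejer_coef N r j l) <= e.
have mono j l d d' : d' <= d -> P j l d -> P j l d'.
  by move=> dd H r' r'r rd; apply: H => //; exact: lt_le_trans dd.
have one j l : exists2 h : R, 0 < h & P j l h.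
  have [||d d0 dP] := @annulus_uniform R r r (fun x d => forall y,
      cmod y <= 1 -> cmod (y - x) < d -> cmod (G j l y - G j l x) <= e).
  - by move=> x d d' dd H y yr yx; apply: H => //; exact: lt_le_trans dd.
  - move=> x; rewrite -eq_le eq_sym => /eqP xr.
    have x1 : cmod x <= 1 by rewrite xr; case/andP: rr.
    have x0 : x != 0.
      by rewrite -cmod_gt0 xr; case/andP: rr => h _; exact: lt_le_trans h.
    pose q (x : Cplx R) := x ^+ l * x^-1 ^+ j.
    have dq : {for x, continuous q}.
      apply: differentiable_continuous.
      exact: (differentiable_mul (differentiable_pow l (differentiable_var x))
        (differentiable_pow j (differentiable_inv (differentiable_var x) x0))).
    have [B B0 BP] := bounded_disc.
    pose Q := cmod (q x); have Q0 : 0 <= Q by exact: cmod_ge0.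
    have Q1 : 0 < Q + 1 by rewrite ltr_wpDl.
    have eB : 0 < e / (4 * B) by rewrite divr_gt0// mulr_gt0.
    have eQ : 0 < e / (4 * (Q + 1)) by rewrite divr_gt0// mulr_gt0.
    have /continuous_cmodP/(_ _ eB)[d1 d10 d1P] := dq.
    have [d2 d20 d2P] := cF x1 eQ.
    pose d := Num.min d1 d2.
    have dd1 : d <= d1 by rewrite ge_min lexx.
    have dd2 : d <= d2 by rewrite ge_min lexx orbT.
    have d0 : 0 < d by rewrite lt_min d10.
    have half y : cmod y <= 1 -> cmod (y - x) < d ->
        cmod (G j l y - G j l x) <= e / 2.
      move=> y1 yx.
      have -> : G j l y - G j l x = F y * (q y - q x) + (F y - F x) * q x.
        have K (p p' s s' : Cplx R) : p * s - p' * s' = p * (s - s') + (p - p') * s'.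
          by ring.
        exact: K.
      apply: (le_trans (cmodD _ _)).
      rewrite (cmodM (F y)) (cmodM (F y - F x)).
      have h1 : cmod (F y) * cmod (q y - q x) <= B * (e / (4 * B)).
        apply: ler_pM; rewrite ?cmod_ge0 ?BP//; apply: ltW; apply: d1P.
        exact: lt_le_trans dd1.
      have h2 : cmod (F y - F x) * cmod (q x) <= e / (4 * (Q + 1)) * (Q + 1).
        apply: ler_pM; rewrite ?cmod_ge0//; last by rewrite -/Q; lra.
        by apply: ltW; apply: d2P => //; exact: lt_le_trans dd2.
      have E1 : B * (e / (4 * B)) = e / 4 by field; exact: lt0r_neq0.
      have E2 : e / (4 * (Q + 1)) * (Q + 1) = e / 4 by field; exact: lt0r_neq0.
      apply: (le_trans (lerD h1 h2)); rewrite E1 E2; lra.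
    exists (d / 2) => [|x']; first by rewrite divr_gt0.
    rewrite -eq_le eq_sym => /eqP x'r x'x y y1 yx'.
    have yx : cmod (y - x) < d by have := cmod_dist y x x'; lra.
    have x'1 : cmod x' <= 1 by rewrite x'r -xr.
    have h1 := half y y1 yx; have h2 : cmod (G j l x' - G j l x) <= e / 2.
      by apply: half => //; lra.
    exact: (cmod_dist_half h1 h2).
  exists d => // r' r'r rd.
  have [r1r r_1] := andP rr; have [r1r' r'_1] := andP r'r.
  have r0 : 0 < r by exact: lt_le_trans r1r.
  have r'0 : 0 < r' by exact: lt_le_trans r1r'.
  have rcr t : r <= cmod (r%:C * cis t) <= r.
    by rewrite cmod_polar ?(ltW r0)// lexx.
  have r'c t : cmod (r'%:C * cis t) <= 1 by rewrite cmod_polar ?(ltW r'0).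
  have dist t : cmod (r'%:C * cis t - r%:C * cis t) < d.
    by rewrite -mulrBl -rmorphB cmodM cmod_cis mulr1 cmod_real.
  have cG s : 0 < s -> s <= 1 -> cont_circ s (G j l).
    by move=> s0 s1; exact: (cont_circM (cont_circ_F s0 s1) (@cont_circ_mono R s l j)).
  pose G' x := G j l ((r' / r)%:C * x).
  have G'E t : G' (r%:C * cis t) = G j l (r'%:C * cis t) by exact: scaled_circle.
  have cG' : cont_circ r G' by apply: cont_circ_scale => //; exact: cG.
  have E : cmean r' (G j l) = cmean r G' by exact: cmean_scale.
  rewrite /fejer_coef -/(G j l) -mulrBr cmodM cmodV cmod_natr.
  rewrite -[cmean r' _]/(cmean r' (G j l)) E -(cmeanB cG' (cG r r0 r_1)).
  apply: (@le_trans _ _ (1 * e)); last by rewrite mul1r.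
  have Ni0 : 0 <= N.+1%:R^-1 :> R by rewrite invr_ge0.
  have Ni1 := inv_succ_le1 N.
  apply: (ler_pM Ni0 (cmod_ge0 _) Ni1).
  apply: (cmod_cmean_le (cont_circB cG' (cG r r0 r_1))) => t _.
  rewrite G'E; exact: (dP _ (rcr t) _ (r'c t) (dist t)).
have [||h h0 hP] := @finite_min N (fun j h => forall l, (l <= N)%N -> P j l h).
- by move=> j d d' dd H l lN; exact: (mono _ _ _ _ dd (H l lN)).
- move=> j jN; apply: finite_min => [l d d'|l lN]; last exact: one.
  exact: mono.
by exists h => // r' r'r rd j l jN lN; apply: (hP j jN l lN).
Qed.

End Assembly.

(** * Vanishing of the moments on the unit circle *)

Section Vanishing.
Variable R : realType.
Local Notation "x %:C" := (x%:C%C : Cplx R).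
Variables (F : Cplx R -> Cplx R) (Om : set (Cplx R * Cplx R))
  (f : Cplx R * Cplx R -> Cplx R).
Hypothesis cF : forall x, cmod x <= 1 -> forall e : R, 0 < e ->
  exists2 d : R, 0 < d & forall y, cmod y <= 1 -> cmod (y - x) < d ->
    cmod (F y - F x) < e.
Hypothesis sumF : forall r : R, 0 < r -> r <= 1 ->
  (\esum_(n in [set: int]) (cmod (fourier_coef F r n) / r ^ n)%:E < 1)%E.
Hypotheses (oOm : open Om) (hf : holomorphic_on Om f).
Hypothesis graphOm : forall z, cmod z <= 1 -> Om (z, F z).
Hypothesis circOm : circle `*` disc `<=` Om.

Lemma graph_uniform_tube : exists2 d : R, 0 < d &
  forall z v, cmod z <= 1 -> cmod (v - F z) < d -> Om (z, v).
Proof.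
have [||d d0 dP] := @annulus_uniform R (-1) 1 (fun z d => forall v,
    cmod (v - F z) < d -> Om (z, v)).
- by move=> x d d' dd H v vx; apply: H; exact: lt_le_trans dd.
- move=> x /andP[_ x1]; have [d d0 dP] := open2_cmod oOm (graphOm x1).
  have d20 : 0 < d / 2 by rewrite divr_gt0.
  have [d1 d10 d1P] := cF x1 d20.
  exists (Num.min (d / 2) d1) => [|y /andP[_ y1]]; first by rewrite lt_min d20.
  rewrite lt_min => /andP[yd yd1] v; rewrite lt_min => /andP[vd _].
  apply: dP; first by apply: (lt_trans yd); lra.
  apply: (le_lt_trans (cmod_dist _ _ (F y))); rewrite [ltRHS]splitr.
  by apply: ltrD => //; exact: d1P.
exists d => // z v z1; apply: dP; exact: cmod_range.
Qed.

(** The error in [fejer_approx] increases with [r], so its value at [r = 1] determines one degree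
    for all radii. *)
Lemma fejer_uniform (e : R) : 0 < e -> exists N, forall (r : R) z,
  0 < r -> r <= 1 -> cmod z = r -> cmod (fejer N r F z - F z) <= e.
Proof.
move=> e0; have e20 : 0 < e / 2 by rewrite divr_gt0.
have [d d0 dP] := uniformly_continuous_disc cF e20.
have [B B0 BP] := bounded_disc cF.
have X0 : 0 <= 16 * B / (d ^+ 2 * e).
  by rewrite divr_ge0 ?mulr_ge0 ?sqr_ge0// ltW.
have := archi_boundP X0; set N := Num.bound _ => NP.
exists N => r z r0 r1 zr.
have rc t : cmod (r%:C * cis t) = r by rewrite cmod_polar// ltW.
have z1 : cmod z <= 1 by rewrite zr.
have H := fejer_approx N r0 zr d0 (ltW e20) (cont_circ_F cF r0 r1)
  (fun t _ => BP (r%:C * cis t) (eq_ind_r (fun x => x <= 1) r1 (rc t))) (BP z z1)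
  (fun t h => ltW (dP z (r%:C * cis t) z1 (eq_ind_r (fun x => x <= 1) r1 (rc t)) h)).
apply: (le_trans H); rewrite [leRHS]splitr lerD2l.
have d20 : 0 < d ^+ 2 by rewrite exprn_gt0.
have N0 : 0 < N.+1%:R * d ^+ 2 by rewrite mulr_gt0.
rewrite ler_pdivrMr//.
have r2 : r ^+ 2 <= 1 by rewrite exprn_ile1// ltW.
apply: (@le_trans _ _ (8 * B * 1)); first by apply: ler_wpM2l => //; lra.
rewrite ltr_pdivrMr ?mulr_gt0// in NP.
have h1 : N%:R * (d ^+ 2 * e) <= N.+1%:R * (d ^+ 2 * e).
  by apply: ler_wpM2r; [rewrite mulr_ge0// ltW|rewrite ler_nat].
lra.
Qed.

Lemma circle_moments_vanish m w : cmod w < 1 ->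
  cmean 1 (fun z => f (z, w) * z ^+ m.+1) = 0.
Proof.
have z01 : cmod (0 : Cplx R) <= 1 by rewrite cmod0.
have [eps eps0 epsP] := open2_cmod oOm (graphOm z01).
have e40 : 0 < eps / 4 by rewrite divr_gt0.
have [d1 d10 d1P] := cF z01 e40.
have [d2 d20 d2P] := graph_uniform_tube.
(* [d1] keeps [F] within [eps / 4] of [F 0] on [|z| <= r1], and [eps] puts the product of this disc
   with the ball of radius [eps] about [F 0] inside [Om]. *)
pose r1 := Num.min (1 / 2) (Num.min (d1 / 2) (eps / 2)).
have r10 : 0 < r1 by rewrite !lt_min !divr_gt0.
have r1_2 : r1 <= 1 / 2 by rewrite ge_min lexx.
have r1_d : r1 <= d1 / 2 by rewrite !ge_min lexx orbT.
have r1_e : r1 <= eps / 2 by rewrite !ge_min lexx !orbT.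
have r11 : r1 < 1 by lra.
(* [d2] keeps the Fejér graphs in the tube around the graph of [F]; [eps / 4] keeps the values over
   [|z| = r1] within [eps] of [F 0]. *)
pose eta := Num.min (d2 / 2) (eps / 4).
have eta0 : 0 < eta by rewrite lt_min !divr_gt0.
have etad : eta <= d2 / 2 by rewrite ge_min lexx.
have etae : eta <= eps / 4 by rewrite ge_min lexx orbT.
have [N NP] := fejer_uniform eta0.
pose a r := fejer_coef F N r.
have aE r z : laurent N (a r) z = fejer N r F z.
  by rewrite fejer_laurent.
have rpos r : r1 <= r <= 1 -> 0 < r /\ r <= 1.
  by move=> /andP[h ->]; split => //; exact: lt_le_trans h.
have near0 z : cmod z <= r1 -> cmod (F z - F 0) < eps / 4.
  by move=> zr; apply: d1P; rewrite ?subr0; lra.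
(* This mean is a Fejér mean of degree [0], so [fejer_coef_circle] puts it in the open disc. The
   value [F 0] would not do: it is [1] for [F z = 1 - |z|]. *)
pose w1 := cmean r1 F.
have w1E : laurent 0 (fejer_coef F 0 r1) 1 = w1.
  rewrite /laurent big_ord1 big_ord1 /fejer_coef /= invr1 !expr0 !mul1r !mulr1.
  by apply: eq_cmean => t; rewrite ?expr0 !mulr1.
have w11 : cmod w1 < 1.
  by rewrite -w1E; apply: (fejer_coef_circle cF sumF) => //; [exact: ltW|exact: cmod1].
have cF1 := cont_circ_F cF r10 (ltW r11).
have w1e : cmod (w1 - F 0) < eps.
  rewrite /w1 -(cmean_cst r1 (F 0)) -(cmeanB cF1 (@cont_circ_cst R r1 (F 0))).
  apply: (@le_lt_trans _ _ (eps / 4)); last by lra.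
  apply: (cmod_cmean_le (cont_circB cF1 (@cont_circ_cst R r1 (F 0)))) => t _.
  by apply: ltW; apply: near0; rewrite cmod_polar// ltW.
pose f' (p : Cplx R * Cplx R) : Cplx R := f p * p.1 ^+ m.+1.
have hf' : holomorphic_on Om f'.
  move=> p Op; exact: (differentiable_mul (hf Op)
    (differentiable_pow m.+1 (differentiable_fst p))).
have center z v : cmod z <= r1 -> cmod (v - F 0) < eps -> Om (z, v).
  by move=> zr vF; apply: epsP; rewrite ?subr0//; lra.
suff H : forall v, cmod v < 1 -> cmean 1 (fun z => f' (z, v)) = 0 by exact: H.
apply: (@circle_mean_vanishes R Om f' oOm hf' circOm r1 N a r10 r11 _ _ _
  (F 0) eps center _ w1 w11 w1e).
- move=> r z rr z1; have [r0 r_1] := rpos r rr.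
  exact: (fejer_coef_circle cF sumF).
- move=> r z rr zr; have [r0 r_1] := rpos r rr.
  rewrite aE; apply: d2P; first by rewrite zr.
  by apply: (le_lt_trans (NP r z r0 r_1 zr)); lra.
- move=> r e rr e0; exact: (fejer_coef_continuous cF N r10 rr e0).
- move=> z zr; rewrite aE.
  have h1 := NP r1 z r10 (ltW r11) zr.
  have h2 : cmod (F z - F 0) < eps / 4 by apply: near0; rewrite zr.
  apply: (le_lt_trans (cmod_dist _ _ (F z))).
  have h3 : eta + eps / 4 < eps by lra.
  by apply: lt_trans h3; exact: ler_ltD.
(* It remains to treat the inner means: along a constant graph [f] is bounded on [|z| <= r1], so
   [cmean_punctured_disc] applies. *)
move=> v v1 vF.
have [||M M0 MP] := @annulus_uniform R (-1) r1 (fun z d => 0 < d ->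
    cmod (f (z, v)) <= d^-1).
- move=> x e e' ee H e'0; apply: (le_trans (H (lt_le_trans e'0 ee))).
  by rewrite lef_pV2 ?posrE// (lt_le_trans e'0 ee).
- move=> x /andP[_ xr].
  have [d d0 dP] := holomorphic_locally_bounded oOm hf (center x v xr vF).
  exists d => // y _ yx _; have [||_] // := dP y v.
  by rewrite subrr cmod0.
rewrite /f' /=.
apply: (@cmean_punctured_disc R (fun z => f (z, v)) r1 M^-1 m r10).
  move=> z /andP[_ zr].
  exact: (differentiable_comp2 (differentiable_var z) (differentiable_const v z)
    (hf (center z v zr vF))).
move=> z /andP[z0 zr]; apply: MP => //; rewrite zr andbT.
by apply: le_trans (cmod_ge0 z); rewrite lerN10.
Qed.

End Vanishing.

Theorem theorem1p1 (R : realType) (F : Cplx R -> Cplx R)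
    (Omega1 Omega2 : set (Cplx R * Cplx R)) (f : Cplx R * Cplx R -> Cplx R) :
  {within closed_disc, continuous F} ->
  (ereal_sup [set (cmod (F z))%:E | z in circle] < 1)%E ->
  (forall r : R, 0 < r -> r <= 1 ->
    (\esum_(n in [set: int]) (cmod (fourier_coef F r n) / r ^ n)%:E < 1)%E) ->
  open Omega1 ->
  graph_over_closed_disc F `|` circle `*` disc `<=` Omega1 ->
  open Omega2 ->
  connected Omega2 ->
  Omega2 `<=` [set: Cplx R] `*` disc ->
  circle `*` disc `<=` closure Omega2 `&` ([set: Cplx R] `*` disc) ->
  closure Omega2 `&` ([set: Cplx R] `*` disc)
    `<=` Omega1 `&` ([set z : Cplx R | 1 <= `|z|] `*` disc) ->
  holomorphic_on Omega1 f ->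
  exists (W : set (Cplx R * Cplx R)) (g : Cplx R * Cplx R -> Cplx R),
    [/\ open W,
        closed_disc `*` disc `|` Omega2 `<=` W,
        holomorphic_on W g
      & forall p, Omega2 p -> g p = f p].
Proof.
move=> cF _ sumF oOm1 graphOm oOm2 _ Om2disc _ clOm2 hf.
have circOm : circle `*` disc `<=` Omega1.
  by move=> p pc; apply: graphOm; right.
have cF' x : cmod x <= 1 -> forall e : R, 0 < e ->
  exists2 d : R, 0 < d & forall y, cmod y <= 1 -> cmod (y - x) < d ->
    cmod (F y - F x) < e.
  move=> x1 e e0; have closedE z : closed_disc z = (cmod z <= 1) :> Prop.
    by rewrite /closed_disc /= -cmodE (lecR _ 1).
  have x1' : closed_disc x by rewrite closedE.
  have /subspace_continuousP/(_ x x1') cFx := cF.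
  have : nbhs (F x) [set y | cmod (y - F x) < e].
    by apply/nbhs_cmodP; exists e.
  move=> /cFx; rewrite /= nbhs_simpl /within /= => /nbhs_cmodP[d d0 dP].
  by exists d => // y y1 yx; apply: dP => //; rewrite closedE.
have graphF z : cmod z <= 1 -> Omega1 (z, F z).
  move=> z1; apply: graphOm; left; exists z => //.
  by rewrite /closed_disc /= -cmodE (lecR _ 1).
apply: (extension oOm1 hf circOm) => //.
- move=> w m; exact: (circle_moments_vanish cF' sumF oOm1 hf graphF circOm).
(* [Omega2] lies in its relative closure and inherits both inclusions from it. *)
- by move=> p p2; have [] := clOm2 p (conj (subset_closure p2) (Om2disc p p2)).
- move=> p p2; have [_ []] := clOm2 p (conj (subset_closure p2) (Om2disc p p2)).
  by rewrite /= -cmodE (lecR 1).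
Qed.
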